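(* Let $\lambda\in P$, let $V^q$ be a highest weight $U_q(\mathfrak g)$-module with highest weight $\lambda$ and highest weight vector $v_\lambda$, and let $V^1$, $V^1_\mu$ $(\mu\in P)$ be its classical limit and the classical limits of its weight spaces. (a) The elements $\overline s_{il},\overline T_{il}$ $((i,l)\in I^\infty)$ and $\overline h$ $(h\in P^\vee)$ of $U_1$ satisfy the defining relations of $U(\mathfrak g)$. Hence there exists a surjective $\mathbb Q$-algebra homomorphism $\psi:U(\mathfrak g)\to U_1$ sending $e_{il}$ to $\overline s_{il}$, $f_{il}$ to $\overline T_{il}$, and $h$ to $\overline h$. In particular, the $U_1$-module $V^1$ has a $U(\mathfrak g)$-module structure. (b) For each $\mu\in P$ and $h\in P^\vee$, the element $\overline h$ acts on $V^1_\mu$ as scalar multiplication by $\mu(h)$. So $V^1_\mu$ is the $\mu$-weight space of the $U(\mathfrak g)$-module $V^1$. (c) As a $U(\mathfrak g)$-module, $V^1$ is a highest weight module with highest weight $\lambda$ and highest weight vector $\overline v_\lambda$.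
   Context: **Cartan datum.** $I$ is a countable (possibly infinite) index set; $A=(a_{ij})_{i,j\in I}$ is an integer matrix with $a_{ii}\in\{2,0,-2,-4,\dots\}$, $a_{ij}\le 0$ for $i\ne j$, and there are positive integers $r_i$ with $r_ia_{ij}=r_ja_{ji}$. $I^{re}=\{i:a_{ii}=2\}$, $I^{im}=\{i:a_{ii}\le0\}$, $I^\infty=(I^{re}\times\{1\})\cup(I^{im}\times\mathbb Z_{>0})$; for $i\in I^{re}$ write $i$ for $(i,1)$. $P^\vee$ is the free abelian group with basis $\{h_i,d_i: i\in I\}$, $\mathfrak h=\mathbb Q\otimes_{\mathbb Z}P^\vee$, $P=\{\lambda\in\mathfrak h^*:\lambda(P^\vee)\subseteq\mathbb Z\}$. The simple roots $\alpha_i\in P$ satisfy $\alpha_j(h_i)=a_{ij}$, $\alpha_j(d_i)=\delta_{ij}$. $(\ ,\ )$ is the symmetric bilinear form with $(\alpha_i,\lambda)=r_i\lambda(h_i)$, so $(\alpha_i,\alpha_j)=r_ia_{ij}$. **Borcherds-Bozec algebra.** $\mathfrak g$ is the Lie algebra over $\mathbb Q$ generated by $e_{il},f_{il}$ $((i,l)\in I^\infty)$ and $\mathfrak h$ with relations: $[h,h']=0$; $[e_{ik},f_{jl}]=k\delta_{ij}\delta_{kl}h_i$; $[h,e_{jl}]=l\alpha_j(h)e_{jl}$, $[h,f_{jl}]=-l\alpha_j(h)f_{jl}$; $(\mathrm{ad}\,e_i)^{1-la_{ij}}(e_{jl})=0=(\mathrm{ad}\,f_i)^{1-la_{ij}}(f_{jl})$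 for $i\in I^{re}$, $i\ne(j,l)$; $[e_{ik},e_{jl}]=[f_{ik},f_{jl}]=0$ if $a_{ij}=0$. $U(\mathfrak g)$ is its universal enveloping algebra, i.e. the associative unital $\mathbb Q$-algebra with these generators and relations (brackets read as commutators). **Quantum Borcherds-Bozec algebra.** $q$ is an indeterminate, $q_i=q^{r_i}$, $q_{(i)}=q^{(\alpha_i,\alpha_i)/2}$; for $i\in I^{re}$, $[n]_i=\frac{q_i^n-q_i^{-n}}{q_i-q_i^{-1}}$, with the associated $q$-factorials $[n]_i!$ and $q$-binomials. $\mathscr F$ is the free associative $\mathbb Q(q)$-algebra on $f_{il}$ $((i,l)\in I^\infty)$, graded by $|f_{il}|=-l\alpha_i$, and $\mathscr F\otimes\mathscr F$ has the twisted product $(x_1\otimes x_2)(y_1\otimes y_2)=q^{-(|x_2|,|y_1|)}x_1y_1\otimes x_2y_2$; $\delta:\mathscr F\to\mathscr F\otimes\mathscr F$ is the algebra map $\delta(f_{il})=\sum_{m+n=l}q_{(i)}^{-mn}f_{im}\otimes f_{in}$ (with $f_{i0}=1$). Fix nonzero $\nu_{il}\in\mathbb Q(q)$ with $\nu_{il}\in1+q\mathbb Z_{\ge0}[[q]]$. $(\ ,\ )_L$ is the symmetric bilinear form on $\mathscr F$ with $(x,y)_L=0$ if $|x|\ne|y|$, $(1,1)_L=1$, $(f_{il},f_{il})_L=\nu_{il}$, $(x,yz)_L=(\delta(x),y\otimes z)_L$. $\widehat U$ is the $\mathbb Q(q)$-algebra generated by $q^h$ $(h\in P^\vee)$, $e_{il},f_{il}$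 $((i,l)\in I^\infty)$ with relations $q^0=1$, $q^hq^{h'}=q^{h+h'}$, $q^he_{jl}q^{-h}=q^{l\alpha_j(h)}e_{jl}$, $q^hf_{jl}q^{-h}=q^{-l\alpha_j(h)}f_{jl}$; $\sum_{k=0}^{1-la_{ij}}(-1)^k\begin{bmatrix}1-la_{ij}\\k\end{bmatrix}_ix_i^{1-la_{ij}-k}x_{jl}x_i^k=0$ for $x=e$ and $x=f$, $i\in I^{re}$, $i\ne(j,l)$; $[e_{ik},e_{jl}]=[f_{ik},f_{jl}]=0$ if $a_{ij}=0$. With $K_i=q_i^{h_i}=q^{r_ih_i}$, its comultiplication is $\Delta(q^h)=q^h\otimes q^h$, $\Delta(e_{il})=\sum_{m+n=l}q_{(i)}^{mn}e_{im}\otimes K_i^{-m}e_{in}$, $\Delta(f_{il})=\sum_{m+n=l}q_{(i)}^{-mn}f_{im}K_i^n\otimes f_{in}$. $\omega$ is the involution $q^h\mapsto q^{-h}$, $e_{il}\leftrightarrow f_{il}$. The form $(\ ,\ )_L$ extends to $\widehat U$ (Bozec) with $(q^h,1)_L=1$, $(q^h,f_{il})_L=0$, $(q^h,K_j)_L=q^{-\alpha_j(h)}$, $(x,y)_L=(\omega(x),\omega(y))_L$ for $x,y$ in the subalgebra $\widehat U^+$ generated by the $e_{il}$, and on the subalgebra $\widehat U^{\le0}$ generated by the $f_{il},q^h$ it is compatible with $\Delta$: $(x,yz)_L=(\Delta(x),y\otimes z)_L$. $\widetilde U$ is the quotient of $\widehat U$ by the relations (Sweedler notation) $\sum(a_{(1)},b_{(2)})_L\,\omega(b_{(1)})a_{(2)}=\sum(a_{(2)},b_{(1)})_L\,a_{(1)}\omega(b_{(2)})$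 for $a,b\in\widehat U^{\le0}$. The quantum Borcherds-Bozec algebra $U_q(\mathfrak g)$ is the quotient of $\widetilde U$ by the radical of $(\ ,\ )_L$ restricted to $\widetilde U^-\times\widetilde U^+$. $U^+$, $U^-$ denote the subalgebras generated by the $e_{il}$, the $f_{il}$ respectively. **Primitive generators.** (Bozec) For $i\in I^{im}$, $l\ge1$ there are unique $t_{il}\in U^-$ of degree $-l\alpha_i$ and $s_{il}=\omega(t_{il})\in U^+$ such that $t_{il}-f_{il}$ lies in the subalgebra generated by $f_{ik}$, $k<l$, and $(t_{il},z)_L=0$ for all $z$ in that subalgebra. For $i\in I^{re}$ put $t_{i1}=f_{i1}$, $s_{i1}=e_{i1}$. Put $\tau_{il}=(t_{il},t_{il})_L\neq0$. Then $s_{il}t_{jk}-t_{jk}s_{il}=\delta_{ij}\delta_{lk}\tau_{il}(K_i^l-K_i^{-l})$. **$\mathbb A_1$-forms and classical limits.** $\mathbb A_1=\{g/h:g,h\in\mathbb Q[q],h(1)\ne0\}$, with maximal ideal $\mathbb J_1=(q-1)$ and $\mathbb A_1/\mathbb J_1\cong\mathbb Q$. Put $(q^h;0)_q=\frac{q^h-1}{q-1}$ and $T_{il}=\frac1{\tau_{il}}\frac1{q_i^2-1}t_{il}$. $U_{\mathbb A_1}$ is the $\mathbb A_1$-subalgebra of $U_q(\mathfrak g)$ generated by $s_{il},T_{il},q^h,(q^h;0)_q$ for $(i,l)\in I^\infty$, $h\in P^\vee$. A highest weight $U_q(\mathfrak g)$-module of highest weight $\lambda$ is $V^q=U_q(\mathfrak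 g)v_\lambda$ with $v_\lambda\ne0$, $e_{il}v_\lambda=0$ for all $(i,l)$, $q^hv_\lambda=q^{\lambda(h)}v_\lambda$; highest weight $\mathfrak g$-modules are defined analogously ($hv_\lambda=\lambda(h)v_\lambda$). $V^q_\mu=\{v:q^hv=q^{\mu(h)}v\ \forall h\in P^\vee\}$, $V_{\mathbb A_1}=U_{\mathbb A_1}v_\lambda$, $(V_{\mathbb A_1})_\mu=V_{\mathbb A_1}\cap V^q_\mu$. $U_1=(\mathbb A_1/\mathbb J_1)\otimes_{\mathbb A_1}U_{\mathbb A_1}$, $V^1=(\mathbb A_1/\mathbb J_1)\otimes_{\mathbb A_1}V_{\mathbb A_1}$ (a $U_1$-module), $V^1_\mu=(\mathbb A_1/\mathbb J_1)\otimes_{\mathbb A_1}(V_{\mathbb A_1})_\mu$. $\overline x$ denotes the image of $x$ in $U_1$ or $V^1$, and for $h\in P^\vee$, $\overline h\in U_1$ denotes the image of $(q^h;0)_q$; the map $h\mapsto\overline h$ is additive and is extended $\mathbb Q$-linearly to $\mathfrak h$.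
   Formalization: As no form as described exists over Q(q) when some r_j > 1, its compatibility with Δ is required only when x, or both y and z, lie in the subalgebra generated by the f_il and K_i^{±1}, and the relations defining Ũ only when a or b does; for all r_j = 1 the algebra is unchanged. *)

(* Defs.v *)
From HB Require Import structures.
From mathcomp Require Import all_boot all_order all_algebra generic_quotient.
From mathcomp Require Import finmap monalg.
From mathcomp.classical Require Import boolp.

Set Implicit Arguments.
Unset Strict Implicit.
Unset Printing Implicit Defensive.

Import Order.TTheory GRing.Theory Num.Theory.
Local Open Scope ring_scope.
Local Open Scope quotient_scope.

(* An associative unital R-algebra, given by its structure map. MathComp's
   algType requires 1 != 0, which is not known beforehand for an algebra given
   by generators and relations; this is why it is not used here. *)
HB.mixin Record isPzAlgebra (R : pzRingType) A of GRing.PzRing A := {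
  scal : R -> A;
  scal_is_zmod : zmod_morphism scal;
  scal_is_monoid : monoid_morphism scal;
  scalC : forall (c : R) (x : A), scal c * x = x * scal c
}.
#[short(type="pzAlgType")]
HB.structure Definition PzAlgebra (R : pzRingType) :=
  {A of GRing.PzRing A & isPzAlgebra R A}.

HB.instance Definition _ (R : pzRingType) (A : pzAlgType R) :=
  GRing.isZmodMorphism.Build R A (@scal R A) scal_is_zmod.
HB.instance Definition _ (R : pzRingType) (A : pzAlgType R) :=
  GRing.isMonoidMorphism.Build R A (@scal R A) scal_is_monoid.

Definition alg_hom (R : pzRingType) (A B : pzAlgType R) (f : A -> B) : Prop :=
  [/\ zmod_morphism f, monoid_morphism f & forall c : R, f (scal c) = scal c].

Section AlgMod.
Variables (R : pzRingType) (A : pzAlgType R).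
Definition algmod : Type := A.
HB.instance Definition _ := GRing.Zmodule.on algmod.
Definition algmod_scale (c : R) (x : algmod) : algmod := scal c * (x : A).
Lemma algmod_scaleA a b x :
  algmod_scale a (algmod_scale b x) = algmod_scale (a * b) x.
Proof. by rewrite /algmod_scale rmorphM mulrA. Qed.
Lemma algmod_scale1 : left_id 1 algmod_scale.
Proof. by move=> x; rewrite /algmod_scale rmorph1 mul1r. Qed.
Lemma algmod_scaleDr : right_distributive algmod_scale +%R.
Proof. by move=> a x y; rewrite /algmod_scale mulrDr. Qed.
Lemma algmod_scaleDl x : {morph algmod_scale^~ x : a b / a + b}.
Proof. by move=> a b; rewrite /algmod_scale rmorphD mulrDl. Qed.
HB.instance Definition _ := GRing.Zmodule_isLmodule.Build R algmod
  algmod_scaleA algmod_scale1 algmod_scaleDr algmod_scaleDl.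
End AlgMod.

Section IdealQuotient.
Variables (R : pzRingType) (A : pzAlgType R) (G : A -> Prop).

Inductive ideal_gen : A -> Prop :=
| ideal_in x of G x : ideal_gen x
| ideal_0 : ideal_gen 0
| ideal_B x y of ideal_gen x & ideal_gen y : ideal_gen (x - y)
| ideal_Ml a x of ideal_gen x : ideal_gen (a * x)
| ideal_Mr x a of ideal_gen x : ideal_gen (x * a).

Definition ideal_pred : {pred A} := fun x => `[< ideal_gen x >].

Lemma ideal_zmod_closed : zmod_closed ideal_pred.
Proof.
split; first exact/asboolP/ideal_0.
by move=> x y /asboolP hx /asboolP hy; apply/asboolP/ideal_B.
Qed.
HB.instance Definition _ := GRing.isZmodClosed.Build A ideal_pred ideal_zmod_closed.

(* The quotient of A by the two-sided ideal generated by G *)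
Definition aquot : Type := Quotient.quot ideal_pred.
HB.instance Definition _ := GRing.Zmodule.on aquot.

Definition api : A -> aquot := \pi_(Quotient.quot ideal_pred).
Definition arepr : aquot -> A := fun x : Quotient.quot ideal_pred => repr x.

Lemma areprK x : api (arepr x) = x. Proof. exact: reprK. Qed.
Lemma api_eq x y : api x = api y <-> ideal_gen (x - y).
Proof.
rewrite /api; split => [h|h].
  apply/asboolP; change ((x - y) \in ideal_pred).
  by rewrite Quotient.idealrBE; apply/eqP.
by apply/eqP; rewrite -Quotient.idealrBE; apply/asboolP.
Qed.

Lemma api_is_zmod : zmod_morphism api.
Proof. exact: (raddfB (\pi_(Quotient.quot ideal_pred))). Qed.
HB.instance Definition _ := GRing.isZmodMorphism.Build A aquot api api_is_zmod.

Definition aone : aquot := api 1.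
Definition amul (x y : aquot) : aquot := api (arepr x * arepr y).

Lemma amul_pi x y : amul (api x) (api y) = api (x * y).
Proof.
apply/api_eq; set x' := arepr _; set y' := arepr _.
have -> : x' * y' - x * y = (x' - x) * y' - x * (y - y').
  by rewrite mulrBl mulrBr opprB addrA subrK.
apply: ideal_B; [apply: ideal_Mr | apply: ideal_Ml];
  by apply/api_eq; rewrite areprK.
Qed.

Lemma amulA : associative amul.
Proof.
by move=> x y z; rewrite -[x]areprK -[y]areprK -[z]areprK !amul_pi mulrA.
Qed.
Lemma amul1 : left_id aone amul.
Proof. by move=> x; rewrite -[x]areprK amul_pi mul1r. Qed.
Lemma amulr1 : right_id aone amul.
Proof. by move=> x; rewrite -[x]areprK amul_pi mulr1. Qed.
Lemma amulDl : left_distributive amul +%R.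
Proof.
move=> x y z; rewrite -[x]areprK -[y]areprK -[z]areprK.
by rewrite -raddfD !amul_pi -raddfD mulrDl.
Qed.
Lemma amulDr : right_distributive amul +%R.
Proof.
move=> x y z; rewrite -[x]areprK -[y]areprK -[z]areprK.
by rewrite -raddfD !amul_pi -raddfD mulrDr.
Qed.
HB.instance Definition _ :=
  GRing.Zmodule_isPzRing.Build aquot amulA amul1 amulr1 amulDl amulDr.

Lemma api_is_monoid : monoid_morphism api.
Proof. by split=> // x y; rewrite -amul_pi. Qed.
HB.instance Definition _ := GRing.isMonoidMorphism.Build A aquot api api_is_monoid.

Definition ascal (c : R) : aquot := api (scal c).
Lemma ascal_is_zmod : zmod_morphism ascal.
Proof. by move=> a b; rewrite /ascal !raddfB. Qed.
Lemma ascal_is_monoid : monoid_morphism ascal.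
Proof. by split=> [|a b]; rewrite /ascal ?rmorph1 ?rmorphM. Qed.
Lemma ascalC c x : ascal c * x = x * ascal c.
Proof. by rewrite -[x]areprK -!rmorphM scalC. Qed.
HB.instance Definition _ :=
  isPzAlgebra.Build R aquot ascal_is_zmod ascal_is_monoid ascalC.

(* A homomorphism killing G factors through aquot *)
Section Factor.
Variables (B : pzAlgType R) (f : A -> B).
Hypotheses (fhom : alg_hom f) (fG : forall x, G x -> f x = 0).

Lemma afactorE x : f (arepr (api x)) = f x.
Proof.
case: fhom => fB [_ fM] _; have f0 : f 0 = 0 by rewrite -(subrr 0) fB subrr.
apply/eqP; rewrite -subr_eq0 -fB; apply/eqP.
have : ideal_gen (arepr (api x) - x) by apply/api_eq; rewrite areprK.
by elim=> [y /fG //|//|y z _ hy _ hz|a y _ hy|y a _ hy];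
  rewrite ?fB ?fM ?hy ?hz ?subrr ?mulr0 ?mul0r.
Qed.
Lemma afactor_alg_hom : alg_hom (fun x => f (arepr x)).
Proof.
case: (fhom) => fB [f1 fM] fS; split; last by move=> c; rewrite afactorE fS.
  by move=> x y; rewrite -[x in LHS]areprK -[y in LHS]areprK -raddfB afactorE fB.
split; first by rewrite [arepr 1]/(arepr (api 1)) afactorE f1.
by move=> x y; rewrite -[x in LHS]areprK -[y in LHS]areprK -rmorphM afactorE fM.
Qed.
End Factor.

End IdealQuotient.
Arguments api {R A} G x.
Arguments arepr {R A} G x.

Section MalgExt.
Variables (R : nzRingType) (X : choiceType) (V : lmodType R) (c : X -> V).

Definition lext (x : {malg R[X]}) : V := \sum_(k <- msupp x) x@_k *: c k.

Lemma lextEw (d : {fset X}) x : (msupp x `<=` d)%fset ->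
  lext x = \sum_(k <- d) x@_k *: c k.
Proof.
move=> le; rewrite [LHS](big_fset_incl _ le) => //= k _ /mcoeff_outdom ->.
by rewrite scale0r.
Qed.

Lemma lextU a k : lext << a *g k >> = a *: c k.
Proof. by rewrite (lextEw msuppU_le) big_seq_fset1 mcoeffUU. Qed.

Lemma lext_is_zmod : zmod_morphism lext.
Proof.
move=> x y; set d := (msupp x `|` msupp y)%fset.
rewrite (lextEw (msuppB_le x y)) (@lextEw d x) ?(@lextEw d y);
  rewrite ?fsubsetUr ?fsubsetUl // -sumrB.
by apply: eq_bigr => k _; rewrite mcoeffB scalerBl.
Qed.
HB.instance Definition _ := GRing.isZmodMorphism.Build {malg R[X]} V lext lext_is_zmod.

Lemma lext_is_scalable : scalable lext.
Proof.
move=> a x; rewrite (lextEw (msuppZ_le a x)) scaler_sumr.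
by apply: eq_bigr => k _; rewrite mcoeffZ scalerA.
Qed.
HB.instance Definition _ :=
  GRing.isScalable.Build R {malg R[X]} V _ lext lext_is_scalable.
End MalgExt.

Definition words (X : choiceType) : Type := seq X.
HB.instance Definition _ (X : choiceType) := Choice.on (words X).
Lemma words_unit (X : choiceType) (u v : words X) :
  u ++ v = [::] -> u = [::] /\ v = [::].
Proof. by case: u => // ->. Qed.
HB.instance Definition _ (X : choiceType) :=
  Choice_isMonomialDef.Build (words X) (@catA X) (@cat0s X) (@cats0 X)
    (@words_unit X).

Section FreeAlgebra.
Variables (R : comNzRingType) (X : choiceType).

Definition falg : Type := {malg R[words X]}.
HB.instance Definition _ := GRing.Lalgebra.on falg.

Definition fscal (c : R) : falg := c%:MP.
Lemma fscal_is_zmod : zmod_morphism fscal.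
Proof. by move=> a b; rewrite /fscal monalgUB. Qed.
Lemma fscal_is_monoid : monoid_morphism fscal.
Proof. by split=> [|a b]; rewrite /fscal ?mpolyC1E ?mpolyCM. Qed.
Lemma fscalC c x : fscal c * x = x * fscal c.
Proof.
rewrite /fscal [x](@monalgE (words X) R) mulr_sumr mulr_suml.
apply: eq_bigr => k _; rewrite !malgM_def !fgmulUU mul1m mulm1 mulrC //.
Qed.
HB.instance Definition _ :=
  isPzAlgebra.Build R falg fscal_is_zmod fscal_is_monoid fscalC.

Definition fgen (x : X) : falg := << 1 *g ([:: x] : words X) >>.

Definition fext (A : pzAlgType R) (g : X -> A) (x : falg) : A :=
  @lext R (words X) (algmod A) (fun w => \prod_(a <- w) g a) x.

Section Ext.
Variables (A : pzAlgType R) (g : X -> A).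
Let wprod (w : words X) : A := \prod_(a <- w) g a.

Lemma fextU c (w : words X) : fext g << c *g w >> = scal c * wprod w.
Proof. exact: (@lextU R (words X) (algmod A)). Qed.
Lemma fext_is_zmod : zmod_morphism (fext g).
Proof. exact: (@lext_is_zmod R (words X) (algmod A)). Qed.
HB.instance Definition _ := GRing.isZmodMorphism.Build falg A (fext g) fext_is_zmod.

Lemma fext_alg_hom : alg_hom (fext g).
Proof.
have fS c : fext g (scal c) = scal c.
  by apply: etrans (fextU c [::]) _; rewrite /wprod big_nil mulr1.
split=> [||//]; first exact: fext_is_zmod.
split; first by have := fS 1; rewrite !rmorph1.
move=> x y; rewrite [x](@monalgE (words X) R) [y](@monalgE (words X) R).
rewrite mulr_suml !(raddf_sum (fext g)) mulr_suml; apply: eq_bigr => u _.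
rewrite mulr_sumr (raddf_sum (fext g)) mulr_sumr; apply: eq_bigr => v _.
have -> : (<< x@_u *g u >> : falg) * << y@_v *g v >> = << x@_u * y@_v *g u ++ v >>.
  exact: fgmulUU.
rewrite /= !fextU /wprod big_cat rmorphM /=.
by rewrite -!mulrA; congr (_ * _); rewrite !mulrA scalC.
Qed.
Lemma fext_gen x : fext g (fgen x) = g x.
Proof. by apply: etrans (fextU _ _) _; rewrite /wprod big_seq1 rmorph1 mul1r. Qed.
End Ext.

End FreeAlgebra.

Section LinearQuotient.
Variables (R : pzRingType) (V : lmodType R) (G : V -> Prop).

Inductive lspan : V -> Prop :=
| lspan_gen x of G x : lspan x
| lspan_0 : lspan 0
| lspan_comb a x y of lspan x & lspan y : lspan (a *: x + y).

Definition lspan_pred : {pred V} := fun x => `[< lspan x >].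

Lemma lspan_zmod_closed : zmod_closed lspan_pred.
Proof.
split; first exact/asboolP/lspan_0.
move=> x y /asboolP hx /asboolP hy; apply/asboolP.
by rewrite addrC -scaleN1r; apply: lspan_comb.
Qed.
HB.instance Definition _ := GRing.isZmodClosed.Build V lspan_pred lspan_zmod_closed.

Lemma lspanZ a x : lspan x -> lspan (a *: x).
Proof. by move=> hx; rewrite -[_ *: _]addr0; apply: lspan_comb => //; apply: lspan_0. Qed.

(* The quotient of V by the submodule spanned by G *)
Definition lquot : Type := Quotient.quot lspan_pred.
HB.instance Definition _ := GRing.Zmodule.on lquot.

Definition lpi : V -> lquot := \pi_(Quotient.quot lspan_pred).
Definition lrepr : lquot -> V := fun x : Quotient.quot lspan_pred => repr x.

Lemma lreprK x : lpi (lrepr x) = x. Proof. exact: reprK. Qed.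
Lemma lpi_eq x y : lpi x = lpi y <-> lspan (x - y).
Proof.
rewrite /lpi; split => [h|h].
  apply/asboolP; change ((x - y) \in lspan_pred).
  by rewrite Quotient.idealrBE; apply/eqP.
by apply/eqP; rewrite -Quotient.idealrBE; apply/asboolP.
Qed.

Lemma lpi_is_zmod : zmod_morphism lpi.
Proof. exact: (raddfB (\pi_(Quotient.quot lspan_pred))). Qed.
HB.instance Definition _ := GRing.isZmodMorphism.Build V lquot lpi lpi_is_zmod.

Definition lscale (a : R) (x : lquot) : lquot := lpi (a *: lrepr x).

Lemma lscale_pi a x : lscale a (lpi x) = lpi (a *: x).
Proof.
apply/lpi_eq; rewrite -scalerBr; apply: lspanZ.
by apply/lpi_eq; rewrite lreprK.
Qed.

Lemma lscaleA a b x : lscale a (lscale b x) = lscale (a * b) x.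
Proof. by rewrite -[x]lreprK !lscale_pi scalerA. Qed.
Lemma lscale1 : left_id 1 lscale.
Proof. by move=> x; rewrite -[x]lreprK !lscale_pi scale1r. Qed.
Lemma lscaleDr : right_distributive lscale +%R.
Proof.
move=> a x y; rewrite -[x]lreprK -[y]lreprK.
by rewrite -(raddfD lpi) !lscale_pi scalerDr (raddfD lpi).
Qed.
Lemma lscaleDl x : {morph lscale^~ x : a b / a + b}.
Proof. by move=> a b; rewrite -[x]lreprK !lscale_pi scalerDl (raddfD lpi). Qed.
HB.instance Definition _ :=
  GRing.Zmodule_isLmodule.Build R lquot lscaleA lscale1 lscaleDr lscaleDl.

Lemma lpi_is_scalable : scalable lpi.
Proof. by move=> a x; rewrite -lscale_pi. Qed.
HB.instance Definition _ := GRing.isScalable.Build R V lquot _ lpi lpi_is_scalable.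

End LinearQuotient.
Arguments lpi {R V} G x.
Arguments lrepr {R V} G x.

Definition bilin (R : pzRingType) (M N P : lmodType R) (b : M -> N -> P) : Prop :=
  (forall n a m m', b (a *: m + m') n = a *: b m n + b m' n) /\
  (forall m a n n', b m (a *: n + n') = a *: b m n + b m n').

Section Tensor.
Variables (R : comNzRingType) (M N : lmodType R).
Let pr (m : M) (n : N) : {malg R[(M * N)%type]} := << 1 *g (m, n) >>.

Inductive tens_rel : {malg R[(M * N)%type]} -> Prop :=
| tens_l a m m' n : tens_rel (pr (a *: m + m') n - (a *: pr m n + pr m' n))
| tens_r m a n n' : tens_rel (pr m (a *: n + n') - (a *: pr m n + pr m n')).

(* M (x)_R N *)
Definition tens : Type := lquot tens_rel.
HB.instance Definition _ := GRing.Lmodule.on tens.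

Definition pure (m : M) (n : N) : tens := lpi tens_rel (pr m n).

Lemma pure_bilin : bilin pure.
Proof.
split=> [n a m m'|m a n n'].
  apply: etrans (linearP (lpi tens_rel) a (pr m n) (pr m' n)).
  by apply/lpi_eq/lspan_gen/tens_l.
apply: etrans (linearP (lpi tens_rel) a (pr m n) (pr m n')).
by apply/lpi_eq/lspan_gen/tens_r.
Qed.

Definition tlift (P : lmodType R) (b : M -> N -> P) (x : tens) : P :=
  lext (fun mn => b mn.1 mn.2) (lrepr tens_rel x).

Lemma tens_ind (Q : tens -> Prop) :
  Q 0 -> (forall m n, Q (pure m n)) -> (forall a x y, Q x -> Q y -> Q (a *: x + y)) ->
  forall x, Q x.
Proof.
move=> Q0 Qp Qc x; rewrite -[x]lreprK [lrepr _ _]monalgE linear_sum /=.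
elim/big_ind: _ => [//|u v Qu Qv|[m n] _].
  by rewrite -[u]scale1r; apply: Qc.
set c := mcoeff _ _; have -> : << c *g (m, n) >> = c *: pr m n.
  by apply/malgP => k; rewrite mcoeffZ !mcoeffU mulrnAr mulr1.
rewrite linearZ /= -[X in Q X]addr0; apply: Qc => //; exact: Qp.
Qed.

Lemma tens_eq (V : lmodType R) (F F' : tens -> V) :
  (forall c x y, F (c *: x + y) = c *: F x + F y) ->
  (forall c x y, F' (c *: x + y) = c *: F' x + F' y) ->
  (forall m n, F (pure m n) = F' (pure m n)) -> F =1 F'.
Proof.
have F0 (H : tens -> V) : (forall c x y, H (c *: x + y) = c *: H x + H y) -> H 0 = 0.
  move=> hH; apply: (addIr (H 0)); rewrite add0r.
  by have := hH 1 0 0; rewrite !scale1r add0r.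
move=> hF hF' hp; elim/tens_ind => [|//|c x y hx hy]; first by rewrite !F0.
by rewrite hF hF' hx hy.
Qed.

Section Lift.
Variables (P : lmodType R) (b : M -> N -> P) (hb : bilin b).

Let lext_rel x : lspan tens_rel x -> lext (fun mn => b mn.1 mn.2) x = 0.
Proof.
case: hb => hl hr; elim=> {x} [x [a m m' n|m a n n']||a x y _ hx _ hy].
- by rewrite linearB linearP /= !lextU !scale1r hl subrr.
- by rewrite linearB linearP /= !lextU !scale1r hr subrr.
- by rewrite linear0.
- by rewrite linearP /= hx hy scaler0 addr0.
Qed.

Lemma tlift_pi x : tlift b (lpi tens_rel x) = lext (fun mn => b mn.1 mn.2) x.
Proof.
apply/eqP; rewrite -subr_eq0 /tlift -linearB; apply/eqP/lext_rel.
by apply/lpi_eq; rewrite lreprK.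
Qed.

Lemma tlift_pure m n : tlift b (pure m n) = b m n.
Proof. by rewrite tlift_pi lextU scale1r. Qed.

Lemma tliftP a x y : tlift b (a *: x + y) = a *: tlift b x + tlift b y.
Proof. by rewrite -[x]lreprK -[y]lreprK -linearP !tlift_pi linearP. Qed.

Lemma tlift0 : tlift b 0 = 0.
Proof. by have := tliftP 1 0 0; rewrite !scale1r !addr0 => /(canLR (addrK _)); rewrite subrr. Qed.
End Lift.

End Tensor.
Arguments pure {R M N} m n.

Section TensorMaps.
Variable R : comNzRingType.

(* (f (x) g)(m (x) n) = f m (x) g n *)
Definition tmap (M N M' N' : lmodType R) (f : M -> M') (g : N -> N')
    (x : tens M N) : tens M' N' :=
  tlift (fun m n => pure (f m) (g n)) x.

(* (m1 (x) n1, m2 (x) n2) |-> f m1 m2 (x) g n1 n2 *)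
Definition tmap2 (M1 N1 M2 N2 M3 N3 : lmodType R)
    (f : M1 -> M2 -> M3) (g : N1 -> N2 -> N3)
    (x : tens M1 N1) (y : tens M2 N2) : tens M3 N3 :=
  tlift (fun m1 n1 => tlift (fun m2 n2 => pure (f m1 m2) (g n1 n2)) y) x.

Section Bilin.
Variables (M1 N1 M2 N2 M3 N3 : lmodType R).
Variables (f : M1 -> M2 -> M3) (g : N1 -> N2 -> N3).
Hypotheses (hf : bilin f) (hg : bilin g).

Let bilin_in m1 n1 : bilin (fun m2 n2 => pure (f m1 m2) (g n1 n2)).
Proof.
case: (hf) (hg) (pure_bilin M3 N3) => _ fr [_ gr] [pl pr].
by split=> *; rewrite ?fr ?gr ?pl ?pr.
Qed.

Let comb_swap (V : lmodType R) (a c : R) (x x' y y' : V) :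
  c *: (a *: x + x') + (a *: y + y') = a *: (c *: x + y) + (c *: x' + y').
Proof. by rewrite !scalerDr !scalerA (mulrC c a) addrACA. Qed.

Let T m1 n1 := tlift (fun m2 n2 => pure (f m1 m2) (g n1 n2)).
Let TP m n c x y : T m n (c *: x + y) = c *: T m n x + T m n y.
Proof. exact: (tliftP (bilin_in m n)). Qed.
Let T0 m n : T m n 0 = 0.
Proof. exact: (tlift0 (bilin_in m n)). Qed.
Let Tp m n m2 n2 : T m n (pure m2 n2) = pure (f m m2) (g n n2).
Proof. exact: (tlift_pure (bilin_in m n)). Qed.

Let tens_ext (M N V : lmodType R) (a : R) (F F1 F2 : tens M N -> V) :
  (forall c x y, F (c *: x + y) = c *: F x + F y) -> F 0 = 0 ->
  (forall c x y, F1 (c *: x + y) = c *: F1 x + F1 y) -> F1 0 = 0 ->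
  (forall c x y, F2 (c *: x + y) = c *: F2 x + F2 y) -> F2 0 = 0 ->
  (forall m n, F (pure m n) = a *: F1 (pure m n) + F2 (pure m n)) ->
  forall z, F z = a *: F1 z + F2 z.
Proof.
move=> hF F0 hF1 F10 hF2 F20 hp; elim/tens_ind => [||c x y hx hy] //.
  by rewrite F0 F10 F20 scaler0 addr0.
by rewrite hF hF1 hF2 hx hy comb_swap.
Qed.

Let bilin_out y : bilin (fun m1 n1 => T m1 n1 y).
Proof.
case: (hf) (hg) (pure_bilin M3 N3) => fl _ [gl _] [pl pr].
by split=> [n a m m'|m a n n']; apply: tens_ext => // ? ?; rewrite !Tp ?fl ?gl ?pl ?pr.
Qed.

Lemma tmap2_bilin : bilin (tmap2 f g).
Proof.
have tP z c x x' : tmap2 f g (c *: x + x') z = c *: tmap2 f g x z + tmap2 f g x' z.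
  exact: (tliftP (bilin_out z)).
have t0 z : tmap2 f g 0 z = 0 := tlift0 (bilin_out z).
have tp z m n : tmap2 f g (pure m n) z = T m n z := tlift_pure (bilin_out z) m n.
split=> [y a x x'|x a y y']; first exact: tP.
move: x; apply: tens_ext => //; try by move=> *; exact: tP.
by move=> m n; rewrite !tp TP.
Qed.

Lemma tmap2_pure m1 n1 m2 n2 :
  tmap2 f g (pure m1 n1) (pure m2 n2) = pure (f m1 m2) (g n1 n2).
Proof. exact: etrans (tlift_pure (bilin_out _) m1 n1) (Tp m1 n1 m2 n2). Qed.
End Bilin.

End TensorMaps.

(* A (x)_R B for R-algebras: (a (x) b)(a' (x) b') = aa' (x) bb' *)
Section TensorAlgebra.
Variables (R : comNzRingType) (A B : pzAlgType R).

Definition atens : Type := tens (algmod A) (algmod B).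
HB.instance Definition _ := GRing.Lmodule.on atens.

Definition apure (a : A) (b : B) : atens :=
  pure (a : algmod A) (b : algmod B).

Definition algmod_mul (C : pzAlgType R) (x y : algmod C) : algmod C :=
  (x : C) * (y : C).

Lemma algmod_mul_bilin (C : pzAlgType R) : bilin (@algmod_mul C).
Proof.
split=> [n a m m'|m a n n'].
  by rewrite /algmod_mul mulrDl; congr (_ + _); rewrite [RHS]mulrA.
rewrite /algmod_mul mulrDr; congr (_ + _).
by rewrite [LHS]mulrA -(@scalC R C a m) -[LHS]mulrA.
Qed.

Definition atmul (x y : atens) : atens := tmap2 (@algmod_mul A) (@algmod_mul B) x y.
Definition atone : atens := apure 1 1.

Let mulP := tmap2_bilin (@algmod_mul_bilin A) (@algmod_mul_bilin B).
Let mulp := tmap2_pure (@algmod_mul_bilin A) (@algmod_mul_bilin B).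

Let atmulPl z a x y : atmul (a *: x + y) z = a *: atmul x z + atmul y z.
Proof. exact: mulP.1. Qed.
Let atmulPr z a x y : atmul z (a *: x + y) = a *: atmul z x + atmul z y.
Proof. exact: mulP.2. Qed.

Lemma atmulDl : left_distributive atmul +%R.
Proof. by move=> x y z; have := atmulPl z 1 x y; rewrite !scale1r. Qed.
Lemma atmulDr : right_distributive atmul +%R.
Proof. by move=> x y z; have := atmulPr x 1 y z; rewrite !scale1r. Qed.
Lemma atmul0l x : atmul 0 x = 0.
Proof. by have := atmulDl 0 0 x; rewrite addr0 => /(canLR (addrK _)); rewrite subrr. Qed.
Lemma atmul0r x : atmul x 0 = 0.
Proof. by have := atmulDr x 0 0; rewrite addr0 => /(canLR (addrK _)); rewrite subrr. Qed.

Lemma atmulA : associative atmul.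
Proof.
move=> x y z; move: x; apply: tens_eq => [c u v|c u v|a b].
- exact: atmulPl.
- by rewrite (atmulPl y c u v) (atmulPl z c _ _).
move: y; apply: tens_eq => [c u v|c u v|a' b'].
- by rewrite (atmulPl z c u v) (atmulPr _ c _ _).
- by rewrite (atmulPr _ c u v) (atmulPl z c _ _).
move: z; apply: tens_eq => [c u v|c u v|a'' b''].
- by rewrite (atmulPr _ c u v) (atmulPr _ c _ _).
- exact: atmulPr.
by rewrite /atmul !mulp /algmod_mul !mulrA.
Qed.
Lemma atmul1 : left_id atone atmul.
Proof.
apply: tens_eq => [c u v|//|a b]; first exact: atmulPr.
by rewrite /atmul mulp /algmod_mul !mul1r.
Qed.
Lemma atmulr1 : right_id atone atmul.
Proof.
apply: (@tens_eq _ _ _ _ (atmul^~ atone)) => [c u v|//|a b]; first exact: atmulPl.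
by rewrite /atmul mulp /algmod_mul !mulr1.
Qed.
HB.instance Definition _ :=
  GRing.Zmodule_isPzRing.Build atens atmulA atmul1 atmulr1 atmulDl atmulDr.

Definition atscal (c : R) : atens := c *: (1 : atens).
Lemma atscal_is_zmod : zmod_morphism atscal.
Proof. by move=> a b; rewrite /atscal scalerBl. Qed.
Let atmulZl c x y : atmul (c *: x) y = c *: atmul x y.
Proof. by have := atmulPl y c x 0; rewrite atmul0l !addr0. Qed.
Let atmulZr c x y : atmul x (c *: y) = c *: atmul x y.
Proof. by have := atmulPr x c y 0; rewrite atmul0r !addr0. Qed.
Lemma atscalE c (x : atens) : atscal c * x = c *: x.
Proof. by apply: etrans (atmulZl c 1 x) _; congr (_ *: _); exact: mul1r. Qed.
Lemma atscal_is_monoid : monoid_morphism atscal.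
Proof. by split=> [|a b]; rewrite ?atscalE /atscal ?scale1r ?scalerA. Qed.
Lemma atscalC c x : atscal c * x = x * atscal c.
Proof.
rewrite atscalE; apply/esym/(etrans (atmulZr c x 1)); congr (_ *: _).
exact: mulr1.
Qed.
HB.instance Definition _ :=
  isPzAlgebra.Build R atens atscal_is_zmod atscal_is_monoid atscalC.
End TensorAlgebra.
Arguments apure {R A B} a b.

(* For an R-module N on which B acts, A (x)_R N is a module over A (x)_R B *)
Section TensorModule.
Variables (R : comNzRingType) (A B : pzAlgType R) (N : lmodType R).
Variable act : algmod B -> N -> N.
Hypothesis act_bilin : bilin act.
Hypothesis actA : forall (x y : B) n, act x (act y n) = act (x * y) n.
Hypothesis act1 : forall n, act (1 : B) n = n.

Definition tens_act (x : atens A B) (w : tens (algmod A) N) : tens (algmod A) N :=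
  tmap2 (@algmod_mul R A) act x w.

Let actP := tmap2_bilin (@algmod_mul_bilin R A) act_bilin.
Let actp := tmap2_pure (@algmod_mul_bilin R A) act_bilin.
Let mulP := tmap2_bilin (@algmod_mul_bilin R A) (@algmod_mul_bilin R B).
Let mulp := tmap2_pure (@algmod_mul_bilin R A) (@algmod_mul_bilin R B).

Let tens_actPl w a (x y : atens A B) :
  tens_act (a *: x + y) w = a *: tens_act x w + tens_act y w.
Proof. exact: actP.1. Qed.
Let tens_actPr x a w w' :
  tens_act x (a *: w + w') = a *: tens_act x w + tens_act x w'.
Proof. exact: actP.2. Qed.
Let mulPl (z : atens A B) a x y : atmul (a *: x + y) z = a *: atmul x z + atmul y z.
Proof. exact: mulP.1. Qed.
Let mulPr (z : atens A B) a x y : atmul z (a *: x + y) = a *: atmul z x + atmul z y.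
Proof. exact: mulP.2. Qed.

Lemma tens_actA x y w : tens_act x (tens_act y w) = tens_act (x * y) w.
Proof.
change (x * y) with (atmul x y).
move: x; apply: tens_eq => [c u u'|c u u'|a u].
- exact: tens_actPl.
- by rewrite (mulPl y c u u') (tens_actPl w c _ _).
move: y; apply: tens_eq => [c y y'|c y y'|a' u'].
- by rewrite (tens_actPl w c y y') (tens_actPr _ c _ _).
- by rewrite (mulPr _ c y y') (tens_actPl w c _ _).
move: w; apply: tens_eq => [c w w'|c w w'|a'' n].
- by rewrite (tens_actPr _ c w w') (tens_actPr _ c _ _).
- exact: tens_actPr.
by rewrite /tens_act /atmul !actp mulp actp /algmod_mul mulrA actA.
Qed.
Lemma tens_act1 w : tens_act 1 w = w.
Proof.
move: w; apply: tens_eq => [c u v|//|a n]; first exact: tens_actPr.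
apply: etrans (actp _ _ _ _) _.
by rewrite act1 /algmod_mul mul1r.
Qed.
Lemma tens_actDr x w w' : tens_act x (w + w') = tens_act x w + tens_act x w'.
Proof. by have := tens_actPr x 1 w w'; rewrite !scale1r. Qed.
Lemma tens_actDl w x y : tens_act (x + y) w = tens_act x w + tens_act y w.
Proof. by have := tens_actPl w 1 x y; rewrite !scale1r. Qed.
End TensorModule.

Section Subalgebra.
Variables (R : pzRingType) (A : pzAlgType R) (S : R -> Prop) (G : A -> Prop).

(* The subring of A generated by G and by the scalars in S *)
Inductive subalg : A -> Prop :=
| subalg_gen x of G x : subalg x
| subalg_scal c of S c : subalg (scal c)
| subalg_B x y of subalg x & subalg y : subalg (x - y)
| subalg_M x y of subalg x & subalg y : subalg (x * y).
End Subalgebra.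

Definition subalgebra (R : pzRingType) (A : pzAlgType R) (G : A -> Prop) :=
  subalg (fun _ : R => True) G.

Record cartan_datum (I : countType) := CartanDatum {
  cm : I -> I -> int;
  cr : I -> nat;
  cm_diag : forall i, cm i i = 2 \/ exists k : nat, cm i i = - (2 * k)%:Z;
  cm_off : forall i j, i != j -> cm i j <= 0;
  cr_gt0 : forall i, (0 < cr i)%N;
  cm_sym : forall i j, (cr i)%:Z * cm i j = (cr j)%:Z * cm j i
}.

Section Weights.
Variables (I : countType) (D : cartan_datum I).

Definition is_real (i : I) : bool := cm D i i == 2.

Definition in_Iinf (x : I * nat) : bool :=
  (0 < x.2)%N && (is_real x.1 ==> (x.2 == 1)%N).
Definition Iinf : Type := {x : I * nat | in_Iinf x}.
HB.instance Definition _ := Countable.on Iinf.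
Definition idx (x : Iinf) : I := (val x).1.
Definition lev (x : Iinf) : nat := (val x).2.

(* x_{im}, with x_{i0} = 1: for (i, l) in I^infty and m <= l, (i, m) is in
   I^infty unless m = 0 *)
Definition at_level (A : pzRingType) (g : Iinf -> A) (i : I) (m : nat) : A :=
  if insub (i, m) is Some x then g x else 1.

(* P^vee, and the Cartan subalgebra Q (x) P^vee. The basis element inl i is h_i
   and inr i is d_i *)
Definition Pvee : Type := {malg int[(I + I)%type]}.
HB.instance Definition _ := GRing.Zmodule.on Pvee.
Definition cartan : Type := {malg rat[(I + I)%type]}.
HB.instance Definition _ := GRing.Lmodule.on cartan.

Definition coroot (i : I) : Pvee := << 1 *g (inl i : (I + I)%type) >>.
Definition Pvee_in (h : Pvee) : cartan :=
  \sum_(b <- msupp (h : {malg int[(I + I)%type]}))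
    << (mcoeff b h)%:~R *g b >>.

Record weight := Weight {
  wt_fun :> {linear cartan -> rat^o};
  wt_int : forall h : Pvee, (wt_fun (Pvee_in h) : rat) \is a Num.int
}.

(* The integer lambda(h) *)
Definition wt_val (lam : weight) (h : Pvee) : int := Num.floor (lam (Pvee_in h) : rat).

Lemma Pvee_in_is_zmod : zmod_morphism Pvee_in.
Proof.
move=> x y; apply/malgP => b; rewrite mcoeffB.
have co (z : {malg int[(I + I)%type]}) : mcoeff b (Pvee_in z) = (mcoeff b z)%:~R.
  rewrite /Pvee_in raddf_sum /=; case: (msuppP z b) => [hb|hb].
    rewrite (big_fsetD1 b) //= mcoeffUU big1_fset ?addr0 // => c.
    by rewrite in_fsetD1 mcoeffU => /andP [/negPf ->].
  rewrite big1_fset // => c hc _; rewrite mcoeffU; case: eqP => // e.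
  by rewrite -e hc in hb.
by rewrite !co mcoeffB rmorphB.
Qed.
HB.instance Definition _ :=
  GRing.isZmodMorphism.Build Pvee cartan Pvee_in Pvee_in_is_zmod.

Lemma wt_valE (lam : weight) h : (wt_val lam h)%:~R = (lam (Pvee_in h) : rat).
Proof. exact/floorK/wt_int. Qed.
Lemma wt_valN (lam : weight) h : wt_val lam (- h) = - wt_val lam h.
Proof.
by apply: (@intr_inj rat); rewrite mulrNz !wt_valE (raddfN Pvee_in) (raddfN lam).
Qed.

Definition alpha_basis (j : I) (b : I + I) : rat^o :=
  match b with inl i => (cm D i j)%:~R | inr i => (i == j)%:R end.
Definition alpha_fun (j : I) : cartan -> rat^o :=
  @lext rat (I + I)%type rat^o (alpha_basis j).
HB.instance Definition _ (j : I) := GRing.Linear.on (alpha_fun j).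
Lemma alpha_int j (h : Pvee) : (alpha_fun j (Pvee_in h) : rat) \is a Num.int.
Proof.
rewrite /Pvee_in /alpha_fun linear_sum /=; apply: rpred_sum => b _.
rewrite lextU; apply: rpredM; first by rewrite rpred_int_num.
by case: b => i /=; [rewrite rpred_int_num | rewrite rpred_nat].
Qed.
Definition alpha (j : I) : weight := @Weight (alpha_fun j) (alpha_int j).
End Weights.

Definition Kq : Type := {fraction {poly rat}}.
HB.instance Definition _ := GRing.Field.on Kq.
Definition frac_of (p : {poly rat}) : Kq := FracField.tofrac p.
Definition qq : Kq := frac_of 'X.

(* 1 + q Z_{>=0}[[q]]: the expansion of x = g / h at q = 0 is the power series
   with coefficients s *)
Definition one_plus_q_nat_series (x : Kq) : Prop :=
  exists (g h : {poly rat}) (s : nat -> nat),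
    [/\ h`_0 != 0, x = frac_of g / frac_of h, s 0 = 1
      & forall n, g`_n = \sum_(k < n.+1) h`_k * (s (n - k))%:R].

Section QuantumNumbers.
Variables (I : countType) (D : cartan_datum I).
Definition q_ (i : I) : Kq := qq ^+ cr D i.
(* q^{(alpha_i, alpha_i) / 2}; a_ii is even *)
Definition qpar (i : I) : Kq := qq ^ ((cr D i)%:Z * (cm D i i %/ 2)%Z).
Definition qint (i : I) (n : nat) : Kq :=
  (q_ i ^+ n - q_ i ^- n) / (q_ i - (q_ i)^-1).
Definition qfact (i : I) (n : nat) : Kq := \prod_(1 <= k < n.+1) qint i k.
Definition qbinom (i : I) (n k : nat) : Kq :=
  qfact i n / (qfact i k * qfact i (n - k)).
(* 1 - l a_ij *)
Definition serre_exp (i j : Iinf D) : nat :=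
  absz (1 - (lev j)%:Z * cm D (idx i) (idx j))%R.
End QuantumNumbers.

Definition comm (A : pzRingType) (x y : A) : A := x * y - y * x.

Section FreeForm.
Variables (I : countType) (D : cartan_datum I).
Local Notation W := (words (Iinf D)).

Definition Ffree : Type := falg Kq (Iinf D).
HB.instance Definition _ := PzAlgebra.on Ffree.
HB.instance Definition _ := GRing.Lmodule.on Ffree.
Definition ffree (x : Iinf D) : Ffree := fgen Kq x.

(* Elements of the root lattice; << i >> is alpha_i *)
Definition rootlat : Type := {malg int[I]}.
HB.instance Definition _ := GRing.Zmodule.on rootlat.
Definition rootform (b c : rootlat) : int :=
  \sum_(i <- msupp (b : {malg int[I]})) \sum_(j <- msupp (c : {malg int[I]}))
    mcoeff i b * mcoeff j c * ((cr D i)%:Z * cm D i j).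

Definition wdeg (w : W) : rootlat :=
  - \sum_(x <- w) << (lev x)%:Z *g idx x >>.
Definition homog (b : rootlat) (x : Ffree) : Prop :=
  forall w, w \in msupp (x : {malg Kq[W]}) -> wdeg w = b.

(* F (x) F, on the basis of pairs of words, with its twisted product *)
Definition Ffree2 : Type := {malg Kq[(W * W)%type]}.
HB.instance Definition _ := GRing.Lmodule.on Ffree2.
Definition twmul (x y : Ffree2) : Ffree2 :=
  \sum_(u <- msupp (x : {malg Kq[(W * W)%type]}))
   \sum_(v <- msupp (y : {malg Kq[(W * W)%type]}))
    << mcoeff u x * mcoeff v y * qq ^ (- rootform (wdeg u.2) (wdeg v.1))
       *g (u.1 ++ v.1 : W, u.2 ++ v.2 : W) >>.

Definition word_at (i : I) (m : nat) : W :=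
  if insub (i, m) is Some x then [:: x] else [::].
Definition delta_gen (x : Iinf D) : Ffree2 :=
  \sum_(m < (lev x).+1)
    << qpar D (idx x) ^- (m * (lev x - m))
       *g (word_at (idx x) m, word_at (idx x) (lev x - m)) >>.
Definition delta_word (w : W) : Ffree2 :=
  foldr (fun x d => twmul (delta_gen x) d)
        << 1 *g ([::] : W, [::] : W) >> w.
Definition delta (x : Ffree) : Ffree2 := @lext Kq W Ffree2 delta_word x.

Record is_free_form (nu : Iinf D -> Kq) (B : Ffree -> Ffree -> Kq) : Prop := {
  ff_linear : forall (a : Kq) x y z, B (a *: x + y) z = a * B x z + B y z;
  ff_sym : forall x y, B x y = B y x;
  ff_deg : forall b c x y, homog b x -> homog c y -> b != c -> B x y = 0;
  ff_one : B 1 1 = 1;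
  ff_gen : forall x, B (ffree x) (ffree x) = nu x;
  ff_mul : forall x y z, B x (y * z) =
    \sum_(p <- msupp (delta x : {malg Kq[(W * W)%type]}))
      mcoeff p (delta x) * (B << p.1 >> y * B << p.2 >> z)
}.
End FreeForm.

Section Uhat.
Variables (I : countType) (D : cartan_datum I).
Local Notation Pvee := (Pvee I).
Local Notation Iinf := (Iinf D).

Section Relations.
Variables (A : pzAlgType Kq) (Q : Pvee -> A) (E F : Iinf -> A).

Definition qserre (x : Iinf -> A) (i j : Iinf) : A :=
  let N := serre_exp i j in
  \sum_(k < N.+1) (-1) ^+ k * scal (qbinom D (idx i) N k)
                  * x i ^+ (N - k) * x j * x i ^+ k.

Inductive Uhat_rel : A -> Prop :=
| Uhat_q0 : Uhat_rel (Q 0 - 1)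
| Uhat_qD h h' : Uhat_rel (Q h * Q h' - Q (h + h'))
| Uhat_qE h j : Uhat_rel (Q h * E j * Q (- h)
    - scal (qq ^ ((lev j)%:Z * wt_val (alpha D (idx j)) h)) * E j)
| Uhat_qF h j : Uhat_rel (Q h * F j * Q (- h)
    - scal (qq ^ (- ((lev j)%:Z * wt_val (alpha D (idx j)) h))) * F j)
| Uhat_serreE i j of is_real D (idx i) & i != j : Uhat_rel (qserre E i j)
| Uhat_serreF i j of is_real D (idx i) & i != j : Uhat_rel (qserre F i j)
| Uhat_commE i j of cm D (idx i) (idx j) = 0 : Uhat_rel (comm (E i) (E j))
| Uhat_commF i j of cm D (idx i) (idx j) = 0 : Uhat_rel (comm (F i) (F j)).
End Relations.

Definition Ugen : Type := (Pvee + (Iinf + Iinf))%type.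
HB.instance Definition _ := Choice.on Ugen.
Definition Ufree : Type := falg Kq Ugen.
HB.instance Definition _ := PzAlgebra.on Ufree.
Definition gQ (h : Pvee) : Ufree := @fgen Kq Ugen (inl h).
Definition gE (x : Iinf) : Ufree := @fgen Kq Ugen (inr (inl x)).
Definition gF (x : Iinf) : Ufree := @fgen Kq Ugen (inr (inr x)).

Definition Uhat : Type := aquot (Uhat_rel gQ gE gF).
HB.instance Definition _ := PzAlgebra.on Uhat.

Definition Uhat_pi : Ufree -> Uhat := api (Uhat_rel gQ gE gF).
Definition qh (h : Pvee) : Uhat := Uhat_pi (gQ h).
Definition eh (x : Iinf) : Uhat := Uhat_pi (gE x).
Definition fh (x : Iinf) : Uhat := Uhat_pi (gF x).
(* K_i^n *)
Definition Kh (i : I) (n : int) : Uhat := qh (coroot i *~ ((cr D i)%:Z * n)).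

Definition Ffree_Uhat : Ffree D -> Uhat := @fext Kq Iinf Uhat fh.

Definition Uhat_minus : Uhat -> Prop := subalgebra (fun x => exists j, x = fh j).
Definition Uhat_plus : Uhat -> Prop := subalgebra (fun x => exists j, x = eh j).
Definition Uhat_le0 : Uhat -> Prop :=
  subalgebra (fun x => (exists j, x = fh j) \/ (exists h, x = qh h)).
Definition Uhat_le0K : Uhat -> Prop :=
  subalgebra (fun x => (exists j, x = fh j) \/ (exists i n, x = Kh i n)).

(* The algebra homomorphism q^h |-> q^{-h}, e_il <-> f_il: see omega_alg_hom *)
Definition omega_gen (g : Ugen) : Uhat :=
  match g with
  | inl h => qh (- h)
  | inr (inl x) => fh x
  | inr (inr x) => eh x
  end.
Definition omega (x : Uhat) : Uhat :=
  @fext Kq Ugen Uhat omega_gen (arepr (Uhat_rel gQ gE gF) x).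

Lemma Uhat_rel_api r0 r : Uhat_rel gQ gE gF r0 -> Uhat_pi r0 = r -> r = 0.
Proof.
move=> h <-; rewrite -(raddf0 (api (Uhat_rel gQ gE gF))).
by apply/api_eq; rewrite subr0; apply: ideal_in.
Qed.

Lemma qserre_hom (A B : pzAlgType Kq) (f : A -> B) (x : Iinf -> A) i j :
  alg_hom f -> f (qserre x i j) = qserre (fun k => f (x k)) i j.
Proof.
case=> fB [f1 fM] fS; rewrite /qserre.
pose fa := GRing.isZmodMorphism.Build A B f fB.
pose fm := GRing.isMonoidMorphism.Build A B f (conj f1 fM).
pose g : {rmorphism A -> B} := HB.pack f fa fm.
have fX y n : f (y ^+ n) = f y ^+ n := rmorphXn g n y.
have fN : f (-1) = -1 by rewrite -f1; exact: (raddfN g).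
apply: etrans (raddf_sum g _ _ _) _; apply: eq_bigr => k _.
by rewrite /= !fM !fX fN fS.
Qed.

Lemma Uhat_rel_swap (A B : pzAlgType Kq) (p g : A -> B) (Q : Pvee -> A)
    (E F : Iinf -> A) :
  alg_hom p -> alg_hom g -> (forall h, g (Q h) = p (Q (- h))) ->
  (forall x, g (E x) = p (F x)) -> (forall x, g (F x) = p (E x)) ->
  forall r, Uhat_rel Q E F r -> exists2 r', Uhat_rel Q E F r' & p r' = g r.
Proof.
move=> ph gh gQE gEE gFE r.
case: (gh) => gB [g1 gM] gS; case: (ph) => pB [p1 pM] pS.
case=> [|h h'|h j|h j|i j hi hj|i j hi hj|i j hij|i j hij].
- by exists (Q 0 - 1); [exact: Uhat_q0 | rewrite pB gB gQE oppr0 p1 g1].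
- exists (Q (- h) * Q (- h') - Q (- h - h')); first exact: Uhat_qD.
  by rewrite pB gB pM gM !gQE opprD.
- eexists; first exact: (Uhat_qF Q E F (- h) j).
  rewrite pB gB !pM !gM !gQE gEE pS gS; congr (_ - scal (_ ^ _) * _).
  by rewrite wt_valN mulrN opprK.
- eexists; first exact: (Uhat_qE Q E F (- h) j).
  rewrite pB gB !pM !gM !gQE gFE pS gS; congr (_ - scal (_ ^ _) * _).
  by rewrite wt_valN mulrN.
- eexists; first exact: (Uhat_serreF Q E F hi hj).
  by rewrite !qserre_hom //; congr qserre; apply: funext => k; rewrite gEE.
- eexists; first exact: (Uhat_serreE Q E F hi hj).
  by rewrite !qserre_hom //; congr qserre; apply: funext => k; rewrite gFE.
- eexists; first exact: (Uhat_commF Q E F hij).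
  by rewrite /comm pB gB !pM !gM !gEE.
- eexists; first exact: (Uhat_commE Q E F hij).
  by rewrite /comm pB gB !pM !gM !gFE.
Qed.

Lemma Uhat_pi_alg_hom : alg_hom Uhat_pi.
Proof. by split; [exact: api_is_zmod | exact: api_is_monoid | move=> c]. Qed.

Lemma omega_rel r : Uhat_rel gQ gE gF r -> fext omega_gen r = 0.
Proof.
move=> hr.
have [r' hr' <-] := Uhat_rel_swap Uhat_pi_alg_hom (fext_alg_hom omega_gen)
  (fun h => fext_gen omega_gen (inl h)) (fun x => fext_gen omega_gen (inr (inl x)))
  (fun x => fext_gen omega_gen (inr (inr x))) hr.
exact: (Uhat_rel_api hr').
Qed.

Lemma omega_alg_hom : alg_hom omega.
Proof. exact: (afactor_alg_hom (fext_alg_hom omega_gen) omega_rel). Qed.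
Lemma omega_q h : omega (qh h) = qh (- h).
Proof.
by rewrite /omega [LHS](afactorE (fext_alg_hom omega_gen) omega_rel) fext_gen.
Qed.
Lemma omega_e x : omega (eh x) = fh x.
Proof.
by rewrite /omega [LHS](afactorE (fext_alg_hom omega_gen) omega_rel) fext_gen.
Qed.
Lemma omega_f x : omega (fh x) = eh x.
Proof.
by rewrite /omega [LHS](afactorE (fext_alg_hom omega_gen) omega_rel) fext_gen.
Qed.

Record is_comult (Delta : Uhat -> atens Uhat Uhat) : Prop := {
  comult_hom : alg_hom Delta;
  comult_q : forall h, Delta (qh h) = apure (qh h) (qh h);
  comult_e : forall x, Delta (eh x) =
    \sum_(m < (lev x).+1)
      scal (qpar D (idx x) ^+ (m * (lev x - m))) *
      apure (at_level eh (idx x) m)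
            (Kh (idx x) (- m%:Z) * at_level eh (idx x) (lev x - m));
  comult_f : forall x, Delta (fh x) =
    \sum_(m < (lev x).+1)
      scal (qpar D (idx x) ^- (m * (lev x - m))) *
      apure (at_level fh (idx x) m * Kh (idx x) (lev x - m)%:Z)
            (at_level fh (idx x) (lev x - m))
}.

(* (d, y (x) z)_L for d in Uhat (x) Uhat *)
Definition form2 (B : Uhat -> Uhat -> Kq) (d : atens Uhat Uhat) (y z : Uhat) : Kq :=
  @tlift Kq (algmod Uhat) (algmod Uhat) Kq^o (fun a b => B a y * B b z) d.

(* (,)_L is used on pairs of elements of Uhat^{<= 0} of which at least one
   lies in the subalgebra Uhat_le0K generated by the f_il and the K_i^{+-1}.
   On all pairs, compatibility with Delta would force
   (q^{d_j}, q^{h_j})^{r_j} = (q^{d_j}, K_j) = q^{-1}, which has no solution in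
   Q(q) when r_j > 1. The values on the remaining pairs are irrelevant. *)
Record is_form (BF : Ffree D -> Ffree D -> Kq)
    (Delta : Uhat -> atens Uhat Uhat) (B : Uhat -> Uhat -> Kq) : Prop := {
  form_linear : forall a x y z, B (scal a * x + y) z = a * B x z + B y z;
  form_sym : forall x y, B x y = B y x;
  form_ext : forall x y, B (Ffree_Uhat x) (Ffree_Uhat y) = BF x y;
  form_q1 : forall h, B (qh h) 1 = 1;
  form_qf : forall h x, B (qh h) (fh x) = 0;
  form_qK : forall h j, B (qh h) (Kh j 1) = qq ^ (- wt_val (alpha D j) h);
  form_omega : forall x y, Uhat_plus x -> Uhat_plus y -> B x y = B (omega x) (omega y);
  form_mul : forall x y z, Uhat_le0 x -> Uhat_le0 y -> Uhat_le0 z ->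
    Uhat_le0K x \/ Uhat_le0K y /\ Uhat_le0K z ->
    B x (y * z) = form2 B (Delta x) y z
}.
End Uhat.

Record bozec_data (I : countType) (D : cartan_datum I) (nu : Iinf D -> Kq) :=
  BozecData {
  comult : Uhat D -> atens (Uhat D) (Uhat D);
  form_free : Ffree D -> Ffree D -> Kq;
  form : Uhat D -> Uhat D -> Kq;
  comultP : is_comult comult;
  form_freeP : is_free_form nu form_free;
  formP : is_form form_free comult form
}.

Section Uq.
Variables (I : countType) (D : cartan_datum I) (nu : Iinf D -> Kq).
Variable L : bozec_data nu.
Local Notation Pvee := (Pvee I).
Local Notation Iinf := (Iinf D).
Local Notation Uhat := (Uhat D).
Local Notation omega := (@omega I D).

(* sum (a_1, b_2) omega(b_1) a_2  and  sum (a_2, b_1) a_1 omega(b_2),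
   where d = Delta a and d' = Delta b *)
Definition drinfeld_l (d d' : atens Uhat Uhat) : Uhat :=
  @tlift Kq (algmod Uhat) (algmod Uhat) (algmod Uhat) (fun a1 a2 =>
    @tlift Kq (algmod Uhat) (algmod Uhat) (algmod Uhat) (fun b1 b2 =>
      scal (form L a1 b2) * omega b1 * (a2 : Uhat)) d') d.
Definition drinfeld_r (d d' : atens Uhat Uhat) : Uhat :=
  @tlift Kq (algmod Uhat) (algmod Uhat) (algmod Uhat) (fun a1 a2 =>
    @tlift Kq (algmod Uhat) (algmod Uhat) (algmod Uhat) (fun b1 b2 =>
      scal (form L a2 b1) * (a1 : Uhat) * omega b2) d') d.

(* One of a, b lies in Uhat_le0K: see is_form *)
Inductive drinfeld_rel : Uhat -> Prop :=
| drinfeld_ab a b of Uhat_le0 a & Uhat_le0 b & (Uhat_le0K a \/ Uhat_le0K b) :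
    drinfeld_rel (drinfeld_l (comult L a) (comult L b)
                  - drinfeld_r (comult L a) (comult L b)).

Definition Utilde : Type := aquot drinfeld_rel.
HB.instance Definition _ := PzAlgebra.on Utilde.

(* The radical of the form (x, omega y) on Utilde^- x Utilde^+: its left part is
   the radical of (,)_L on the minus part, and its right part is the radical of
   (,)_L on the plus part. Both are described on preimages in Uhat *)
Inductive radical_rel : Utilde -> Prop :=
| radical_minus x of Uhat_minus x & (forall y, Uhat_minus y -> form L x y = 0) :
    radical_rel (api drinfeld_rel x)
| radical_plus x of Uhat_plus x & (forall y, Uhat_plus y -> form L x y = 0) :
    radical_rel (api drinfeld_rel x).

Definition Uq : Type := aquot radical_rel.
HB.instance Definition _ := PzAlgebra.on Uq.

Definition Uq_pi (x : Uhat) : Uq := api radical_rel (api drinfeld_rel x).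
Definition Uq_q (h : Pvee) : Uq := Uq_pi (qh D h).
Definition Uq_e (x : Iinf) : Uq := Uq_pi (eh x).
Definition Uq_f (x : Iinf) : Uq := Uq_pi (fh x).

Definition lower_f (x : Iinf) : Uhat -> Prop :=
  subalgebra (fun y => exists j,
    [/\ idx j = idx x, (lev j < lev x)%N & y = fh j]).

(* The t_il, through preimages in Uhat^-, where the form is defined; t_il itself
   is t_ below *)
Record prim_gens := PrimGens {
  tlow : Iinf -> Uhat;
  tlow_deg : forall x, exists2 w : Ffree D,
    homog (- << (lev x)%:Z *g idx x >>) w & tlow x = Ffree_Uhat w;
  tlow_tri : forall x, ~~ is_real D (idx x) -> lower_f x (tlow x - fh x);
  tlow_orth : forall x, ~~ is_real D (idx x) ->
    forall z, lower_f x z -> form L (tlow x) z = 0;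
  tlow_real : forall x, is_real D (idx x) -> tlow x = fh x;
  (* tau_il != 0 *)
  tlow_neq0 : forall x, form L (tlow x) (tlow x) != 0
}.

Record is_highest_weight_q (lam : weight I) (V : lmodType Uq) (v : V) : Prop := {
  hwq_neq0 : v != 0;
  hwq_e : forall x, Uq_e x *: v = 0;
  hwq_q : forall h, Uq_q h *: v = (scal (qq ^ wt_val lam h) : Uq) *: v;
  hwq_gen : forall w : V, exists u : Uq, w = u *: v
}.
End Uq.

Definition A1_pred : {pred Kq} := fun x =>
  `[< exists g h : {poly rat}, h.[1] != 0 /\ x = frac_of g / frac_of h >].

Lemma frac_of_neq0 h : h.[1] != 0 -> frac_of h != 0.
Proof.
move=> h1; apply: contra_neq h1 => h0.
have /eqP : frac_of h == 0 by rewrite h0.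
by move/eqP; rewrite tofrac_eq0 => /eqP ->; rewrite horner0.
Qed.

Lemma A1_subring_closed : subring_closed A1_pred.
Proof.
split.
- apply/asboolP; exists 1, 1; rewrite hornerC oner_eq0; split=> //.
  by rewrite divrr // unitfE frac_of_neq0 // hornerC oner_eq0.
- move=> x y /asboolP [g [h [h1 ->]]] /asboolP [g' [h' [h1' ->]]].
  apply/asboolP; exists (g * h' - g' * h), (h * h').
  rewrite hornerM mulf_neq0 //; split=> //.
  rewrite -mulNr addf_div ?frac_of_neq0 // mulNr.
  by rewrite /frac_of rmorphB !rmorphM.
- move=> x y /asboolP [g [h [h1 ->]]] /asboolP [g' [h' [h1' ->]]].
  apply/asboolP; exists (g * g'), (h * h').
  rewrite hornerM mulf_neq0 //; split=> //.
  by rewrite /frac_of !rmorphM mulf_div.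
Qed.
HB.instance Definition _ := GRing.isSubringClosed.Build Kq A1_pred A1_subring_closed.

Record A1 := InA1 { A1_val : Kq; A1_valP : A1_val \in A1_pred }.
HB.instance Definition _ := [isSub for A1_val].
HB.instance Definition _ := [Choice of A1 by <:].
HB.instance Definition _ := [SubChoice_isSubComNzRing of A1 by <:].

Definition J1_pred : {pred A1} := fun a =>
  `[< exists b : A1, A1_val a = (qq - 1) * A1_val b >].

Lemma A1_val_is_zmod : zmod_morphism A1_val.
Proof. exact: (raddfB (val : A1 -> Kq)). Qed.
Lemma A1_val_is_monoid : monoid_morphism A1_val.
Proof. by split; [exact: (rmorph1 (val : A1 -> Kq)) | exact: (rmorphM (val : A1 -> Kq))]. Qed.
HB.instance Definition _ := GRing.isZmodMorphism.Build A1 Kq A1_val A1_val_is_zmod.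
HB.instance Definition _ := GRing.isMonoidMorphism.Build A1 Kq A1_val A1_val_is_monoid.

Lemma J1_idealr : idealr_closed J1_pred.
Proof.
split.
- by apply/asboolP; exists 0; rewrite !(raddf0 A1_val) mulr0.
- apply/negP => /asboolP [[x hx] ex1]; case/asboolP: (hx) => g [h [h1 ex]].
  have e : (qq - 1) * frac_of g / frac_of h = 1.
    by rewrite -mulrA -ex -[RHS](rmorph1 A1_val).
  have e2 : frac_of (('X - 1) * g) = frac_of h.
    rewrite /frac_of rmorphM rmorphB rmorph1.
    by apply: (divIf (frac_of_neq0 h1)); rewrite divff ?frac_of_neq0.
  have /eqP : frac_of (('X - 1) * g) == frac_of h by apply/eqP.
  move/eqP; rewrite tofrac_eq => /eqP e3; move: h1.
  by rewrite -e3 hornerM hornerD hornerX hornerN hornerC subrr mul0r eqxx.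
- move=> a x y /asboolP [b e] /asboolP [b' e']; apply/asboolP.
  exists (a * b + b'); have vD u w : A1_val (u + w) = A1_val u + A1_val w := raddfD A1_val u w.
  have vM u w : A1_val (u * w) = A1_val u * A1_val w := rmorphM A1_val u w.
  rewrite !vD !vM e e'.
  by rewrite mulrDr mulrCA.
Qed.
HB.instance Definition _ := isIdealr.Build A1 J1_pred J1_idealr.

(* A_1 / J_1 as an A_1-algebra *)
Definition A1modJ1 : Type := {ideal_quot J1_pred}.
HB.instance Definition _ := GRing.ComNzRing.on A1modJ1.
Definition A1_scal : A1 -> A1modJ1 := \pi_({ideal_quot J1_pred}).
Lemma A1_scal_is_zmod : zmod_morphism A1_scal.
Proof. exact: (raddfB (\pi_({ideal_quot J1_pred}))). Qed.
Lemma A1_scal_is_monoid : monoid_morphism A1_scal.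
Proof. 
split; first exact: (rmorph1 (\pi_({ideal_quot J1_pred}))).
exact: (rmorphM (\pi_({ideal_quot J1_pred}))).
Qed.
Lemma A1_scalC c x : A1_scal c * x = x * A1_scal c.
Proof. exact: mulrC. Qed.
HB.instance Definition _ :=
  isPzAlgebra.Build A1 A1modJ1 A1_scal_is_zmod A1_scal_is_monoid A1_scalC.

Lemma rat_A1_subproof (c : rat) : frac_of c%:P \in A1_pred.
Proof.
apply/asboolP; exists c%:P, 1; rewrite hornerC oner_eq0; split=> //.
by rewrite /frac_of rmorph1 divr1.
Qed.
(* The constants of A_1; Q -> A_1 -> A_1 / J_1 is the isomorphism Q = A_1 / J_1 *)
Definition rat_A1 (c : rat) : A1 := InA1 (rat_A1_subproof c).
Lemma rat_A1_is_zmod : zmod_morphism rat_A1.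
Proof. by move=> a b; apply: val_inj; rewrite /= /frac_of !raddfB. Qed.
Lemma rat_A1_is_monoid : monoid_morphism rat_A1.
Proof. by split=> [|a b]; apply: val_inj; rewrite /= /frac_of ?rmorph1 ?rmorphM. Qed.
HB.instance Definition _ := GRing.isZmodMorphism.Build rat A1 rat_A1 rat_A1_is_zmod.
HB.instance Definition _ := GRing.isMonoidMorphism.Build rat A1 rat_A1 rat_A1_is_monoid.

Section A1Forms.
Variables (I : countType) (D : cartan_datum I) (nu : Iinf D -> Kq).
Variables (L : bozec_data nu) (t : prim_gens L).
Local Notation Pvee := (Pvee I).
Local Notation Iinf := (Iinf D).
Local Notation Uq := (Uq L).

Definition t_ (x : Iinf) : Uq := Uq_pi L (tlow t x).
Definition s_ (x : Iinf) : Uq := Uq_pi L (omega (tlow t x)).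
Definition tau (x : Iinf) : Kq := form L (tlow t x) (tlow t x).
Definition T_ (x : Iinf) : Uq :=
  scal ((tau x)^-1 * (q_ D (idx x) ^+ 2 - 1)^-1) * t_ x.
(* (q^h; 0)_q *)
Definition qh0 (h : Pvee) : Uq := scal (qq - 1)^-1 * (Uq_q L h - 1).

Inductive UA1_gen : Uq -> Prop :=
| UA1_s x : UA1_gen (s_ x)
| UA1_T x : UA1_gen (T_ x)
| UA1_q h : UA1_gen (Uq_q L h)
| UA1_q0 h : UA1_gen (qh0 h).

Definition in_UA1 : Uq -> Prop := subalg (fun c => c \in A1_pred) UA1_gen.
Definition UA1_pred : {pred Uq} := fun x => `[< in_UA1 x >].

Lemma UA1_subring_closed : subring_closed UA1_pred.
Proof.
split.
- apply/asboolP; rewrite -(rmorph1 (@scal _ Uq)).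
  by apply: subalg_scal; apply: rpred1.
- by move=> x y /asboolP hx /asboolP hy; apply/asboolP/subalg_B.
- by move=> x y /asboolP hx /asboolP hy; apply/asboolP/subalg_M.
Qed.
HB.instance Definition _ := GRing.isSubringClosed.Build Uq UA1_pred UA1_subring_closed.

Record UA1 := InUA1 { UA1_val : Uq; UA1_valP : UA1_val \in UA1_pred }.
HB.instance Definition _ := [isSub for UA1_val].
HB.instance Definition _ := [Choice of UA1 by <:].
HB.instance Definition _ := 
  GRing.SubChoice_isSubPzRing.Build Uq UA1_pred UA1 (GRing.subringClosedP UA1_pred).

Lemma UA1_scal_subproof (c : A1) : (scal (A1_val c) : Uq) \in UA1_pred.
Proof. by apply/asboolP/subalg_scal/A1_valP. Qed.
Definition UA1_scal (c : A1) : UA1 := InUA1 (UA1_scal_subproof c).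
Lemma UA1_scal_is_zmod : zmod_morphism UA1_scal.
Proof. by move=> a b; apply: val_inj; rewrite /= !raddfB. Qed.
Lemma UA1_scal_is_monoid : monoid_morphism UA1_scal.
Proof. by split=> [|a b]; apply: val_inj; rewrite /= ?rmorph1 ?rmorphM. Qed.
Lemma UA1_scalC c x : UA1_scal c * x = x * UA1_scal c.
Proof. by apply: val_inj; rewrite /= scalC. Qed.
HB.instance Definition _ :=
  isPzAlgebra.Build A1 UA1 UA1_scal_is_zmod UA1_scal_is_monoid UA1_scalC.

Lemma UA1_genP x : UA1_gen x -> x \in UA1_pred.
Proof. by move=> h; apply/asboolP/subalg_gen. Qed.

(* U_1 = (A_1 / J_1) (x)_{A_1} U_{A_1}, as a Q-algebra *)
Definition U1 : Type := atens A1modJ1 UA1.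
HB.instance Definition _ := GRing.PzRing.on U1.
Definition U1_scal (c : rat) : U1 := (scal (rat_A1 c) : atens A1modJ1 UA1).
Lemma U1_scal_is_zmod : zmod_morphism U1_scal.
Proof. by move=> a b; rewrite /U1_scal !raddfB. Qed.
Lemma U1_scal_is_monoid : monoid_morphism U1_scal.
Proof. by split=> [|a b]; rewrite /U1_scal ?rmorph1 ?rmorphM. Qed.
Lemma U1_scalC c x : U1_scal c * x = x * U1_scal c.
Proof. exact: scalC. Qed.
HB.instance Definition _ :=
  isPzAlgebra.Build rat U1 U1_scal_is_zmod U1_scal_is_monoid U1_scalC.

Definition ubar (x : UA1) : U1 := apure 1 x.
Definition sbar (x : Iinf) : U1 := ubar (InUA1 (UA1_genP (UA1_s x))).
Definition Tbar (x : Iinf) : U1 := ubar (InUA1 (UA1_genP (UA1_T x))).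
Definition hbar (h : Pvee) : U1 := ubar (InUA1 (UA1_genP (UA1_q0 h))).
(* The Q-linear extension of hbar to the Cartan subalgebra *)
Definition hbarQ (h : cartan I) : U1 :=
  @lext rat (I + I)%type (algmod U1)
    (fun b => hbar << 1 *g (b : (I + I)%type) >>) h.

Section Modules.
Variables (V : lmodType Uq) (v0 : V).

Definition VA1_pred : {pred V} :=
  fun w => `[< exists2 u, u \in UA1_pred & w = u *: v0 >].
Lemma VA1_zmod_closed : zmod_closed VA1_pred.
Proof.
split; first by apply/asboolP; exists 0; rewrite ?rpred0 ?scale0r.
move=> x y /asboolP [u hu ->] /asboolP [u' hu' ->].
by apply/asboolP; exists (u - u'); rewrite ?rpredB ?scalerBl.
Qed.
HB.instance Definition _ := GRing.isZmodClosed.Build V VA1_pred VA1_zmod_closed.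

Record VA1 := InVA1 { VA1_val : V; VA1_valP : VA1_val \in VA1_pred }.
HB.instance Definition _ := [isSub for VA1_val].
HB.instance Definition _ := [Choice of VA1 by <:].
HB.instance Definition _ := [SubChoice_isSubZmodule of VA1 by <:].

Lemma VA1_act_subproof (u : UA1) (w : VA1) : UA1_val u *: VA1_val w \in VA1_pred.
Proof.
case: u w => u hu [w hw] /=; case/asboolP: (hw) => u' hu' ->.
by apply/asboolP; exists (u * u'); rewrite ?rpredM ?scalerA.
Qed.
Definition VA1_act (u : UA1) (w : VA1) : VA1 := InVA1 (VA1_act_subproof u w).

Definition VA1_scale (c : A1) (w : VA1) : VA1 := VA1_act (scal c) w.
Lemma VA1_scaleA a b x : VA1_scale a (VA1_scale b x) = VA1_scale (a * b) x.
Proof. by apply: val_inj; rewrite /= rmorphM scalerA. Qed.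
Lemma VA1_scale1 : left_id 1 VA1_scale.
Proof. by move=> x; apply: val_inj; rewrite /= rmorph1 scale1r. Qed.
Lemma VA1_scaleDr : right_distributive VA1_scale +%R.
Proof. by move=> a x y; apply: val_inj; rewrite /= scalerDr. Qed.
Lemma VA1_scaleDl x : {morph VA1_scale^~ x : a b / a + b}.
Proof. by move=> a b; apply: val_inj; rewrite /= rmorphD scalerDl. Qed.
HB.instance Definition _ := GRing.Zmodule_isLmodule.Build A1 VA1
  VA1_scaleA VA1_scale1 VA1_scaleDr VA1_scaleDl.

(* V^1 = (A_1 / J_1) (x)_{A_1} V_{A_1}, as a U_1-module:
   (a (x) u)(b (x) w) = ab (x) uw *)
Definition V1 : Type := tens (algmod A1modJ1) VA1.
HB.instance Definition _ := GRing.Zmodule.on V1.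

Lemma VA1_act_bilin : bilin (VA1_act : algmod UA1 -> VA1 -> VA1).
Proof.
split=> [n a m m'|m a n n']; apply: val_inj; rewrite /=.
  by rewrite scalerDl -scalerA.
by rewrite scalerDr !scalerA scalC.
Qed.

Lemma VA1_actA (x y : UA1) w : VA1_act x (VA1_act y w) = VA1_act (x * y) w.
Proof. by apply: val_inj; rewrite /= scalerA. Qed.
Lemma VA1_act1 w : VA1_act 1 w = w.
Proof. by apply: val_inj; rewrite /= scale1r. Qed.

Definition V1_scale (x : U1) (w : V1) : V1 :=
  tens_act (A := A1modJ1) (VA1_act : algmod UA1 -> VA1 -> VA1) x w.

Lemma V1_scaleA x y w : V1_scale x (V1_scale y w) = V1_scale (x * y) w.
Proof. exact: (tens_actA VA1_act_bilin VA1_actA). Qed.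
Lemma V1_scale1 : left_id 1 V1_scale.
Proof. exact: (tens_act1 VA1_act_bilin VA1_act1). Qed.
Lemma V1_scaleDr : right_distributive V1_scale +%R.
Proof. exact: (tens_actDr VA1_act_bilin). Qed.
Lemma V1_scaleDl w : {morph V1_scale^~ w : x y / x + y}.
Proof. exact: (tens_actDl VA1_act_bilin). Qed.
HB.instance Definition _ := GRing.Zmodule_isLmodule.Build U1 V1
  V1_scaleA V1_scale1 V1_scaleDr V1_scaleDl.

Definition vbar (w : VA1) : V1 := pure ((1 : A1modJ1) : algmod A1modJ1) w.
Lemma v0_in_VA1 : v0 \in VA1_pred.
Proof. by apply/asboolP; exists 1; rewrite ?rpred1 ?scale1r. Qed.
Definition v0bar : V1 := vbar (InVA1 v0_in_VA1).

Section WeightSpace.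
Variable mu : weight I.

Definition VA1mu_pred : {pred V} := fun w => (w \in VA1_pred) &&
  `[< forall h, Uq_q L h *: w = (scal (qq ^ wt_val mu h) : Uq) *: w >].
Lemma VA1mu_zmod_closed : zmod_closed VA1mu_pred.
Proof.
split.
  by apply/andP; split; [exact: rpred0 | apply/asboolP => h; rewrite !scaler0].
move=> x y /andP [hx /asboolP hx'] /andP [hy /asboolP hy'].
apply/andP; split; first exact: rpredB.
by apply/asboolP => h; rewrite !scalerBr hx' hy'.
Qed.
HB.instance Definition _ := GRing.isZmodClosed.Build V VA1mu_pred VA1mu_zmod_closed.

Record VA1mu := InVA1mu { VA1mu_val : V; VA1mu_valP : VA1mu_val \in VA1mu_pred }.
HB.instance Definition _ := [isSub for VA1mu_val].
HB.instance Definition _ := [Choice of VA1mu by <:].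
HB.instance Definition _ := [SubChoice_isSubZmodule of VA1mu by <:].

Lemma VA1mu_in_VA1 (w : VA1mu) : VA1mu_val w \in VA1_pred.
Proof. by case: w => w /= /andP []. Qed.
Definition VA1mu_incl (w : VA1mu) : VA1 := InVA1 (VA1mu_in_VA1 w).

Lemma VA1mu_scale_subproof (c : A1) (w : VA1mu) :
  (scal (A1_val c) : Uq) *: VA1mu_val w \in VA1mu_pred.
Proof.
apply/andP; split; first exact: (VA1_act_subproof (scal c) (VA1mu_incl w)).
case: w => w /= /andP [_ /asboolP hw]; apply/asboolP => h.
by rewrite scalerA -scalC -scalerA hw !scalerA scalC.
Qed.
Definition VA1mu_scale (c : A1) (w : VA1mu) : VA1mu :=
  InVA1mu (VA1mu_scale_subproof c w).
Lemma VA1mu_scaleA a b x : VA1mu_scale a (VA1mu_scale b x) = VA1mu_scale (a * b) x.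
Proof. by apply: val_inj; rewrite /= rmorphM scalerA. Qed.
Lemma VA1mu_scale1 : left_id 1 VA1mu_scale.
Proof. by move=> x; apply: val_inj; rewrite /= rmorph1 scale1r. Qed.
Lemma VA1mu_scaleDr : right_distributive VA1mu_scale +%R.
Proof. by move=> a x y; apply: val_inj; rewrite /= scalerDr. Qed.
Lemma VA1mu_scaleDl x : {morph VA1mu_scale^~ x : a b / a + b}.
Proof. by move=> a b; apply: val_inj; rewrite /= rmorphD scalerDl. Qed.
HB.instance Definition _ := GRing.Zmodule_isLmodule.Build A1 VA1mu
  VA1mu_scaleA VA1mu_scale1 VA1mu_scaleDr VA1mu_scaleDl.

Definition V1mu : Type := tens (algmod A1modJ1) VA1mu.
HB.instance Definition _ := GRing.Zmodule.on V1mu.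
(* The map V^1_mu -> V^1 induced by the inclusion *)
Definition V1mu_incl : V1mu -> V1 :=
  tmap (fun a : algmod A1modJ1 => a) VA1mu_incl.
End WeightSpace.
End Modules.
End A1Forms.

Section Ug.
Variables (I : countType) (D : cartan_datum I).
Local Notation Iinf := (Iinf D).
Local Notation cartan := (cartan I).

Definition corootQ (i : I) : cartan := << 1 *g (inl i : (I + I)%type) >>.

Section Relations.
Variables (A : pzAlgType rat) (H : cartan -> A) (E F : Iinf -> A).

Inductive Ug_rel : A -> Prop :=
| Ug_lin c h h' : Ug_rel (H (c *: h + h') - (scal c * H h + H h'))
| Ug_hh h h' : Ug_rel (comm (H h) (H h'))
| Ug_ef i j : Ug_rel (comm (E i) (F j)
    - (if i == j then scal (lev i)%:R * H (corootQ (idx i)) else 0))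
| Ug_he h j : Ug_rel (comm (H h) (E j)
    - scal ((lev j)%:R * (alpha D (idx j) h : rat)) * E j)
| Ug_hf h j : Ug_rel (comm (H h) (F j)
    - scal (- ((lev j)%:R * (alpha D (idx j) h : rat))) * F j)
| Ug_serreE i j of is_real D (idx i) & i != j :
    Ug_rel (iter (serre_exp i j) (comm (E i)) (E j))
| Ug_serreF i j of is_real D (idx i) & i != j :
    Ug_rel (iter (serre_exp i j) (comm (F i)) (F j))
| Ug_commE i j of cm D (idx i) (idx j) = 0 : Ug_rel (comm (E i) (E j))
| Ug_commF i j of cm D (idx i) (idx j) = 0 : Ug_rel (comm (F i) (F j)).
End Relations.

Definition Ug_gen : Type := (cartan + (Iinf + Iinf))%type.
HB.instance Definition _ := Choice.on Ug_gen.
Definition Ug_free : Type := falg rat Ug_gen.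
HB.instance Definition _ := PzAlgebra.on Ug_free.
Definition Ug_gH (h : cartan) : Ug_free := @fgen rat Ug_gen (inl h).
Definition Ug_gE (x : Iinf) : Ug_free := @fgen rat Ug_gen (inr (inl x)).
Definition Ug_gF (x : Iinf) : Ug_free := @fgen rat Ug_gen (inr (inr x)).

Definition Ug : Type := aquot (Ug_rel Ug_gH Ug_gE Ug_gF).
HB.instance Definition _ := PzAlgebra.on Ug.
Definition Ug_pi : Ug_free -> Ug := api (Ug_rel Ug_gH Ug_gE Ug_gF).
Definition Ug_h (h : cartan) : Ug := Ug_pi (Ug_gH h).
Definition Ug_e (x : Iinf) : Ug := Ug_pi (Ug_gE x).
Definition Ug_f (x : Iinf) : Ug := Ug_pi (Ug_gF x).

Definition in_weight_space (mu : weight I) (M : lmodType Ug) (w : M) : Prop :=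
  forall h, Ug_h h *: w = (scal (mu h : rat) : Ug) *: w.

Record is_highest_weight (lam : weight I) (M : lmodType Ug) (v : M) : Prop := {
  hw_neq0 : v != 0;
  hw_e : forall x, Ug_e x *: v = 0;
  hw_h : in_weight_space lam v;
  hw_gen : forall w : M, exists u : Ug, w = u *: v
}.
End Ug.

(* A B-module seen as an A-module through phi : A -> B *)
Definition pullback (A B : pzRingType) (phi : {rmorphism A -> B})
  (M : lmodType B) : Type := M.
Section Pullback.
Variables (A B : pzRingType) (phi : {rmorphism A -> B}) (M : lmodType B).
Local Notation pb := (pullback phi M).
HB.instance Definition _ := GRing.Zmodule.copy pb M.
Definition pullback_scale (a : A) (x : pb) : pb := phi a *: (x : M).
Lemma pullback_scaleA a b x :
  pullback_scale a (pullback_scale b x) = pullback_scale (a * b) x.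
Proof. by rewrite /pullback_scale scalerA rmorphM. Qed.
Lemma pullback_scale1 : left_id 1 pullback_scale.
Proof. by move=> x; rewrite /pullback_scale rmorph1 scale1r. Qed.
Lemma pullback_scaleDr : right_distributive pullback_scale +%R.
Proof. by move=> a x y; rewrite /pullback_scale scalerDr. Qed.
Lemma pullback_scaleDl x : {morph pullback_scale^~ x : a b / a + b}.
Proof. by move=> a b; rewrite /pullback_scale rmorphD scalerDl. Qed.
HB.instance Definition _ := GRing.Zmodule_isLmodule.Build A pb
  pullback_scaleA pullback_scale1 pullback_scaleDr pullback_scaleDl.
End Pullback.

(* Main.v *)
Require Import Defs.
From HB Require Import structures.
From mathcomp Require Import all_boot all_order all_algebra.
From mathcomp Require Import generic_quotient finmap monalg ring.
From mathcomp.classical Require Import boolp.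

(** Everything follows from a few relations between the elements t_x, s_x and T_x of
the quantum algebra, together with a passage to the limit q = 1 that is insensitive
to how the elements were built.

Commutator of s_x and t_y ([primitive_comm]).  Modulo the radical of the form,
t_x is primitive: it is orthogonal to every word in the f's other than the
single letter f_x, so (t_x, ab) = e(a) (t_x, b) + (t_x, a) e(b) with e the
augmentation.  Hence contracting the coproduct of t_x on the left against a word
w gives e(w) t_x + (t_x, w) modulo the radical ([pi_contract_l]), and contracting
it on the right against t_y gives (t_x, t_y) K_y ([pi_contract_r]).  Inserted in
the Drinfeld relation of the pair (t_y, t_x), whose two sides are iterated
contractions, this leaves s_x t_y - t_y s_x = (t_x, t_y) (K_x - K_x^-1).

Serre relations ([tlow_serre], [tlow_comm]).  An element t_x is a combination of
words whose letters all carry the index of x and whose levels add up to that of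
x.  The quantum Serre sum is an iterated commutator twisted by powers of q
([serre_sum_qadn]); twisted commutators satisfy a Leibniz rule, so the relations
of the letters of a word, of orders adding up correctly, give the relation for
the word ([qadn_mul]).  The relations [f_x, f_y] = 0 pass to t_x and t_y in the
same way, and those of s_x follow by applying omega.

The limit ([classical_relations], [psi]).  The relation [lim] u x says that u
lies in the integral form and that x is its class in U_1.  It is functional,
compatible with the ring operations, and sends a scalar regular at q = 1 to its
value there ([ev]).  Taking limits in the relations above, the twists disappear,
(q^m - 1) / (q - 1) becomes m, and the defining relations of the classical
enveloping algebra come out.  As the integral form is generated by elements with
limits in the image of psi, psi is onto.

Modules.  The lattice V_A1 is spanned over A_1 by the words in the T's applied to
the highest weight vector ([VA1_span]): the commutation of s_x with T_x produces
scalars (q^z - q^-z) / (q_i^2 - 1) that are regular at 1.  All these spanning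
vectors are weight vectors, both before and after the limit, and weights are
independent ([weight_component]).  Consequently v_lambda is not divisible by
q - 1 in the lattice, so that its class is nonzero ([v_not_divisible]); and a
vector of V^1 of weight mu only involves words of weight mu, so it comes from the
lattice of weight mu ([V1mu_weight_space]).  Finally V_A1 modulo its part of
weight mu has no (q - 1)-torsion, which makes V^1_mu a subspace of V^1
([V1mu_incl_inj]). *)

Set Implicit Arguments.
Unset Strict Implicit.
Unset Printing Implicit Defensive.

Import Order.TTheory GRing.Theory Num.Theory.
Local Open Scope ring_scope.

(** * Scalars, commutators and homomorphisms *)

Lemma scalCA (R : pzRingType) (A : pzAlgType R) (a : R) (x y : A) :
  x * (scal a * y) = scal a * (x * y).
Proof. by rewrite mulrA -scalC mulrA. Qed.

Section AlgHom.
Variables (R : pzRingType) (A B : pzAlgType R) (p : A -> B).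
Hypothesis ph : alg_hom p.
Lemma alg_homB x y : p (x - y) = p x - p y. Proof. by case: ph. Qed.
Lemma alg_homM x y : p (x * y) = p x * p y. Proof. by case: ph => _ []. Qed.
Lemma alg_hom1 : p 1 = 1. Proof. by case: ph => _ []. Qed.
Lemma alg_homS c : p (scal c) = scal c. Proof. by case: ph. Qed.
Lemma alg_hom0 : p 0 = 0. Proof. by rewrite -(subrr 0) alg_homB subrr. Qed.
Lemma alg_homD x y : p (x + y) = p x + p y.
Proof. by rewrite -[y in LHS]opprK alg_homB -[- y]sub0r alg_homB alg_hom0 sub0r opprK. Qed.
End AlgHom.

Lemma alg_hom_comp (R : pzRingType) (A B C : pzAlgType R) (f : A -> B) (g : B -> C) :
  alg_hom f -> alg_hom g -> alg_hom (fun x => g (f x)).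
Proof.
case=> fB [f1 fM] fS [gB [g1 gM] gS]; split=> [x y||c].
- by rewrite fB gB.
- by split=> [|x y]; rewrite ?f1 ?g1 // fM gM.
- by rewrite fS gS.
Qed.

Lemma api_alg_hom (R : pzRingType) (A : pzAlgType R) (G : A -> Prop) : alg_hom (api G).
Proof. by split; [exact: api_is_zmod | exact: api_is_monoid | move=> c]. Qed.
Lemma api_rel0 (R : pzRingType) (A : pzAlgType R) (G : A -> Prop) x : G x -> api G x = 0.
Proof.
move=> h; rewrite -(raddf0 (api G)).
by apply/api_eq; rewrite subr0; apply: ideal_in.
Qed.

Section SubalgebraFacts.
Variables (R : pzRingType) (A : pzAlgType R) (G : A -> Prop).
Lemma subalg_1 : subalgebra G 1.
Proof. by rewrite -(rmorph1 (@scal _ A)); apply: subalg_scal. Qed.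
Lemma subalg_prod (J : Type) (s : seq J) (F : J -> A) :
  (forall j, G (F j)) -> subalgebra G (\prod_(j <- s) F j).
Proof.
move=> h; elim/big_ind: _ => [|u v|j _]; first exact: subalg_1.
  exact: subalg_M.
exact/subalg_gen/h.
Qed.
Lemma subalg_0 : subalgebra G 0.
Proof. by rewrite -(rmorph0 (@scal _ A)); apply: subalg_scal. Qed.
Lemma subalg_D (u v : A) :
  subalgebra G u -> subalgebra G v -> subalgebra G (u + v).
Proof.
move=> hu hv; rewrite -[v]opprK -[- v]sub0r; apply: subalg_B => //.
by apply: subalg_B => //; exact: subalg_0.
Qed.
End SubalgebraFacts.

(** Enlarging the set of generators; used to pass from U^- to the larger algebras
on which the form is compatible with the coproduct. *)
Lemma subalg_sub (R : pzRingType) (A : pzAlgType R) (G G' : A -> Prop) (u : A) :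
  (forall v, G v -> G' v) -> subalgebra G u -> subalgebra G' u.
Proof.
move=> h; elim=> [v /h|c _|v v' _ hv _ hv'|v v' _ hv _ hv'].
- exact: subalg_gen.
- exact: subalg_scal.
- exact: subalg_B.
- exact: subalg_M.
Qed.

Lemma comm_lin (R : pzRingType) (A : pzAlgType R) c (x u v : A) :
  comm x (scal c * u + v) = scal c * comm x u + comm x v.
Proof. by rewrite /comm mulrDr mulrDl scalCA -mulrA opprD addrACA mulrBr. Qed.
Lemma comm_anti (A : pzRingType) (x y : A) : comm x y = - comm y x.
Proof. by rewrite /comm opprB. Qed.
Lemma comm0 (A : pzRingType) (x : A) : comm x 0 = 0. Proof. by rewrite /comm mulr0 mul0r subrr. Qed.

Lemma comm_B1 (A : pzRingType) (a b : A) : comm (a - 1) b = comm a b.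
Proof. by rewrite /comm mulrBl mulrBr mul1r mulr1 opprB addrA subrK. Qed.

Lemma comm_scalr (K : fieldType) (A : pzAlgType K) (a x : A) b :
  comm a (scal b * x) = scal b * comm a x.
Proof. by rewrite /comm scalCA -mulrA -mulrBr. Qed.
Lemma comm_scall (K : fieldType) (A : pzAlgType K) (a x : A) b :
  comm (scal b * a) x = scal b * comm a x.
Proof. by rewrite /comm scalCA -mulrA -mulrBr. Qed.

Lemma comm_scal0 (K : fieldType) (A : pzAlgType K) (f x : A) a b :
  comm f x = 0 -> comm (scal a * f) (scal b * x) = 0.
Proof. by move=> e; rewrite comm_scall comm_scalr e !mulr0. Qed.

Lemma comm_hom0 (K : pzRingType) (A B : pzAlgType K) (g : A -> B) f x :
  alg_hom g -> comm f x = 0 -> comm (g f) (g x) = 0.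
Proof.
by move=> gh e; rewrite /comm -!(alg_homM gh) -(alg_homB gh) [f * x - _]e (alg_hom0 gh).
Qed.

Lemma hom_conj (K : fieldType) (A B : pzAlgType K) (g : A -> B) (a x : A) c :
  alg_hom g -> a * x = scal c * (x * a) -> g a * g x = scal c * (g x * g a).
Proof.
by move=> gh e; rewrite -!(alg_homM gh) e (alg_homM gh) (alg_homS gh).
Qed.

Lemma hom_scal_conj (K : fieldType) (A : pzAlgType K) (a x : A) b c :
  a * x = scal c * (x * a) -> a * (scal b * x) = scal c * ((scal b * x) * a).
Proof. by move=> e; rewrite scalCA e -mulrA (scalCA b (scal c)). Qed.

Section ConjSwap.
Variables (K : fieldType) (A : pzAlgType K).
Lemma conj_swap (a b x : A) c : a * x * b - scal c * x = 0 -> b * a = 1 ->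
  a * x = scal c * (x * a).
Proof. by move=> /eqP; rewrite subr_eq0 => /eqP e h; rewrite mulrA -e -mulrA h mulr1. Qed.
Lemma lin_alg_hom (B : pzAlgType K) (f : A -> B) c x y :
  alg_hom f -> f (scal c * x + y) = scal c * f x + f y.
Proof. by move=> fh; rewrite (alg_homD fh) (alg_homM fh) (alg_homS fh). Qed.
End ConjSwap.

(** How tau is divided out of the commutator of s_x and t_y when t_y is normalised to T_y. *)
Lemma scal_ifK (K : fieldType) (A : pzAlgType K) (b : bool) (x y : A) (a c : K) : a != 0 ->
  x = (if b then scal a * y else 0) ->
  scal (a^-1 * c) * x = if b then scal c * y else 0.
Proof.
move=> a0 ->; case: b; last by rewrite mulr0.
by rewrite mulrA -rmorphM mulrAC mulVf // mul1r.
Qed.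

Lemma mulrB_mulr (R : pzRingType) (d d' p p' : R) :
  d * d' - p * p' = (d - p) * (d' - p') + ((d - p) * p' + p * (d' - p')).
Proof. by rewrite addrA -mulrDr subrK mulrBl mulrBr addrA subrK. Qed.

(** * Iterated twisted commutators *)

Section TwistedAdjoint.
Variables (K : comNzRingType) (A : pzAlgType K).
Implicit Types (c : K) (f x y : A) (n : nat).

Definition qad f c x : A := f * x - scal c * (x * f).

(** The twist is multiplied by q^2 at each application.  Starting at q^-m, the
successive twists of the (m+1)-fold iterate are q^-m, q^(2-m), ..., q^m: these are
the factors of the quantum Serre relation. *)
Fixpoint qadn f (q : K) c n x : A :=
  if n is n'.+1 then qadn f q (c * q ^+ 2) n' (qad f c x) else x.

Lemma qad_is_linear f c a x y :
  qad f c (scal a * x + y) = scal a * qad f c x + qad f c y.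
Proof.
rewrite /qad mulrBr mulrDr mulrDl mulrDr opprD addrACA (scalCA a f x).
by rewrite -mulrA (scalCA a (scal c)).
Qed.

Lemma qadnP f q c n a x y :
  qadn f q c n (scal a * x + y) = scal a * qadn f q c n x + qadn f q c n y.
Proof. by elim: n c x y => //= n IH c x y; rewrite qad_is_linear IH. Qed.

Lemma qad0 f c : qad f c 0 = 0.
Proof. by rewrite /qad mul0r !mulr0 subrr. Qed.
Lemma qadn0 f q c n : qadn f q c n 0 = 0.
Proof.
by elim: n c => //= n IH c; rewrite qad0 IH.
Qed.
Lemma qadnD f q c n x y : qadn f q c n (x + y) = qadn f q c n x + qadn f q c n y.
Proof. by have := qadnP f q c n 1 x y; rewrite rmorph1 !mul1r. Qed.
Lemma qadnZ f q c n a x : qadn f q c n (scal a * x) = scal a * qadn f q c n x.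
Proof. by have := qadnP f q c n a x 0; rewrite !addr0 qadn0 addr0. Qed.

Lemma qadn_scal f q c n a x :
  qadn (scal a * f) q c n x = scal (a ^+ n) * qadn f q c n x.
Proof.
elim: n c x => [|n IH] c x /=; first by rewrite expr0 rmorph1 mul1r.
have -> : qad (scal a * f) c x = scal a * qad f c x.
  by rewrite /qad mulrBr (scalCA a x f) (scalCA a (scal c)) -mulrA.
by rewrite qadnZ IH mulrA -rmorphM -exprS.
Qed.

(** The Leibniz rule for twisted commutators: the twist of a product is the product
of the twists. *)
Lemma qad_mul f c c' x y :
  qad f (c * c') (x * y) = qad f c x * y + scal c * (x * qad f c' y).
Proof.
by rewrite /qad mulrBl !mulrBr addrA (scalCA c' x) rmorphM -!mulrA subrK.
Qed.

(** Each application of the Leibniz rule spends one twisted commutator on x or on y,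
and multiplies the corresponding twist by q^2, exactly as [qadn] prescribes for that
factor.  After n applications with a + b <= n + 1, every term has spent a on x or b
on y.  This is the quantum form of the remark that ad(f)^(a+b-1) kills xy when
ad(f)^a kills x and ad(f)^b kills y. *)
Lemma qadn_mul f q n c c' x y a b :
    (a + b <= n.+1)%N -> qadn f q c a x = 0 -> qadn f q c' b y = 0 ->
  qadn f q (c * c') n (x * y) = 0.
Proof.
elim: n c c' x y a b => [|n IH] c c' x y [|a] [|b] leab /= hx hy //;
  rewrite ?hx ?hy ?mul0r ?mulr0 ?qad0 ?qadn0 //.
  by move: leab; rewrite addSn addnS.
rewrite qad_mul qadnD.
(* The term where x was hit: the factor q^2 goes to the twist of x. *)
have -> : qadn f q (c * c' * q ^+ 2) n (qad f c x * y) = 0.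
  have -> : c * c' * q ^+ 2 = (c * q ^+ 2) * c' by ring.
  by apply: (IH _ _ _ _ a b.+1) => //; rewrite addSn in leab.
(* The term where y was hit: the twist c' q^2 of y absorbs it by reassociation. *)
have -> : qadn f q (c * c' * q ^+ 2) n (scal c * (x * qad f c' y)) = 0.
  rewrite qadnZ -mulrA (IH _ _ _ _ a.+1 b) ?mulr0 //.
  by rewrite addnS in leab.
by rewrite addr0.
Qed.

End TwistedAdjoint.

Lemma qadn_hom (K : comNzRingType) (A B : pzAlgType K) (g : A -> B) f q c n x :
  alg_hom g -> g (qadn f q c n x) = qadn (g f) q c n (g x).
Proof.
move=> gh; elim: n c x => //= n IH c x; rewrite IH; congr qadn.
by rewrite /qad (alg_homB gh) (alg_homM gh) (alg_homM gh) (alg_homM gh) (alg_homS gh).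
Qed.

Lemma qadn_hom0 (K : comNzRingType) (A B : pzAlgType K) (g : A -> B) f q c n x :
  alg_hom g -> qadn f q c n x = 0 -> qadn (g f) q c n (g x) = 0.
Proof. by move=> gh e; rewrite -qadn_hom // e (alg_hom0 gh). Qed.

Lemma qadn_scal0 (K : comNzRingType) (A : pzAlgType K) (f : A) q c n x a b :
  qadn f q c n x = 0 -> qadn (scal a * f) q c n (scal b * x) = 0.
Proof. by move=> e; rewrite qadn_scal qadnZ e !mulr0. Qed.

(** * Gaussian binomials and the quantum Serre sum *)

Section GaussBinomial.
Variables (K : fieldType) (A : pzAlgType K) (q : K).
Hypothesis q_neq0 : q != 0.

(** The symmetric Gaussian binomial, by its Pascal recursion.  Unlike the quotient of
factorials it makes sense for every q, and the recursion is what the expansion of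
an iterated commutator produces. *)
Fixpoint gbin (n k : nat) : K :=
  match n, k with
  | _, 0 => 1
  | 0, _.+1 => 0
  | n'.+1, k'.+1 => q ^+ k * gbin n' k + q ^- (n' - k') * gbin n' k'
  end.

Lemma gbinn0 n : gbin n 0 = 1. Proof. by case: n. Qed.
Lemma gbin_small n k : (n < k)%N -> gbin n k = 0.
Proof.
elim: n k => [|n IH] [|k] //= lt.
by rewrite (IH k) // (IH k.+1) ?mulr0 ?addr0 //; apply: ltnW.
Qed.

Definition gint (n : nat) : K := (q ^+ n - q ^- n) / (q - q^-1).
Definition gfact (n : nat) : K := \prod_(1 <= k < n.+1) gint k.

Hypothesis gint_neq0 : forall n, (0 < n)%N -> gint n != 0.

Lemma gfactS n : gfact n.+1 = gint n.+1 * gfact n.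
Proof. by rewrite /gfact big_nat_recr //= mulrC. Qed.
Lemma gfact_neq0 n : gfact n != 0.
Proof.
elim: n => [|n IH]; first by rewrite /gfact big_geq ?oner_eq0.
by rewrite gfactS mulf_neq0 ?gint_neq0.
Qed.

(** The identity of q-integers behind the Pascal recursion. *)
Lemma gint_add k m : gint (k + m) = q ^+ k * gint m + q ^- m * gint k.
Proof.
rewrite /gint !mulrA -mulrDl; congr (_ / _).
rewrite !exprD invfM; field.
by rewrite !expf_neq0.
Qed.

Lemma gbinE n k : (k <= n)%N -> gbin n k = gfact n / (gfact k * gfact (n - k)).
Proof.
have f0 : gfact 0 = 1 by rewrite /gfact big_geq.
elim: n k => [|n IH] [|k] //= le.
- by rewrite f0 mul1r mulr1 invr1.
- by rewrite f0 mul1r subn0 divff ?gfact_neq0.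
rewrite ltnS in le; rewrite subSS; move: le; rewrite leq_eqVlt => /orP [/eqP ->|lt].
  rewrite gbin_small // mulr0 add0r IH // subnn f0 expr0 invr1 mul1r mulr1.
  by rewrite mulr1 !divff ?gfact_neq0.
have -> : (n - k = (n - k.+1).+1)%N by rewrite -subSn ?subSS.
rewrite !IH //; last exact: ltnW.
have -> : (n - k = (n - k.+1).+1)%N by rewrite -subSn ?subSS.
rewrite !gfactS.
have -> : gint n.+1 = q ^+ k.+1 * gint (n - k.+1).+1 + q ^- (n - k.+1).+1 * gint k.+1.
  by rewrite -gint_add; congr gint; rewrite addnS subnKC.
field.
rewrite !gfact_neq0 !gint_neq0 //= expf_neq0 //.
Qed.

(** Left and right multiplication by f commute and the twists are in geometric
progression, so this is the q-binomial theorem. *)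
Lemma qadn_gbin f c n (x : A) : qadn f q c n x =
  \sum_(k < n.+1) scal ((-1) ^+ k * c ^+ k * (q ^+ k) ^+ n / q ^+ k * gbin n k)
     * (f ^+ (n - k) * x * f ^+ k).
Proof.
elim: n c x => [|n IH] c x.
  rewrite big_ord1 /= !expr0 !mulr1 mul1r invr1 rmorph1 !mul1r //.
rewrite [LHS]/= IH.
pose g k : A := f ^+ (n.+1 - k) * x * f ^+ k.
pose a k : K := (-1) ^+ k * (c * q ^+ 2) ^+ k * (q ^+ k) ^+ n / q ^+ k * gbin n k.
(* Expanding the innermost commutator splits every term into two neighbours. *)
have -> : \sum_(k < n.+1) scal (a k) * (f ^+ (n - k) * qad f c x * f ^+ k) =
   \sum_(k < n.+1) scal (a k) * g k - \sum_(k < n.+1) scal (a k * c) * g k.+1.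
  rewrite -sumrB; apply: eq_bigr => -[k /= lek] _.
  rewrite /qad mulrBr !mulrBl mulrBr /g; congr (_ - _).
    by rewrite subSn // !exprSr !mulrA.
  rewrite (rmorphM (@scal K A) (a k) c) subSS (exprS f k) -!mulrA.
  by rewrite (scalCA c).
have -> : \sum_(k < n.+1) scal (a k) * g k
    = scal (a 0) * g 0 + \sum_(k < n.+1) scal (a k.+1) * g k.+1.
  rewrite big_ord_recl [in RHS]big_ord_recr /= addrA.
  have -> : a n.+1 = 0 by rewrite /a gbin_small ?mulr0.
  by rewrite rmorph0 mul0r addr0.
(* Both sums now run over f^(n-k) x f^(k+1): compare coefficients, which is the
Pascal recursion of [gbin]. *)
rewrite -addrA -sumrB [RHS]big_ord_recl; congr (_ + _).
  by rewrite /a /g /= !expr0 !gbinn0 !mulr1 !expr1n.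
apply: eq_bigr => -[k /= lek] _; rewrite -mulrBl -raddfB; congr (scal _ * _).
rewrite /a; have [m ->] : exists m, n = (k + m)%N by exists (n - k)%N; rewrite subnKC.
rewrite addKn; move: (gbin _ _) (gbin _ _) => u v.
rewrite /bump leq0n add1n !(exprMn _ c) !(exprAC q 2).
have -> : (q ^+ k.+1) ^+ (k + m) = (q ^+ k) ^+ (k + m) * (q ^+ k * q ^+ m).
  by rewrite exprS exprMn mulrC -exprD.
have -> : (q ^+ k.+1) ^+ (k + m).+1 = (q ^+ k) ^+ (k + m) * (q ^+ k * q ^+ m) * q ^+ k.+1.
  by rewrite exprSr; congr (_ * _); rewrite exprS exprMn mulrC -exprD.
rewrite !exprS; field.
by rewrite !expf_neq0.
Qed.
End GaussBinomial.

Section SerreSum.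
Variables (K : fieldType) (A : pzAlgType K) (q : K).
Hypothesis q_neq0 : q != 0.
Hypothesis gint_neq0 : forall n, (0 < n)%N -> gint q n != 0.

(** The quantum Serre sum is an iterated twisted commutator: for the initial twist
q^-N the powers of q in the q-binomial expansion cancel. *)
Lemma serre_sum_qadn (f x : A) N :
  \sum_(k < N.+2) (-1) ^+ k * scal (gfact q N.+1 / (gfact q k * gfact q (N.+1 - k)))
      * f ^+ (N.+1 - k) * x * f ^+ k
  = qadn f q (q ^- N) N.+1 x.
Proof.
rewrite (qadn_gbin q_neq0); apply: eq_bigr => k _; have lek := ltn_ord k.
rewrite -!mulrA mulrA; congr (_ * _).
rewrite -(gbinE q_neq0 gint_neq0); last by rewrite -ltnS.
have -> : (-1) ^+ k = scal ((-1) ^+ k) :> A by rewrite rmorphXn rmorphN1.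
rewrite -rmorphM; congr (scal _); congr (_ * _).
have qk : q ^+ k != 0 by rewrite expf_neq0.
(* q^(-Nk) q^(k(N+1)) q^(-k) = 1. *)
have e : (q ^- N) ^+ k = ((q ^+ k) ^+ N)^-1 by rewrite exprVn exprAC.
by rewrite e exprSr !mulrA mulVf ?expf_neq0 // mul1r divff // mul1r.
Qed.
End SerreSum.

(** * Independence of eigenvectors *)

Section Eigenvectors.
Variables (K : fieldType) (A : pzAlgType K) (M : lmodType A) (H : Type) (X : H -> A).

Lemma scal_inj0 (c : K) (x : M) : c != 0 -> (scal c : A) *: x = 0 -> x = 0.
Proof.
move=> c0 e; rewrite -[x]scale1r -(rmorph1 (@scal K A)) -(mulVf c0) rmorphM.
by rewrite -scalerA e scaler0.
Qed.

Definition is_weight_vec (mu : H -> K) (x : M) :=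
  forall h, X h *: x = (scal (mu h) : A) *: x.

Lemma is_weight_vecZ mu c x : is_weight_vec mu x -> is_weight_vec mu ((scal c : A) *: x).
Proof. by move=> hx h; rewrite scalerA -scalC -scalerA hx !scalerA scalC. Qed.

Lemma is_weight_vecB mu x y : is_weight_vec mu x -> is_weight_vec mu y -> is_weight_vec mu (x - y).
Proof. by move=> hx hy h; rewrite !scalerBr hx hy. Qed.

(** Applying X h - nu_j(h), for an h that separates nu_j from mu, kills the first
term of the sum, multiplies the others by scalars and x by mu(h) - nu_j(h), which is
nonzero; induct on the number of terms. *)
Lemma weight_sum_eq0 mu x (J : Type) (s : seq J) (nu : J -> H -> K) (y : J -> M) :
    is_weight_vec mu x -> (forall j, is_weight_vec (nu j) (y j)) ->
    (forall j, nu j <> mu) -> x = \sum_(j <- s) y j -> x = 0.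
Proof.
move=> hx hy ne; elim: s x y hx hy => [|j s IH] x y hx hy; first by rewrite big_nil.
rewrite big_cons => ex.
have [h hh] : exists h, nu j h != mu h.
  apply: contrapT => e; apply: (ne j); apply: funext => h.
  by apply/eqP; apply: contra_notT e => hh; exists h.
have d0 : mu h - nu j h != 0 by rewrite subr_eq0 eq_sym.
apply: (scal_inj0 d0).
apply: (IH _ (fun i => (scal (nu i h - nu j h) : A) *: y i)).
- exact: is_weight_vecZ.
- by move=> i; exact: is_weight_vecZ.
rewrite raddfB scalerBl -hx [in LHS]ex scalerDr hy scalerDr opprD addrACA subrr add0r.
rewrite !scaler_sumr -sumrB; apply: eq_bigr => i _.
by rewrite hy -scalerBl -raddfB.
Qed.

(** Subtract the terms of weight mu: the difference has weight mu and is a sum of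
vectors of other weights, so it vanishes by [weight_sum_eq0]. *)
Lemma weight_component mu x (J : Type) (s : seq J) (nu : J -> H -> K) (y : J -> M) :
    is_weight_vec mu x -> (forall j, is_weight_vec (nu j) (y j)) ->
  x = \sum_(j <- s) y j -> x = \sum_(j <- s | `[< nu j = mu >]) y j.
Proof.
move=> hx hy ex; apply/eqP; rewrite -subr_eq0; apply/eqP.
set P := fun j => `[< nu j = mu >].
have hs : is_weight_vec mu (\sum_(j <- s | P j) y j).
  apply: big_ind => [h|u v hu hv|j /asboolP <-] //; first by rewrite !scaler0.
  by move=> h; rewrite !scalerDr hu hv.
pose J' := {j : J | nu j <> mu}.
have e0 : x - \sum_(j <- s | P j) y j = \sum_(j <- s | ~~ P j) y j.
  by rewrite {1}ex (bigID P) /= addrAC subrr add0r.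
have [s' es'] : exists s' : seq J', \sum_(j <- s | ~~ P j) y j = \sum_(j <- s') y (sval j).
  elim: s {ex hs e0} => [|j s [s' IH]]; first by exists [::]; rewrite !big_nil.
  rewrite big_cons; case: ifP => [/negP hj|_]; last by exists s'.
  have nj : nu j <> mu by move=> e; apply: hj; apply/asboolP.
  by exists (exist _ j nj :: s'); rewrite big_cons IH.
rewrite es' in e0.
have hj (j : J') : is_weight_vec (nu (sval j)) (y (sval j)) by exact: hy.
exact: (weight_sum_eq0 (is_weight_vecB hx hs) hj (fun j => proj2_sig j) e0).
Qed.
End Eigenvectors.

(** In a vector space over K an eigenvector may be recognised on a nonzero multiple
of it; this is what makes the quotient of a lattice by an eigenspace torsion-free. *)
Lemma eigen_cancel (K : fieldType) (A : pzAlgType K) (V : lmodType A)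
    (c z : K) (a : A) (x : V) : c != 0 ->
  a *: ((scal c : A) *: x) = (scal z : A) *: ((scal c : A) *: x) ->
  a *: x = (scal z : A) *: x.
Proof.
move=> c0 e; apply/eqP; rewrite -subr_eq0; apply/eqP; apply: (scal_inj0 c0).
by rewrite scalerBr !scalerA !(scalC c) -!scalerA e subrr.
Qed.

(** * Spans and tensor products *)

Section SpanClosure.
Variables (R : pzRingType) (V : lmodType R) (G : V -> Prop).
Lemma lspanD x y : lspan G x -> lspan G y -> lspan G (x + y).
Proof. by move=> hx hy; rewrite -[x]scale1r; exact: lspan_comb. Qed.
Lemma lspan_sum (J : Type) (s : seq J) (P : pred J) (F : J -> V) :
  (forall j, P j -> lspan G (F j)) -> lspan G (\sum_(j <- s | P j) F j).
Proof.
move=> h; elim/big_ind: _ => //; [exact: lspan_0 | exact: lspanD].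
Qed.
End SpanClosure.

Section TensorFacts.
Variables (R : comNzRingType).

Section Lift2.
Variables (M N M' N' P : lmodType R) (F : M -> N -> M' -> N' -> P).
Hypothesis Fin : forall m n, bilin (F m n).
Hypothesis Fout : forall m' n', bilin (fun m n => F m n m' n').

(** The two sides of the Drinfeld relation are sums over two coproducts at once:
the lift of a map linear in each of four variables to a pair of tensors. *)
Definition tlift2 (d : tens M N) (d' : tens M' N') : P :=
  tlift (fun m n => tlift (F m n) d') d.

Lemma tlift2_bilin_out d' : bilin (fun m n => tlift (F m n) d').
Proof.
split=> [n a m m'|m a n n'].
- move: d'; apply: tens_eq => [c u v|c u v|m1 n1].
  + exact: (tliftP (Fin _ _)).
  + rewrite !(tliftP (Fin _ _)) !scalerDr !scalerA (mulrC a c) -!scalerA.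
    by rewrite addrACA.
  + by rewrite !(tlift_pure (Fin _ _)) (Fout m1 n1).1.
- move: d'; apply: tens_eq => [c u v|c u v|m1 n1].
  + exact: (tliftP (Fin _ _)).
  + rewrite !(tliftP (Fin _ _)) !scalerDr !scalerA (mulrC a c) -!scalerA.
    by rewrite addrACA.
  + by rewrite !(tlift_pure (Fin _ _)) (Fout m1 n1).2.
Qed.

Lemma tlift2_bilin : bilin tlift2.
Proof.
split=> [d' a d1 d2|d a d1 d2].
  exact: (tliftP (tlift2_bilin_out d')).
have lin d' := tliftP (tlift2_bilin_out d').
move: d; apply: tens_eq => [c u v|c u v|m n].
- exact: lin.
- rewrite /tlift2 !lin !scalerDr !scalerA (mulrC a c) -!scalerA.
  by rewrite addrACA.
- rewrite /tlift2 !(tlift_pure (tlift2_bilin_out _)).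
  exact: (tliftP (Fin _ _)).
Qed.

Lemma tlift2_pure_l m n d' : tlift2 (pure m n) d' = tlift (F m n) d'.
Proof. exact: (tlift_pure (tlift2_bilin_out d')). Qed.

Lemma tlift2_pure_r d m' n' :
  tlift2 d (pure m' n') = tlift (fun m n => F m n m' n') d.
Proof.
move: d; apply: tens_eq => [c u v|c u v|m n].
- exact: (tliftP (tlift2_bilin_out _)).
- exact: (tliftP (Fout _ _)).
- by rewrite tlift2_pure_l (tlift_pure (Fin _ _)) (tlift_pure (Fout _ _)).
Qed.
End Lift2.

Variables A B : pzAlgType R.
Lemma apureM (a a' : A) (b b' : B) : apure a b * apure a' b' = apure (a * a') (b * b').
Proof. exact: (tmap2_pure (@algmod_mul_bilin R A) (@algmod_mul_bilin R B)). Qed.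
Lemma apureDl (a a' : A) (b : B) : apure (a + a') b = apure a b + apure a' b.
Proof. by have := (pure_bilin (algmod A) (algmod B)).1 b 1 a a'; rewrite !scale1r. Qed.
Lemma apureDr (a : A) (b b' : B) : apure a (b + b') = apure a b + apure a b'.
Proof. by have := (pure_bilin (algmod A) (algmod B)).2 a 1 b b'; rewrite !scale1r. Qed.
Lemma apure0l (b : B) : apure (0 : A) b = 0.
Proof. by apply: (addrI (apure (0 : A) b)); rewrite -apureDl !addr0. Qed.
Lemma apure0r (a : A) : apure a (0 : B) = 0.
Proof. by apply: (addrI (apure a (0 : B))); rewrite -apureDr !addr0. Qed.
Lemma apureZl c (a : A) (b : B) : apure (scal c * a) b = c *: apure a b.
Proof.
have := (pure_bilin (algmod A) (algmod B)).1 b c a 0.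
rewrite addr0 => e; apply: etrans e _; rewrite -[RHS]addr0; congr (_ + _).
exact: apure0l.
Qed.
Lemma apureZr c (a : A) (b : B) : apure a (scal c * b) = c *: apure a b.
Proof.
have := (pure_bilin (algmod A) (algmod B)).2 a c b 0.
rewrite addr0 => e; apply: etrans e _; rewrite -[RHS]addr0; congr (_ + _).
exact: apure0r.
Qed.
Lemma apure_scal c (b : B) : apure (scal c : A) b = apure 1 (scal c * b).
Proof. by rewrite -[scal c as X in apure X _]mulr1 apureZl apureZr. Qed.
Lemma apureBr (a : A) (b b' : B) : apure a (b - b') = apure a b - apure a b'.
Proof. by apply: (addIr (apure a b')); rewrite -apureDr !subrK. Qed.
End TensorFacts.

Lemma tens_act_pure1 (R : comNzRingType) (A B : pzAlgType R) (N : lmodType R)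
    (act : algmod B -> N -> N) (hact : bilin act) (b : B) (n : N) :
  tens_act act (apure (1 : A) b) (pure ((1 : A) : algmod A) n) =
  pure ((1 : A) : algmod A) (act b n).
Proof.
apply: etrans (tmap2_pure (@algmod_mul_bilin R A) hact _ _ _ _) _.
by rewrite /algmod_mul mul1r.
Qed.

Section TensorQuotient.
Variables (R : comNzRingType) (A : pzAlgType R) (N : lmodType R) (tt : R).
Hypothesis scal_surj : forall a : A, exists c, a = scal c.
Hypothesis scal_ker : forall c, scal c = 0 :> A -> exists c', c = tt * c'.
Hypothesis scal_tt : scal tt = 0 :> A.
Local Notation one := ((1 : A) : algmod A).

Lemma pure1P c (n n' : N) : pure one (c *: n + n') = c *: pure one n + pure one n'.
Proof. exact: (pure_bilin (algmod A) N).2. Qed.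
Lemma pure1D (n n' : N) : pure one (n + n') = pure one n + pure one n'.
Proof. by have := pure1P 1 n n'; rewrite !scale1r. Qed.
Lemma pure10 : pure one (0 : N) = 0.
Proof. by apply: (addrI (pure one 0)); rewrite -pure1D !addr0. Qed.
Lemma pure1Z c (n : N) : pure one (c *: n) = c *: pure one n.
Proof. by have := pure1P c n 0; rewrite pure10 !addr0. Qed.
Lemma pure0l (n : N) : pure (0 : algmod A) n = 0.
Proof.
have := (pure_bilin (algmod A) N).1 n 1 0 0; rewrite !scale1r addr0 => e.
by apply: (addrI (pure (0 : algmod A) n)); rewrite -e addr0.
Qed.
Lemma pure_scal c (n : N) : pure (scal c : algmod A) n = pure one (c *: n).
Proof.
have := (pure_bilin (algmod A) N).1 n c one 0; rewrite addr0 pure0l addr0 pure1Z => <-.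
by congr pure; exact: (esym (mulr1 (scal c : A))).
Qed.

Lemma tens_pure1 (z : tens (algmod A) N) : exists n, z = pure one n.
Proof.
elim/tens_ind: z => [|a n|c x y [n ->] [n' ->]].
- by exists 0; rewrite pure10.
- by have [c ->] := scal_surj a; exists (c *: n); rewrite pure_scal.
- by exists (c *: n + n'); rewrite pure1P.
Qed.

Lemma pure1_tt (n : N) : pure one (tt *: n) = 0.
Proof. by rewrite -pure_scal scal_tt pure0l. Qed.

(* The multiples of elements of N by scalars that vanish in A; they span tt N. *)
Let G (x : N) : Prop := exists c n, scal c = 0 :> A /\ x = c *: n.
(* A chosen scalar with image a; [lq] says that the choice is immaterial in N / tt N. *)
Let rp (a : A) : R := projT1 (cid (scal_surj a)).
Let rpK a : scal (rp a) = a. Proof. by rewrite /rp; case: cid => c /= ->. Qed.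
Let lq c c' (n : N) : scal c = scal c' :> A -> lpi G (c *: n) = lpi G (c' *: n).
Proof.
move=> e; apply/lpi_eq; rewrite -scalerBl; apply: lspan_gen; exists (c - c'), n.
by rewrite (rmorphB (@scal R A)) /= e subrr.
Qed.
Let b (a : algmod A) (n : N) : lquot G := lpi G (rp a *: n).
Let b_bilin : bilin b.
Proof.
split=> [n c a a'|a c n n']; rewrite /b -(linearP (lpi G)); last first.
  by rewrite scalerDr !scalerA mulrC.
rewrite scalerA -scalerDl; apply: lq.
apply: etrans (rpK _) _; rewrite (rmorphD (@scal R A)) (rmorphM (@scal R A)) /=.
by congr (_ + _); rewrite [in RHS]rpK.
Qed.

(** Over A = R/(tt) the tensor product A (x) N is N / tt N.  The class map that
sends a (x) n to the class of c n, for any scalar c with image a, is well defined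
and detects whether n lies in tt N. *)
Lemma pure1_eq0 (n : N) : pure one n = 0 -> exists n', n = tt *: n'.
Proof.
move=> e; have : tlift b (pure one n) = 0 by rewrite e (tlift0 b_bilin).
rewrite (tlift_pure b_bilin) /b (@lq _ 1); last by rewrite rpK rmorph1.
rewrite scale1r -(raddf0 (lpi G)) => /lpi_eq; rewrite subr0.
elim=> {e n} [_ [c [n [/scal_ker [c' ->] ->]]]||a x y _ [n ->] _ [n' ->]].
- by exists (c' *: n); rewrite scalerA.
- by exists 0; rewrite scaler0.
- by exists (a *: n + n'); rewrite scalerDr !scalerA mulrC.
Qed.
Lemma pure1_eq (n n' : N) : pure one n = pure one n' -> exists u, n - n' = tt *: u.
Proof.
move=> e; apply: pure1_eq0; apply: (addIr (pure one n')).
by rewrite -pure1D subrK e add0r.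
Qed.
Lemma pure1_mod (n n' u : N) : n - n' = tt *: u -> pure one n = pure one n'.
Proof.
by move=> e; rewrite -[n](subrK n') e pure1D pure1_tt add0r.
Qed.
End TensorQuotient.

(** * Words in the lowering generators *)

Section Levels.
Variables (I : countType) (D : cartan_datum I).
Local Notation W := (words (Iinf D)).
Implicit Types (w u : W) (x y : Iinf D) (h : Pvee I).

(** K_w is the product of the K_i^l over the letters (i, l) of w, and equals q^h for
h = [Kexp w]. *)
Definition Kexp w : Pvee I := \sum_(x <- w) coroot (idx x) *~ ((cr D (idx x))%:Z * (lev x)%:Z).
Definition word_alpha h w : int := \sum_(x <- w) (lev x)%:Z * wt_val (alpha D (idx x)) h.
Lemma Kexp_cat w u : Kexp (w ++ u : W) = Kexp w + Kexp u.
Proof. exact: big_cat. Qed.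
Lemma lev_gt0 x : (0 < lev x)%N.
Proof. by case: x => -[i l] hx; case/andP: (hx). Qed.
Lemma lev_real x : is_real D (idx x) -> lev x = 1%N.
Proof. by case: x => -[i l] hx; case/andP: (hx) => _ /implyP h /h /eqP. Qed.
Lemma level_ex x m : (0 < m)%N -> (m <= lev x)%N ->
  exists y, [/\ insub (idx x, m) = Some y, idx y = idx x & lev y = m].
Proof.
move=> m0 ml; have hm : in_Iinf D (idx x, m).
  rewrite /in_Iinf m0 /=; apply/implyP => hr.
  by move: ml; rewrite lev_real // leq_eqVlt ltnS leqn0 => /orP [] // /eqP m0'; rewrite m0' in m0.
exists (exist _ (idx x, m) hm); split=> //; exact: insubT.
Qed.
Lemma Iinf_eq x y : idx x = idx y -> lev x = lev y -> x = y.
Proof.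
case: x y => -[i l] hx [[j k] hy]; rewrite /idx /lev /= => e e'.
by apply: val_inj; rewrite /= e e'.
Qed.

End Levels.

Section Degrees.
Variables (I : countType) (D : cartan_datum I).
Local Notation W := (words (Iinf D)).
Implicit Types (w u : W) (x y : Iinf D).

(** The simple roots are independent and levels are positive, so a word of degree
-l alpha_i uses the index i only. *)
Lemma wdeg_inv w x : wdeg w = - << (lev x)%:Z *g idx x >> ->
  (forall y, y \in (w : seq _) -> idx y = idx x) /\ (\sum_(y <- w) lev y = lev x)%N.
Proof.
move=> /oppr_inj e.
have co i : (\sum_(y <- w | idx y == i) lev y = if idx x == i then lev x else 0)%N.
  have /(congr1 (mcoeff i)) := e; rewrite raddf_sum /= mcoeffU => ei.
  apply/eqP; rewrite -eqz_nat; apply/eqP.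
  rewrite (big_morph Posz PoszD (erefl 0%:Z)) big_mkcond /=.
  rewrite (_ : Posz (if _ then _ else _) = (lev x)%:Z *+ (idx x == i)); last by case: ifP.
  by rewrite -ei; apply: eq_bigr => y _; rewrite mcoeffU; case: eqP.
have idxE y : y \in (w : seq _) -> idx y = idx x.
  move=> yw; apply/eqP; rewrite eq_sym; apply/negPn/negP => /negPf ne.
  have := co (idx y); rewrite ne (perm_big _ (perm_to_rem yw)) big_cons eqxx.
  by have := lev_gt0 y; case: (lev y).
split=> //; have := co (idx x); rewrite eqxx => <-.
rewrite big_seq [RHS]big_mkcond [RHS]big_seq; apply: eq_bigr => y /idxE ->.
by rewrite eqxx.
Qed.

Lemma wdeg_nil_neq x : wdeg ([::] : W) <> - << (lev x)%:Z *g idx x >> :> rootlat I.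
Proof.
by case/(@wdeg_inv [::]) => _; rewrite big_nil; have := lev_gt0 x; case: (lev x).
Qed.

Lemma wdeg1 x : wdeg ([:: x] : W) = - << (lev x)%:Z *g idx x >> :> rootlat I.
Proof. by rewrite /wdeg big_seq1. Qed.

(** Distinct generators have distinct degrees: t_x and t_y are orthogonal. *)
Lemma deg_inj x y :
  - << (lev x)%:Z *g idx x >> = - << (lev y)%:Z *g idx y >> :> rootlat I -> x = y.
Proof.
rewrite -wdeg1 => /(@wdeg_inv [:: x]) [h1 h2].
apply: Iinf_eq; first by apply: h1; rewrite inE eqxx.
by move: h2; rewrite big_seq1.
Qed.
End Degrees.

Section Words.
Variables (I : countType) (D : cartan_datum I) (K : fieldType).
Variables (U : pzAlgType K) (Q : Pvee I -> U) (F : Iinf D -> U).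
Local Notation W := (words (Iinf D)).
Implicit Types (w u : W) (x y : Iinf D) (h : Pvee I).

Definition fw w : U := \prod_(x <- w) F x.

Lemma fwE w : fw w = \prod_(x <- w) F x. Proof. by []. Qed.
Lemma fw_cat w u : fw (w ++ u : W) = fw w * fw u.
Proof. exact: big_cat. Qed.
Lemma fw_cons x w : fw (x :: w : W) = F x * fw w.
Proof. exact: big_cons. Qed.
Lemma fw_nil : fw [::] = 1. Proof. exact: big_nil. Qed.
Lemma fw1 x : fw [:: x] = F x. Proof. exact: big_seq1. Qed.

Definition Uminus := subalgebra (fun v : U => exists j, v = F j).
Definition Ule0 := subalgebra (fun v : U => (exists j, v = F j) \/ (exists h, v = Q h)).

(** The subalgebra generated by the f's and the K's.  The form is compatible with the
coproduct as soon as suitable arguments lie in it. *)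
Definition Ule0K := subalgebra (fun v : U => (exists j, v = F j) \/
  (exists i n, v = Q (coroot i *~ ((cr D i)%:Z * n)))).

Lemma fw_Uminus w : Uminus (fw w).
Proof. by apply: subalg_prod => x; exists x. Qed.
Lemma Uminus_Ule0K (u : U) : Uminus u -> Ule0K u.
Proof. by apply: subalg_sub => v hv; left. Qed.
Lemma Uminus_Ule0 (u : U) : Uminus u -> Ule0 u.
Proof. by apply: subalg_sub => v hv; left. Qed.

Definition is_word (u : algmod U) : Prop := exists w, u = fw w.

Definition is_word_of x (u : algmod U) : Prop :=
  exists w, u = fw w /\ wdeg w = - << (lev x)%:Z *g idx x >>.

Lemma lspan_is_word_mul (u v : U) :
  lspan is_word (u : algmod U) -> lspan is_word (v : algmod U) ->
  lspan is_word (u * v : algmod U).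
Proof.
move=> hu hv; elim: hu => {u} [_ [w ->]||c u u' _ hu _ hu'].
- elim: hv => {v} [_ [w' ->]||c v v' _ hv _ hv'].
  + by apply: lspan_gen; exists (w ++ w'); rewrite fw_cat.
  + by rewrite mulr0; apply: lspan_0.
  + have -> : fw w * (c *: v + v') = c *: (fw w * v : algmod U) + fw w * v'.
      by rewrite mulrDr; congr (_ + _); exact: scalCA.
    exact: lspan_comb.
- by rewrite mul0r; apply: lspan_0.
- have -> : (c *: u + u' : U) * v = c *: (u * v : algmod U) + (u' : U) * v.
    by rewrite mulrDl; congr (_ + _); exact/esym/mulrA.
  exact: lspan_comb.
Qed.

Lemma Uminus_span (u : U) : Uminus u -> lspan is_word (u : algmod U).
Proof.
elim=> {u} [_ [x ->]|c _|u v _ hu _ hv|u v _ hu _ hv].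
- by apply: lspan_gen; exists [:: x]; rewrite fw1.
- have -> : (scal c : U) = c *: (fw [::] : algmod U).
    by rewrite fw_nil; exact/esym/mulr1.
  by apply/lspanZ/lspan_gen; exists [::].
- rewrite -[u - v]addrC -[- (v : algmod U)]scaleN1r.
  exact: lspan_comb.
- exact: lspan_is_word_mul.
Qed.

Lemma at_level_fw i m : at_level (F) i m = fw (word_at D i m).
Proof. by rewrite /at_level /word_at; case: insub => [x|]; rewrite ?fw1 ?fw_nil. Qed.

Variable q : K.
Hypothesis q_neq0 : q != 0.
Hypothesis QF : forall h x, Q h * F x =
  scal (q ^ (- ((lev x)%:Z * wt_val (alpha D (idx x)) h))) * (F x * Q h).

Lemma qh_fw h w : Q h * fw w = scal (q ^ (- word_alpha h w)) * (fw w * Q h).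
Proof.
elim: w => [|x w IH].
  by rewrite /word_alpha big_nil oppr0 expr0z fw_nil rmorph1 mulr1 !mul1r.
rewrite fw_cons mulrA QF -!mulrA IH scalCA mulrA -(rmorphM (@scal K U)) /word_alpha big_cons.
by rewrite opprD expfzDr ?q_neq0.
Qed.

End Words.

Section WordFacts.
Variables (I : countType) (D : cartan_datum I) (K : fieldType).
Variables (U : pzAlgType K) (F : Iinf D -> U).
Local Notation W := (words (Iinf D)).
Local Notation fw := (fw F).

(** By the Leibniz rule, with the orders 1 + m l of the letters adding up to
1 + m (sum of the levels): this is the reason why the order 1 - l a_ij of the Serre
relation is affine in the level l. *)
Lemma qadn_fw (f : U) (p : K) (m : nat) (w : W) :
  (forall y, y \in (w : seq _) -> qadn f p (p ^- (lev y * m)) (lev y * m).+1 (F y) = 0) ->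
  qadn f p (p ^- ((\sum_(y <- w) lev y) * m)) ((\sum_(y <- w) lev y) * m).+1 (fw w) = 0.
Proof.
elim: w => [|y w IH] h.
  by rewrite big_nil mul0n expr0 invr1 fw_nil /= /qad rmorph1 !mul1r mulr1 subrr.
rewrite big_cons mulnDl exprD invfM fw_cons.
apply: (@qadn_mul _ _ _ _ _ _ _ _ _ (lev y * m).+1 ((\sum_(y <- w) lev y) * m).+1).
- by rewrite addSn addnS.
- by apply: h; rewrite inE eqxx.
- by apply: IH => z hz; apply: h; rewrite inE hz orbT.
Qed.

Lemma comm_fw (x : U) (w : W) :
  (forall y, y \in (w : seq _) -> comm x (F y) = 0) -> comm x (fw w) = 0.
Proof.
elim: w => [|y w IH] h; first by rewrite fw_nil /comm mulr1 mul1r subrr.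
have e1 : x * F y = F y * x by apply/eqP; rewrite -subr_eq0; apply/eqP/h; rewrite inE eqxx.
have e2 : x * fw w = fw w * x.
  by apply/eqP; rewrite -subr_eq0; apply/eqP/IH => z hz; apply: h; rewrite inE hz orbT.
by rewrite fw_cons /comm mulrA e1 -!mulrA e2 subrr.
Qed.

Variable t : Iinf D -> U.
Hypothesis t_span : forall x, lspan (is_word_of F x) (t x : algmod U).

(** A property stable under linear combinations passes from the words in the f's of
index i and total level l to t_il. *)
Lemma word_comb_ind (x : Iinf D) (P : U -> Prop) :
  P 0 -> (forall c u v, P u -> P v -> P (scal c * u + v)) ->
  (forall w : W, (forall y, y \in (w : seq _) -> idx y = idx x) ->
     (\sum_(y <- w) lev y = lev x)%N -> P (fw w)) -> P (t x).
Proof.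
move=> P0 PD Pw; elim: (t_span x) => [_ [w [-> /wdeg_inv [h1 h2]]]||c u v _ hu _ hv] //.
- exact: Pw.
- exact: PD.
Qed.

Lemma qadn_word_comb (f : U) (p : K) (m : nat) (x : Iinf D) :
  (forall y, idx y = idx x -> qadn f p (p ^- (lev y * m)) (lev y * m).+1 (F y) = 0) ->
  qadn f p (p ^- (lev x * m)) (lev x * m).+1 (t x) = 0.
Proof.
move=> h; apply: (@word_comb_ind x (fun z => qadn f p _ _ z = 0)) => [|c u v hu hv|w h1 h2].
- exact: qadn0.
- by rewrite qadnP hu hv mulr0 addr0.
- by rewrite -h2; apply: qadn_fw => y /h1; exact: h.
Qed.

(** Expand t_y into words, then t_x. *)
Lemma comm_word_comb (x y : Iinf D) :
  (forall x' y', idx x' = idx x -> idx y' = idx y -> comm (F x') (F y') = 0) ->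
  comm (t x) (t y) = 0.
Proof.
move=> h; apply: (@word_comb_ind y (fun z => comm (t x) z = 0)) => [|c u v hu hv|w h1 h2].
- exact: comm0.
- by rewrite comm_lin hu hv mulr0 addr0.
apply: comm_fw => y' hy'; rewrite comm_anti.
apply: (@word_comb_ind x (fun z => - comm (F y') z = 0)) => [|c u v hu hv|w' h1' h2'].
- by rewrite comm0 oppr0.
- by rewrite comm_lin opprD -mulrN hu hv mulr0 addr0.
rewrite comm_fw ?oppr0 // => x' hx'; rewrite comm_anti h ?oppr0 //; first exact: h1'.
exact: h1.
Qed.

Variables (q : K) (Q : Pvee I -> U).
Hypothesis q_neq0 : q != 0.
Hypothesis QF : forall h x, Q h * F x =
  scal (q ^ (- ((lev x)%:Z * wt_val (alpha D (idx x)) h))) * (F x * Q h).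

Lemma Q_word_comb h x :
  Q h * t x = scal (q ^ (- ((lev x)%:Z * wt_val (alpha D (idx x)) h))) * (t x * Q h).
Proof.
apply: (@word_comb_ind x (fun z => Q h * z = scal _ * (z * Q h))) => [|c u v hu hv|w h1 h2].
- by rewrite mulr0 mul0r mulr0.
- rewrite mulrDr scalCA hu hv mulrDl mulrDr -[scal c * u * _]mulrA; congr (_ + _).
  by rewrite scalCA.
rewrite (qh_fw q_neq0 QF) -h2; congr (scal (_ ^ (- _)) * _).
rewrite /word_alpha (big_morph Posz PoszD (erefl 0%:Z)) mulr_suml big_seq [RHS]big_seq.
by apply: eq_bigr => y /h1 ->.
Qed.
End WordFacts.

(** * Coproduct, form and primitive elements *)

(** The data of the quantum algebra enter the computation of the commutators only
through the identities assumed here: U with its coproduct, form and involution, and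
a homomorphism pi that kills the radical of the form and satisfies the Drinfeld
relations. *)
Section Drinfeld.
Variables (I : countType) (D : cartan_datum I) (K : fieldType) (q : K).
Variables (U : pzAlgType K) (Q : Pvee I -> U) (E F : Iinf D -> U) (om : U -> U).
Local Notation W := (words (Iinf D)).
Local Notation fw := (fw F).
Local Notation Uminus := (Uminus F).
Local Notation Uplus := (subalgebra (fun v : U => exists j, v = E j)).
Local Notation Ule0 := (Ule0 Q F).
Local Notation Ule0K := (Ule0K Q F).
Implicit Types (w : W) (x y : Iinf D) (h : Pvee I) (u v z : U).

Hypothesis q_neq0 : q != 0.
Hypothesis Q0 : Q 0 = 1.
Hypothesis QD : forall h h', Q h * Q h' = Q (h + h').
Hypothesis QF : forall h x, Q h * F x =
  scal (q ^ (- ((lev x)%:Z * wt_val (alpha D (idx x)) h))) * (F x * Q h).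

Hypothesis omP : alg_hom om.
Hypothesis omQ : forall h, om (Q h) = Q (- h).
Hypothesis omE : forall x, om (E x) = F x.
Hypothesis omF : forall x, om (F x) = E x.

Variable qp : I -> K.
Variable Delta : U -> atens U U.
Hypothesis DeltaP : alg_hom Delta.
Hypothesis DeltaQ : forall h, Delta (Q h) = apure (Q h) (Q h).
Hypothesis DeltaF : forall x, Delta (F x) =
  \sum_(m < (lev x).+1)
      scal (qp (idx x) ^- (m * (lev x - m))) *
      apure (at_level F (idx x) m * Q (coroot (idx x) *~ ((cr D (idx x))%:Z * (lev x - m)%:Z)))
            (at_level F (idx x) (lev x - m)).

Variable B : U -> U -> K.
Hypothesis Blin : forall a u v z, B (scal a * u + v) z = a * B u z + B v z.
Hypothesis Bsym : forall u v, B u v = B v u.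
Hypothesis Bdeg : forall w w', wdeg w <> wdeg w' -> B (fw w) (fw w') = 0.
Hypothesis BQ1 : forall h, B (Q h) 1 = 1.
Hypothesis BQF : forall h x, B (Q h) (F x) = 0.
Hypothesis Bom : forall u v, Uplus u -> Uplus v -> B u v = B (om u) (om v).
Definition form_tens (d : atens U U) (y z : U) : K :=
  @tlift K (algmod U) (algmod U) K^o (fun a b => B a y * B b z) d.
Hypothesis Bmul : forall u v z, Ule0 u -> Ule0 v -> Ule0 z ->
    Ule0K u \/ Ule0K v /\ Ule0K z -> B u (v * z) = form_tens (Delta u) v z.

Lemma B0l z : B 0 z = 0.
Proof. by have := Blin (-1) 0 0 z; rewrite mulr0 addr0 mulN1r addNr. Qed.
Lemma B0r z : B z 0 = 0. Proof. by rewrite Bsym B0l. Qed.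
Lemma BDl u v z : B (u + v) z = B u z + B v z.
Proof. by have := Blin 1 u v z; rewrite rmorph1 !mul1r. Qed.
Lemma BZl a u z : B (scal a * u) z = a * B u z.
Proof. by have := Blin a u 0 z; rewrite B0l !addr0. Qed.
Lemma BBl u v z : B (u - v) z = B u z - B v z.
Proof. by apply: (addIr (B v z)); rewrite -BDl !subrK. Qed.
Lemma BDr z u v : B z (u + v) = B z u + B z v.
Proof. by rewrite Bsym BDl !(Bsym z). Qed.
Lemma BZr a u z : B z (scal a * u) = a * B z u.
Proof. by rewrite Bsym BZl (Bsym z). Qed.

Lemma form_tens_bilin v z :
  @bilin K (algmod U) (algmod U) K^o (fun a b => B a v * B b z).
Proof.
split=> [n a m m'|m a n n'].
  by rewrite Blin mulrDl -mulrA.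
by rewrite Blin mulrDr mulrCA.
Qed.
Lemma form_tensP v z a d d' : form_tens (a *: d + d') v z = a * form_tens d v z + form_tens d' v z.
Proof. exact: (tliftP (form_tens_bilin v z)). Qed.
Lemma form_tens_pure a b v z : form_tens (apure a b) v z = B a v * B b z.
Proof. exact: (tlift_pure (form_tens_bilin v z)). Qed.
Lemma form_tens0 v z : form_tens 0 v z = 0.
Proof. exact: (tlift0 (form_tens_bilin v z)). Qed.
Lemma form_tensD v z d d' : form_tens (d + d') v z = form_tens d v z + form_tens d' v z.
Proof. by have := form_tensP v z 1 d d'; rewrite scale1r mul1r. Qed.

(** The coproduct of an element u of U^- differs from u (x) 1 by a combination of such
terms. *)
Definition mixed (d : atens U U) : Prop :=
  exists w w' : W, w' != [::] /\ d = apure (fw w * Q (Kexp w')) (fw w').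

Lemma scalT c (d : atens U U) : scal c * d = c *: d.
Proof. exact: atscalE. Qed.

Lemma mulTr c (d d1 d2 : atens U U) : d * (c *: d1 + d2) = c *: (d * d1) + d * d2.
Proof. by rewrite mulrDr -(scalT c d1) -(scalT c (d * d1)) scalCA. Qed.
Lemma mulTl c (d d1 d2 : atens U U) : (c *: d1 + d2) * d = c *: (d1 * d) + d2 * d.
Proof. by rewrite mulrDl -(scalT c d1) -(scalT c (d1 * d)) mulrA. Qed.

Lemma Kexp_word_at x m : (m <= lev x)%N ->
  Q (Kexp (word_at D (idx x) m)) = Q (coroot (idx x) *~ ((cr D (idx x))%:Z * m%:Z)).
Proof.
case: m => [|m] hm.
  rewrite mulr0 mulr0z; congr Q; rewrite /word_at.
  case: insubP => [u /andP [] //|_]; exact: big_nil.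
have [y [ey iy ly]] := level_ex (ltn0Sn m) hm.
by rewrite /word_at ey /Kexp big_seq1 iy ly.
Qed.

Lemma Delta_F x : lspan mixed (Delta (F x) - apure (F x) 1).
Proof.
rewrite DeltaF big_ord_recr /= subnn !at_level_fw.
have -> : word_at D (idx x) 0 = [::] by rewrite /word_at; case: insubP => [u /andP []|].
have -> : word_at D (idx x) (lev x) = [:: x].
  have [y [ey iy ly]] := level_ex (lev_gt0 x) (leqnn _).
  by rewrite /word_at ey; congr [:: _]; apply: Iinf_eq.
rewrite muln0 expr0 invr1 rmorph1 mul1r mulr0 mulr0z Q0 mulr1 fw1 fw_nil addrK.
apply: lspan_sum => -[m /= lm] _; rewrite scalT; apply/lspanZ/lspan_gen.
exists (word_at D (idx x) m), (word_at D (idx x) (lev x - m)); split.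
  have h0 : (0 < lev x - m)%N by rewrite subn_gt0.
  have [y [ey _ _]] := level_ex h0 (leq_subr m (lev x)).
  by rewrite /word_at ey.
by rewrite !at_level_fw Kexp_word_at // leq_subr.
Qed.

Lemma mixed_mulr (d : atens U U) w : lspan mixed d -> lspan mixed (d * apure (fw w) 1).
Proof.
elim=> {d} [_ [w1 [w2 [h ->]]]||c d d' _ hd _ hd'].
- rewrite apureM mulr1 -mulrA (qh_fw q_neq0 QF) scalCA (mulrA (fw w1)) -fw_cat apureZl.
  by apply/lspanZ/lspan_gen; exists (w1 ++ w), w2.
- by rewrite mul0r; apply: lspan_0.
- by rewrite mulTl; apply: lspan_comb.
Qed.
Lemma mixed_mull (d : atens U U) w : lspan mixed d -> lspan mixed (apure (fw w) 1 * d).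
Proof.
elim=> {d} [_ [w1 [w2 [h ->]]]||c d d' _ hd _ hd'].
- rewrite apureM mul1r mulrA -fw_cat.
  by apply/lspan_gen; exists (w ++ w1), w2.
- by rewrite mulr0; apply: lspan_0.
- by rewrite mulTr; apply: lspan_comb.
Qed.
Lemma mixed_mul (d d' : atens U U) : lspan mixed d -> lspan mixed d' -> lspan mixed (d * d').
Proof.
move=> hd hd'; elim: hd => {d} [_ [w1 [w2 [h ->]]]||c d d2 _ hd _ hd2].
- elim: hd' => {d'} [_ [w3 [w4 [h' ->]]]||c d d2 _ hd _ hd2].
  + rewrite apureM -mulrA (mulrA (Q _)) (qh_fw q_neq0 QF) -!mulrA scalCA QD.
    rewrite (mulrA (fw w1)) -!fw_cat -Kexp_cat apureZl.
    apply/lspanZ/lspan_gen; exists (w1 ++ w3), (w2 ++ w4); split=> //.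
    by case: (w2) h.
  + by rewrite mulr0; apply: lspan_0.
  + by rewrite mulTr; apply: lspan_comb.
- by rewrite mul0r; apply: lspan_0.
- by rewrite mulTl; apply: lspan_comb.
Qed.

(** Multiplicativity, since mixed terms are stable under product with each other and
with f_w (x) 1: moving K past a word only produces a scalar. *)
Lemma Delta_fw w : lspan mixed (Delta (fw w) - apure (fw w) 1).
Proof.
elim: w => [|x w IH].
  by rewrite fw_nil (alg_hom1 DeltaP) subrr; apply: lspan_0.
rewrite fw_cons (alg_homM DeltaP).
set d := Delta (F x); set d' := Delta (fw w).
set p : atens U U := apure (F x) 1; set p' : atens U U := apure (fw w) 1.
have -> : apure (F x * fw w) 1 = p * p' by rewrite /p /p' apureM mulr1.
rewrite mulrB_mulr.
apply: lspanD; first exact: mixed_mul (Delta_F x) IH.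
apply: lspanD; first exact: mixed_mulr (Delta_F x).
by rewrite /p -fw1; exact: mixed_mull.
Qed.

Lemma Delta_minus u : Uminus u -> lspan mixed (Delta u - apure u 1).
Proof.
move=> /Uminus_span; elim=> {u} [_ [w ->]||c u v _ hu _ hv].
- exact: Delta_fw.
- by rewrite (alg_hom0 DeltaP) apure0l subrr; apply: lspan_0.
have -> : Delta (c *: u + v) - apure (c *: u + v : algmod U) 1 =
    c *: (Delta u - apure (u : U) 1) + (Delta v - apure (v : U) 1).
  rewrite (alg_homD DeltaP) apureDl opprD addrACA scalerBr; congr (_ - _ + _).
    by apply: etrans (alg_homM DeltaP _ _) _; rewrite (alg_homS DeltaP) scalT.
  exact: apureZl.
exact: lspan_comb.
Qed.

Lemma le0_Q h : Ule0 (Q h).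
Proof. by apply: subalg_gen; right; exists h. Qed.
Lemma le0_F x : Ule0 (F x).
Proof. by apply: subalg_gen; left; exists x. Qed.
Lemma le0K_F x : Ule0K (F x).
Proof. by apply: subalg_gen; left; exists x. Qed.
Lemma le0_fw w : Ule0 (fw w). Proof. exact/Uminus_Ule0/fw_Uminus. Qed.
Lemma le0K_fw w : Ule0K (fw w). Proof. exact/Uminus_Ule0K/fw_Uminus. Qed.

(** The coproduct of q^h is grouplike, so (q^h, f_x f_w) = (q^h, f_x) (q^h, f_w) = 0. *)
Lemma B_Q_fw h w : B (Q h) (fw w) = (w == [::])%:R.
Proof.
case: w => [|x w]; first by rewrite fw_nil BQ1.
rewrite fw_cons Bmul ?DeltaQ ?form_tens_pure ?BQF ?mul0r //.
- exact: le0_Q.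
- exact: le0_F.
- exact: le0_fw.
by right; split; [exact: le0K_F | exact: le0K_fw].
Qed.
Lemma B_1_fw w : B 1 (fw w) = (w == [::])%:R.
Proof. by rewrite -Q0 B_Q_fw. Qed.

Lemma form_tens_mixed_Q d v h : lspan mixed d -> form_tens d v (Q h) = 0.
Proof.
elim=> {d} [_ [w [w' [h' ->]]]||c d d' _ hd _ hd'].
- by rewrite form_tens_pure (Bsym (fw w')) B_Q_fw (negPf h') mulr0.
- exact: form_tens0.
- by rewrite form_tensP hd hd' mulr0 addr0.
Qed.

(** Expanding (f_w q^h, f_w') by the coproduct of f_w', the mixed terms pair to 0 with
q^h and only f_w' (x) 1 is left. *)
Lemma B_fwQ w h w' : B (fw w * Q h) (fw w') = B (fw w) (fw w').
Proof.
rewrite Bsym Bmul; last first.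
- by left; exact: le0K_fw.
- exact: le0_Q.
- exact: le0_fw.
- exact: le0_fw.
rewrite -[Delta _](subrK (apure (fw w') 1)) form_tensD form_tens_mixed_Q; last exact: Delta_fw.
by rewrite form_tens_pure add0r (Bsym 1) BQ1 mulr1 Bsym.
Qed.

Definition lowerF x := subalgebra (fun v : U => exists j,
    [/\ idx j = idx x, (lev j < lev x)%N & v = F j]).
Variable t : Iinf D -> U.
Hypothesis t_span : forall x, lspan (is_word_of F x) (t x : algmod U).
Hypothesis t_tri : forall x, ~~ is_real D (idx x) -> lowerF x (t x - F x).
Hypothesis t_orth : forall x, ~~ is_real D (idx x) ->
  forall z, lowerF x z -> B (t x) z = 0.
Hypothesis t_real : forall x, is_real D (idx x) -> t x = F x.
Local Notation tau x := (B (t x) (t x)).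

Lemma t_minus x : Uminus (t x).
Proof.
elim: (t_span x) => [_ [w [-> _]]||c u v _ hu _ hv]; first exact: fw_Uminus.
  exact: subalg_0.
apply: subalg_D => //; apply: subalg_M => //; exact: subalg_scal.
Qed.

(** Words of different degrees are orthogonal. *)
Lemma B_t_deg x w : wdeg w <> - << (lev x)%:Z *g idx x >> -> B (t x) (fw w) = 0.
Proof.
move=> h; elim: (t_span x) => [_ [w' [-> e]]||c u v _ hu _ hv].
- by apply: Bdeg => e'; apply: h; rewrite -e' e.
- exact: B0l.
- by rewrite [LHS]Blin hu hv mulr0 addr0.
Qed.

(** For an imaginary index f_x - t_x lies in the subalgebra orthogonal to t_x. *)
Lemma B_t_F x : B (t x) (F x) = tau x.
Proof.
case: (boolP (is_real D (idx x))) => hr; first by rewrite t_real.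
have h0 : B (t x) (t x - F x) = 0 by apply: t_orth => //; exact: t_tri.
by rewrite -[X in _ = B _ X](subrK (F x)) BDr h0 add0r.
Qed.

(** A word of the degree of t_x other than x itself has at least two letters, all of
the same index and of lower level: it lies in the subalgebra orthogonal to t_x.  For
a real index there is no such word, as its only level is 1. *)
Lemma B_t_fw x w : B (t x) (fw w) = if w == [:: x] then tau x else 0.
Proof.
case: eqP => [->|nw]; first by rewrite fw1 B_t_F.
case: (pselect (wdeg w = - << (lev x)%:Z *g idx x >>)) => [e|]; last exact: B_t_deg.
have [hi hl] := wdeg_inv e.
case: w nw e hi hl => [|y [|z w]] nw e hi hl.
- by case: (wdeg_nil_neq e).
- by case: nw; rewrite (deg_inj (etrans (esym (wdeg1 y)) e)).
(* There are at least two letters, of positive levels adding up to that of x. *)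
have lt (k : Iinf D) : k \in (y :: z :: w : seq _) -> (lev k < lev x)%N.
  move=> hk; rewrite -hl (perm_big _ (perm_to_rem hk)) big_cons -addn1 leq_add2l.
  have : (0 < size (rem k (y :: z :: w)))%N by rewrite size_rem.
  by case: (rem _ _) => // a s _; rewrite big_cons addn_gt0 lev_gt0.
apply: t_orth.
  apply/negP => hr; have := lt y; rewrite inE eqxx (lev_real hr) => /(_ isT).
  by rewrite ltnS leqNgt lev_gt0.
rewrite fwE big_seq; elim/big_ind: _ => [|u v|k hk]; first exact: subalg_1.
  exact: subalg_M.
by apply: subalg_gen; exists k; rewrite hi // lt.
Qed.

(** Primitivity of t_x with respect to the form, in terms of the augmentation
(1 on the empty word, 0 on the others). *)
Lemma B_t_mul x w w' : B (t x) (fw w * fw w') =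
  (w == [::])%:R * B (t x) (fw w') + B (t x) (fw w) * (w' == [::])%:R.
Proof.
have n2 y y' (s : W) : ((y :: y' :: s : W) == [:: x]) = false by apply/eqP.
rewrite -fw_cat !B_t_fw; case: w => [|y [|y' w]].
- by rewrite mul1r mul0r addr0.
- rewrite mul0r add0r; case: w' => [|y' w']; first by rewrite mulr1.
  by rewrite mulr0 n2.
- by rewrite !n2 !mul0r addr0.
Qed.

Lemma Blin_r a u v z : B z (scal a * u + v) = a * B z u + B z v.
Proof. by rewrite BDr BZr. Qed.

(** Both sides of a Drinfeld relation are obtained from coproducts by contracting one of
the two factors with the form. *)
Definition contract_l v (d : atens U U) : algmod U :=
  @tlift K (algmod U) (algmod U) (algmod U) (fun a b => B a v *: b) d.
Definition contract_r v (d : atens U U) : algmod U :=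
  @tlift K (algmod U) (algmod U) (algmod U) (fun a b => B v b *: a) d.

Lemma contract_l_bilin v :
  @bilin K (algmod U) (algmod U) (algmod U) (fun a b => B a v *: b).
Proof.
split=> [b a m m'|m a b b'].
  by rewrite Blin scalerDl scalerA.
by rewrite scalerDr !scalerA mulrC.
Qed.
Lemma contract_r_bilin v :
  @bilin K (algmod U) (algmod U) (algmod U) (fun a b => B v b *: a).
Proof.
split=> [b a m m'|m a b b'].
  by rewrite scalerDr !scalerA mulrC.
by rewrite BDr BZr scalerDl scalerA.
Qed.
Lemma contract_lP v a d d' : contract_l v (a *: d + d') = a *: contract_l v d + contract_l v d'.
Proof. exact: (tliftP (contract_l_bilin v)). Qed.
Lemma contract_l_pure v a b : contract_l v (apure a b) = scal (B a v) * b.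
Proof. exact: (tlift_pure (contract_l_bilin v)). Qed.
Lemma contract_l0 v : contract_l v 0 = 0.
Proof. exact: (tlift0 (contract_l_bilin v)). Qed.
Lemma contract_rP v a d d' : contract_r v (a *: d + d') = a *: contract_r v d + contract_r v d'.
Proof. exact: (tliftP (contract_r_bilin v)). Qed.
Lemma contract_r_pure v a b : contract_r v (apure a b) = scal (B v b) * a.
Proof. exact: (tlift_pure (contract_r_bilin v)). Qed.
Lemma contract_r0 v : contract_r v 0 = 0.
Proof. exact: (tlift0 (contract_r_bilin v)). Qed.
Lemma contract_lD v d d' : contract_l v (d + d') = contract_l v d + contract_l v d'.
Proof. by have := contract_lP v 1 d d'; rewrite !scale1r. Qed.
Lemma contract_rD v d d' : contract_r v (d + d') = contract_r v d + contract_r v d'.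
Proof. by have := contract_rP v 1 d d'; rewrite !scale1r. Qed.

Lemma UminusZ c u : Uminus u -> Uminus (scal c * u).
Proof. by move=> hu; apply: subalg_M => //; apply: subalg_scal. Qed.

Lemma contract_l_mixed v d : lspan mixed d -> Uminus (contract_l v d).
Proof.
elim=> {d} [_ [w [w' [_ ->]]]||c d d' _ hd _ hd'].
- by rewrite contract_l_pure; exact/UminusZ/fw_Uminus.
- by rewrite contract_l0; apply: subalg_0.
- by rewrite contract_lP; apply: subalg_D => //; exact: UminusZ.
Qed.

(** Only the first factors of a coproduct of U^- involve the K's, and they are
absorbed by the form. *)
Lemma contract_l_Uminus v u : Uminus u -> Uminus (contract_l v (Delta u)).
Proof.
move=> hu; rewrite -[Delta u](subrK (apure u 1)) contract_lD contract_l_pure.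
apply: subalg_D; first exact/contract_l_mixed/Delta_minus.
exact/UminusZ/subalg_1.
Qed.

(** Left contraction of a coproduct is adjoint to left multiplication: with the
compatibility of the form, (sum (u_1, v) u_2, z) = (u, vz). *)
Lemma B_contract_l v z d : B (contract_l v d) z = form_tens d v z.
Proof.
elim/tens_ind: d => [|a b|c d d' hd hd'].
- by rewrite contract_l0 form_tens0 B0l.
- by rewrite (contract_l_pure v a b) (form_tens_pure a b) BZl.
- by rewrite (contract_lP v c d d') (form_tensP v z c d d') -hd -hd' Blin.
Qed.

Lemma omK_minus u : Uminus u -> om (om u) = u.
Proof.
elim=> {u} [_ [x ->]|c _|u v _ hu _ hv|u v _ hu _ hv].
- by rewrite omF omE.
- by rewrite !(alg_homS omP).
- by rewrite !(alg_homB omP) hu hv.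
- by rewrite !(alg_homM omP) hu hv.
Qed.
Lemma om_minus u : Uminus u -> Uplus (om u).
Proof.
elim=> {u} [_ [x ->]|c _|u v _ hu _ hv|u v _ hu _ hv].
- by rewrite omF; apply: subalg_gen; exists x.
- by rewrite !(alg_homS omP); apply: subalg_scal.
- by rewrite !(alg_homB omP); apply: subalg_B.
- by rewrite !(alg_homM omP); apply: subalg_M.
Qed.
Lemma om_plus u : Uplus u -> Uminus (om u).
Proof.
elim=> {u} [_ [x ->]|c _|u v _ hu _ hv|u v _ hu _ hv].
- by rewrite omE; apply: subalg_gen; exists x.
- by rewrite !(alg_homS omP); apply: subalg_scal.
- by rewrite !(alg_homB omP); apply: subalg_B.
- by rewrite !(alg_homM omP); apply: subalg_M.
Qed.

(** The general term of the sum on the left of the Drinfeld relation; [drinfeld_rF] is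
that on the right. *)
Definition drinfeld_lF (a1 a2 b1 b2 : algmod U) : algmod U :=
  scal (B a1 b2) * om b1 * (a2 : U).
Definition drinfeld_rF (a1 a2 b1 b2 : algmod U) : algmod U :=
  scal (B a2 b1) * (a1 : U) * om b2.
Definition drinfeld_lhs (d d' : atens U U) : U := tlift2 drinfeld_lF d d'.
Definition drinfeld_rhs (d d' : atens U U) : U := tlift2 drinfeld_rF d d'.

Variables (V : pzAlgType K) (pi : U -> V).
Hypothesis piP : alg_hom pi.
Hypothesis pi_minus : forall u, Uminus u -> (forall v, Uminus v -> B u v = 0) -> pi u = 0.
Hypothesis pi_plus : forall u, Uplus u -> (forall v, Uplus v -> B u v = 0) -> pi u = 0.
Hypothesis pi_drinfeld : forall u v, Ule0 u -> Ule0 v -> Ule0K u \/ Ule0K v ->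
  pi (drinfeld_lhs (Delta u) (Delta v)) = pi (drinfeld_rhs (Delta u) (Delta v)).

Lemma B_words_minus u v : (forall w, B u (fw w) = 0) -> Uminus v -> B u v = 0.
Proof.
move=> h /Uminus_span; elim=> {v} [_ [w ->]||c v v' _ hv _ hv'] //.
  exact: B0r.
by rewrite BDr [B u _]BZr hv hv' mulr0 addr0.
Qed.

Lemma pi_rad u : Uminus u -> (forall w, B u (fw w) = 0) -> pi u = 0.
Proof. by move=> hu h; apply: pi_minus => // v; exact: B_words_minus. Qed.

Lemma pi_om_rad u : Uminus u -> (forall w, B u (fw w) = 0) -> pi (om u) = 0.
Proof.
move=> hu h; apply: pi_plus; first exact: om_minus.
move=> v hv; rewrite Bom //; last exact: om_minus.
by rewrite omK_minus //; apply: B_words_minus => //; exact: om_plus.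
Qed.

(** The difference lies in the radical of U^-, and omega carries it to the radical of
U^+ because it is an isometry. *)
Lemma pi_eq_rad u v : Uminus u -> Uminus v -> (forall w, B u (fw w) = B v (fw w)) ->
  pi u = pi v /\ pi (om u) = pi (om v).
Proof.
move=> hu hv h.
have hm : Uminus (u - v) by apply: subalg_B.
have hB w : B (u - v) (fw w) = 0 by rewrite BBl h subrr.
split; apply/eqP; rewrite -subr_eq0; apply/eqP.
  by rewrite -(alg_homB piP); exact: pi_rad.
by rewrite -(alg_homB piP) -(alg_homB omP); exact: pi_om_rad.
Qed.

Lemma B_t_1 x : B (t x) 1 = 0.
Proof. by have := B_t_fw x [::]; rewrite fw_nil. Qed.

(** Both elements pair with a word w' to (t_x, f_w f_w'), by primitivity of t_x. *)
Lemma pi_contract_l x w :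
  let z := contract_l (fw w) (Delta (t x)) in
  let z' := scal (w == [::])%:R * t x + scal (B (t x) (fw w)) in
  pi z = pi z' /\ pi (om z) = pi (om z').
Proof.
apply: pi_eq_rad; first exact/contract_l_Uminus/t_minus.
  by apply: subalg_D; [exact/UminusZ/t_minus | exact: subalg_scal].
move=> w'; rewrite B_contract_l -Bmul; last by left; exact/Uminus_Ule0K/t_minus.
- by rewrite B_t_mul Blin -[scal _ as X in B X _]mulr1 BZl B_1_fw.
- exact/Uminus_Ule0/t_minus.
- exact: le0_fw.
- exact: le0_fw.
Qed.

Lemma pi_contract_l1 x : pi (contract_l 1 (Delta (t x))) = pi (t x) /\
  pi (om (contract_l 1 (Delta (t x)))) = pi (om (t x)).
Proof.
have := pi_contract_l x [::].
by rewrite fw_nil /= B_t_1 rmorph0 addr0 rmorph1 mul1r.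
Qed.

Lemma drinfeld_lF_in a1 a2 : bilin (drinfeld_lF a1 a2).
Proof.
split=> [b c m m'|m c b b']; rewrite /drinfeld_lF /drinfeld_rF.
  rewrite (alg_homD omP) (alg_homM omP) (alg_homS omP) mulrDr mulrDl scalCA.
  by rewrite -!mulrA.
by rewrite BDr BZr rmorphD rmorphM !mulrDl -!mulrA.
Qed.
Lemma drinfeld_lF_out b1 b2 : bilin (fun a1 a2 => drinfeld_lF a1 a2 b1 b2).
Proof.
split=> [b c m m'|m c b b']; rewrite /drinfeld_lF /drinfeld_rF.
  by rewrite BDl BZl rmorphD rmorphM !mulrDl -!mulrA.
by rewrite mulrDr; congr (_ + _); exact: scalCA.
Qed.
Lemma drinfeld_rF_in a1 a2 : bilin (drinfeld_rF a1 a2).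
Proof.
split=> [b c m m'|m c b b']; rewrite /drinfeld_lF /drinfeld_rF.
  by rewrite BDr BZr rmorphD rmorphM !mulrDl -!mulrA.
rewrite (alg_homD omP) (alg_homM omP) (alg_homS omP) mulrDr; congr (_ + _).
exact: scalCA.
Qed.
Lemma drinfeld_rF_out b1 b2 : bilin (fun a1 a2 => drinfeld_rF a1 a2 b1 b2).
Proof.
split=> [b c m m'|m c b b']; rewrite /drinfeld_lF /drinfeld_rF.
  by rewrite mulrDr mulrDl; congr (_ + _); rewrite scalCA -mulrA.
by rewrite BDl BZl rmorphD rmorphM !mulrDl -!mulrA.
Qed.

(** The sum over the first coproduct is a contraction, once the second tensor is
pure. *)
Lemma drinfeld_lhs_pure d b1 b2 : drinfeld_lhs d (apure b1 b2) = om b1 * contract_l b2 d.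
Proof.
apply: etrans (tlift2_pure_r drinfeld_lF_in drinfeld_lF_out _ _ _) _.
move: d; apply: (@tens_eq K (algmod U) (algmod U) (algmod U) _ (fun d => om b1 * contract_l b2 d))
  => [c d d'|c d d'|a1 a2].
- exact: (tliftP (drinfeld_lF_out _ _)).
- by rewrite contract_lP mulrDr; congr (_ + _); exact: scalCA.
- by rewrite (tlift_pure (drinfeld_lF_out _ _)) (contract_l_pure b2 a1 a2) scalCA mulrA.
Qed.
Lemma drinfeld_rhs_pure d' a1 a2 : drinfeld_rhs (apure a1 a2) d' = a1 * om (contract_l a2 d').
Proof.
apply: etrans (tlift2_pure_l drinfeld_rF_in drinfeld_rF_out _ _ _) _.
move: d'; apply: (@tens_eq K (algmod U) (algmod U) (algmod U) _ (fun d => a1 * om (contract_l a2 d)))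
  => [c d d'|c d d'|b1 b2].
- exact: (tliftP (drinfeld_rF_in _ _)).
- rewrite contract_lP (alg_homD omP) mulrDr; congr (_ + _).
  by rewrite (alg_homM omP) (alg_homS omP) scalCA.
- rewrite (tlift_pure (drinfeld_rF_in _ _)) (contract_l_pure a2 b1 b2) (alg_homM omP) (alg_homS omP).
  by rewrite scalCA mulrA /drinfeld_rF (Bsym a2).
Qed.
Lemma drinfeld_lhsPr d c d1 d2 :
  drinfeld_lhs d (c *: d1 + d2) = scal c * drinfeld_lhs d d1 + drinfeld_lhs d d2.
Proof. exact: (tlift2_bilin drinfeld_lF_in drinfeld_lF_out).2. Qed.
Lemma drinfeld_rhsPl d c d1 d2 :
  drinfeld_rhs (c *: d1 + d2) d = scal c * drinfeld_rhs d1 d + drinfeld_rhs d2 d.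
Proof. exact: (tlift2_bilin drinfeld_rF_in drinfeld_rF_out).1. Qed.

(** For a mixed term b_1 (x) f_w' the contraction of the coproduct of t_x against f_w'
is the scalar (t_x, f_w'), as w' is nonempty; the sum is then a right contraction. *)
Lemma pi_drinfeld_lhs_mixed x d : lspan mixed d ->
  pi (drinfeld_lhs (Delta (t x)) d) = pi (om (contract_r (t x) d)).
Proof.
elim=> {d} [_ [w [w' [h ->]]]||c d d' _ hd _ hd'].
- rewrite drinfeld_lhs_pure contract_r_pure (alg_homM piP) (pi_contract_l x w').1 (negPf h)
    rmorph0 mul0r add0r.
  by rewrite !(alg_homM omP) !(alg_homM piP) (alg_homS omP) !(alg_homS piP) scalC.
- have -> : drinfeld_lhs (Delta (t x)) 0 = 0.
    have := drinfeld_lhsPr (Delta (t x)) (-1) 0 0; rewrite scaler0 addr0 => ->.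
    by rewrite rmorphN rmorph1 mulN1r addNr.
  by rewrite contract_r0 !(alg_hom0 piP, alg_hom0 omP).
- rewrite drinfeld_lhsPr contract_rP (alg_homD omP) !(alg_homD piP) -hd'; congr (_ + _).
  by rewrite (alg_homM omP) (alg_homS omP) !(alg_homM piP) hd.
Qed.

Lemma pi_drinfeld_rhs_mixed y d : lspan mixed d ->
  pi (drinfeld_rhs d (Delta (t y))) = pi (contract_r (t y) d).
Proof.
elim=> {d} [_ [w [w' [h ->]]]||c d d' _ hd _ hd'].
- rewrite drinfeld_rhs_pure contract_r_pure !(alg_homM piP) (pi_contract_l y w').2 (negPf h)
    rmorph0 mul0r add0r.
  by rewrite (alg_homS omP) !(alg_homS piP) scalC.
- have -> : drinfeld_rhs 0 (Delta (t y)) = 0.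
    have := drinfeld_rhsPl (Delta (t y)) (-1) 0 0; rewrite scaler0 addr0 => ->.
    by rewrite rmorphN rmorph1 mulN1r addNr.
  by rewrite contract_r0 !(alg_hom0 piP).
- rewrite drinfeld_rhsPl contract_rP !(alg_homD piP) -hd'; congr (_ + _).
  by rewrite !(alg_homM piP) hd.
Qed.

(** Among the mixed terms f_w K_w' (x) f_w' only those with w' = x survive, so a
factor K_x comes out.  The remaining element u of U^- is determined by its pairings,
which do not see the K's. *)
Lemma contract_r_mixed x d : lspan mixed d ->
  exists2 u, Uminus u & contract_r (t x) d = u * Q (Kexp [:: x]) /\
    forall v, Uminus v -> B u v = form_tens d v (t x).
Proof.
elim=> {d} [_ [w [w' [h ->]]]||c d d' _ [u hu [eu fu]] _ [u' hu' [eu' fu']]].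
- exists (scal (B (t x) (fw w')) * fw w); first exact/UminusZ/fw_Uminus.
  rewrite contract_r_pure; split.
    rewrite B_t_fw; case: eqP => [->|_]; first by rewrite mulrA.
    by rewrite rmorph0 !mul0r.
  move=> v hv; rewrite form_tens_pure BZl mulrC (Bsym (fw w')); congr (_ * _).
  rewrite (Bsym _ v) [RHS]Bsym; move: v hv => v /Uminus_span.
  elim=> {v} [_ [w2 ->]||c v v' _ hv _ hv'].
  + by rewrite !(Bsym (fw w2)) B_fwQ.
  + by rewrite !B0l.
  + by rewrite [LHS]Blin [RHS]Blin hv hv'.
- exists 0; first exact: subalg_0.
  by rewrite contract_r0 mul0r; split=> // v _; rewrite B0l form_tens0.
- exists (scal c * u + u'); first by apply: subalg_D => //; exact: UminusZ.
  split; first by rewrite contract_rP eu eu' mulrDl; congr (_ + _); exact: mulrA.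
  by move=> v hv; rewrite Blin form_tensP fu // fu'.
Qed.

Lemma B_t_t x y : B (t x) (t y) = if x == y then tau x else 0.
Proof.
case: eqP => [->//|ne]; elim: (t_span y) => [_ [w [-> e]]||c u v _ hu _ hv].
- by apply: B_t_deg; rewrite e => /deg_inj/esym.
- exact: B0r.
- by rewrite BDr [B _ _]BZr hu hv mulr0 addr0.
Qed.

(** The term t_y (x) 1 contributes (t_x, 1) = 0. *)
Lemma contract_r_Delta x y :
  contract_r (t x) (Delta (t y)) = contract_r (t x) (Delta (t y) - apure (t y) 1).
Proof.
rewrite -[Delta (t y) in LHS](subrK (apure (t y) 1)) [LHS]contract_rD contract_r_pure B_t_1.
by rewrite rmorph0 mul0r addr0.
Qed.

Lemma drinfeld_lhsDr d d1 d2 : drinfeld_lhs d (d1 + d2) = drinfeld_lhs d d1 + drinfeld_lhs d d2.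
Proof. by have := drinfeld_lhsPr d 1 d1 d2; rewrite scale1r rmorph1 mul1r. Qed.
Lemma drinfeld_rhsDl d d1 d2 : drinfeld_rhs (d1 + d2) d = drinfeld_rhs d1 d + drinfeld_rhs d2 d.
Proof. by have := drinfeld_rhsPl d 1 d1 d2; rewrite scale1r rmorph1 mul1r. Qed.

(** The right contraction is u K_x with (u, v) = (t_y, v t_x) = e(v) (t_y, t_x) for v
in U^-, hence u is the scalar (t_y, t_x) modulo the radical. *)
Lemma pi_contract_r x y :
  let r := contract_r (t x) (Delta (t y)) in
  let c := scal (B (t y) (t x)) : V in
  pi r = c * pi (Q (Kexp [:: x])) /\ pi (om r) = c * pi (Q (- Kexp [:: x])).
Proof.
have hmix := Delta_minus (t_minus y).
have [u hu [eu fu]] := contract_r_mixed x hmix.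
have er : contract_r (t x) (Delta (t y)) = u * Q (Kexp [:: x]) by rewrite contract_r_Delta.
have [e1 e2] : pi u = pi (scal (B (t y) (t x))) /\ pi (om u) = pi (om (scal (B (t y) (t x)))).
  apply: pi_eq_rad => //; first exact: subalg_scal.
  move=> w; rewrite fu; last exact: fw_Uminus.
  (* The term t_y (x) 1 left out pairs to 0, as t_x is orthogonal to 1. *)
  have -> : form_tens (Delta (t y) - apure (t y) 1) (fw w) (t x) = B (t y) (fw w * t x).
    rewrite Bmul; last by left; exact/Uminus_Ule0K/t_minus.
    - rewrite -[in RHS](subrK (apure (t y) 1) (Delta (t y))) [RHS]form_tensD form_tens_pure.
      by rewrite (Bsym 1) B_t_1 mulr0 addr0.
    - exact/Uminus_Ule0/t_minus.
    - exact: le0_fw.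
    - exact/Uminus_Ule0/t_minus.
  rewrite -[scal _]mulr1 BZl B_1_fw.
  elim: (t_span x) => [_ [w' [-> e]]||c v v' _ hv _ hv'].
  - rewrite B_t_mul mulrC.
    have -> : (w' == [::]) = false.
      by apply/eqP => e'; rewrite e' in e; case: (wdeg_nil_neq e).
    by rewrite mulr0 addr0.
  - by rewrite mulr0 !B0r mul0r.
  - have -> : fw w * (c *: v + v') = scal c * (fw w * v) + fw w * v'.
      by rewrite mulrDr; congr (_ + _); exact: scalCA.
    by rewrite Blin_r hv hv' [in RHS]Blin_r mulrDl mulrA.
rewrite /= er !(alg_homM piP) (alg_homM omP) (alg_homM piP) e1 e2 omQ.
by rewrite (alg_homS omP) (alg_homS piP).
Qed.

(** The Drinfeld relation of the pair (t_y, t_x).  Split each second coproduct into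
t (x) 1, which yields the products s_x t_y and t_y s_x, and mixed terms, which yield
the right contractions (t_x, t_y) K^-1 and (t_y, t_x) K. *)
Theorem primitive_comm x y :
  comm (pi (om (t x))) (pi (t y)) =
  if x == y then scal (tau x) * (pi (Q (Kexp [:: x])) - pi (Q (- Kexp [:: x]))) else 0.
Proof.
have hm (z : Iinf D) := Delta_minus (t_minus z).
have h0 (z : Iinf D) : Ule0 (t z) by exact/Uminus_Ule0/t_minus.
have h0K (z : Iinf D) : Ule0K (t z) by exact/Uminus_Ule0K/t_minus.
have := pi_drinfeld (h0 y) (h0 x) (or_introl (h0K y)).
have el : pi (drinfeld_lhs (Delta (t y)) (Delta (t x))) =
    pi (om (t x)) * pi (t y) + scal (B (t x) (t y)) * pi (Q (- Kexp [:: y])).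
  rewrite -[Delta (t x)](subrK (apure (t x) 1)) drinfeld_lhsDr (alg_homD piP) addrC.
  congr (_ + _); first by rewrite drinfeld_lhs_pure (alg_homM piP) (pi_contract_l1 y).1.
  by rewrite pi_drinfeld_lhs_mixed // -contract_r_Delta (pi_contract_r y x).2.
have er : pi (drinfeld_rhs (Delta (t y)) (Delta (t x))) =
    pi (t y) * pi (om (t x)) + scal (B (t y) (t x)) * pi (Q (Kexp [:: x])).
  rewrite -[Delta (t y)](subrK (apure (t y) 1)) drinfeld_rhsDl (alg_homD piP) addrC.
  congr (_ + _); first by rewrite drinfeld_rhs_pure (alg_homM piP) (pi_contract_l1 x).2.
  by rewrite pi_drinfeld_rhs_mixed // -contract_r_Delta (pi_contract_r x y).1.
rewrite el er /comm (B_t_t x y) (B_t_t y x) (eq_sym y); case: eqP => [->|_] e.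
  rewrite mulrBr; apply/eqP; rewrite subr_eq addrAC -subr_eq opprK e addrC.
  by rewrite addrC.
by move: e; rewrite !rmorph0 !mul0r !addr0 => ->; rewrite subrr.
Qed.
End Drinfeld.

(** * Relations of the primitive generators in the quantum algebra *)

(** The relations are stated for the generators of the free algebra; those of their
images under a homomorphism are the images of the relations.  This allows the
relations of a presented algebra to be used on its own generators. *)
Lemma Uhat_rel_lift (I : countType) (D : cartan_datum I) (A B : pzAlgType Kq)
    (p : A -> B) (Q : Pvee I -> A) (E F : Iinf D -> A) : alg_hom p ->
  forall r, Uhat_rel (fun h => p (Q h)) (fun x => p (E x)) (fun x => p (F x)) r ->
  exists2 r0, Uhat_rel Q E F r0 & p r0 = r.
Proof.
move=> ph r; have pB := alg_homB ph; have pM := alg_homM ph.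
have p1 := alg_hom1 ph; have pS := alg_homS ph.
case=> [|h h'|h j|h j|i j hi hj|i j hi hj|i j hij|i j hij].
- by exists (Q 0 - 1); [exact: Uhat_q0 | rewrite pB p1].
- by eexists; [exact: (Uhat_qD Q E F h h') | rewrite pB pM].
- by eexists; [exact: (Uhat_qE Q E F h j) | rewrite pB !pM pS].
- by eexists; [exact: (Uhat_qF Q E F h j) | rewrite pB !pM pS].
- by eexists; [exact: (Uhat_serreE Q E F hi hj) | rewrite qserre_hom].
- by eexists; [exact: (Uhat_serreF Q E F hi hj) | rewrite qserre_hom].
- by eexists; [exact: (Uhat_commE Q E F hij) | rewrite /comm pB !pM].
- by eexists; [exact: (Uhat_commF Q E F hij) | rewrite /comm pB !pM].
Qed.

Lemma qq_neq0 : qq != 0.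
Proof. by rewrite tofrac_eq0 polyX_eq0. Qed.

Lemma frac_of_inj (g h : {poly rat}) : frac_of g = frac_of h -> g = h.
Proof. by move=> e; apply/eqP; rewrite -tofrac_eq; apply/eqP. Qed.
Lemma qq_expE n : qq ^+ n = frac_of 'X^n.
Proof. by rewrite /frac_of rmorphXn. Qed.
Lemma qq_exp_neq1 n : (0 < n)%N -> qq ^+ n != 1.
Proof.
move=> n0; apply/eqP; rewrite qq_expE => e.
have /frac_of_inj/(congr1 (fun p : {poly rat} => size p)) : frac_of 'X^n = frac_of 1.
  by rewrite e /frac_of rmorph1.
by rewrite size_polyXn size_poly1 => -[e']; rewrite e' in n0.
Qed.

(** No q-integer vanishes, since q is not a root of unity. *)
Lemma gint_qq r n : (0 < r)%N -> (0 < n)%N -> gint (qq ^+ r) n != 0.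
Proof.
have key k : (0 < k)%N -> (qq : Kq) ^+ k - qq ^- k != 0.
  move=> k0; rewrite subr_eq0; apply/eqP => e.
  have /eqP := qq_exp_neq1 (n := k + k) ltac:(by rewrite addn_gt0 k0); apply.
  by rewrite exprD {1}e mulVf // expf_neq0 // qq_neq0.
move=> r0 n0; rewrite /gint mulf_neq0 //.
  by rewrite -exprM key // muln_gt0 r0.
by rewrite invr_neq0 // key.
Qed.

Section Instance.
Variables (I : countType) (D : cartan_datum I) (nu : Iinf D -> Kq).
Variables (L : bozec_data nu) (t : prim_gens L).

Lemma Uhat_relE (r : Uhat D) : Uhat_rel (@qh I D) (@eh I D) (@fh I D) r -> r = 0.
Proof.
by case/(Uhat_rel_lift (Uhat_pi_alg_hom D)) => r0 /Uhat_rel_api; exact.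
Qed.

Lemma qh_zero : qh D 0 = 1.
Proof. by apply/eqP; rewrite -subr_eq0; apply/eqP/Uhat_relE/Uhat_q0. Qed.
Lemma qhD h h' : qh D h * qh D h' = qh D (h + h').
Proof. by apply/eqP; rewrite -subr_eq0; apply/eqP/Uhat_relE/Uhat_qD. Qed.
Lemma qhNK h : qh D (- h) * qh D h = 1.
Proof. by rewrite qhD addNr qh_zero. Qed.
Lemma qh_fh h (x : Iinf D) : qh D h * fh x =
  scal (qq ^ (- ((lev x)%:Z * wt_val (alpha D (idx x)) h))) * (fh x * qh D h).
Proof. exact: (@conj_swap _ (Uhat D) _ _ _ _ (Uhat_relE (Uhat_qF _ _ _ h x)) (qhNK h)). Qed.
Lemma Uq_pi_alg_hom : alg_hom (@Uq_pi I D nu L).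
Proof. exact: (alg_hom_comp (@api_alg_hom _ _ _) (@api_alg_hom _ _ _)). Qed.

Lemma Ffree_UhatU c (w : words (Iinf D)) :
  Ffree_Uhat (<< c *g w >> : Ffree D) = scal c * fw (@fh I D) w.
Proof. exact: fextU. Qed.

Lemma homog_word (w : words (Iinf D)) : homog (wdeg w) (<< 1 *g w >> : Ffree D).
Proof. by move=> w'; rewrite msuppU oner_eq0 inE => /eqP ->. Qed.
Lemma Ffree_Uhat_word (w : words (Iinf D)) :
  Ffree_Uhat (<< 1 *g w >> : Ffree D) = fw (@fh I D) w.
Proof. by rewrite Ffree_UhatU rmorph1 mul1r. Qed.

Lemma form_deg (w w' : words (Iinf D)) : wdeg w <> wdeg w' ->
  Defs.form L (fw (@fh I D) w) (fw (@fh I D) w') = 0.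
Proof.
move=> ne; rewrite -!Ffree_Uhat_word (form_ext (formP L)).
have := ff_deg (form_freeP L) (@homog_word w) (@homog_word w').
by apply; apply/eqP.
Qed.

Lemma tlow_span x : lspan (is_word_of (@fh I D) x) (tlow t x : algmod (Uhat D)).
Proof.
have [w wdeg_w ->] := tlow_deg t x.
suff : lspan (is_word_of (@fh I D) x) (\sum_(k <- msupp (w : {malg Kq[words (Iinf D)]}))
    w@_k *: (\prod_(a <- k) fh a : algmod (Uhat D))) by [].
rewrite big_seq; apply: lspan_sum => k hk; apply/lspanZ/lspan_gen.
by exists k; split=> //; exact: wdeg_w.
Qed.

Lemma s_t_comm x y : comm (s_ t x) (t_ t y) =
  if x == y then scal (tau t x) * (Uq_q L (Kexp [:: x]) - Uq_q L (- Kexp [:: x])) else 0.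
Proof.
have piP := Uq_pi_alg_hom.
apply: (@primitive_comm I D Kq qq (Uhat D) (@qh I D) (@eh I D) (@fh I D) (@omega I D) qq_neq0
  qh_zero qhD qh_fh (omega_alg_hom D) (@omega_q I D) (@omega_e I D) (@omega_f I D) (qpar D)
  (comult L) (comult_hom (comultP L)) (comult_q (comultP L)) (comult_f (comultP L))
  (Defs.form L) (form_linear (formP L)) (form_sym (formP L)) form_deg (form_q1 (formP L))
  (form_qf (formP L)) (form_omega (formP L)) (form_mul (formP L))
  (tlow t) tlow_span (tlow_tri t) (@tlow_orth _ _ _ _ t) (@tlow_real _ _ _ _ t)
  (Uq L) (@Uq_pi I D nu L) piP).
- move=> u hu h; apply: api_rel0; exact: radical_minus.
- move=> u hu h; apply: api_rel0; exact: radical_plus.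
- move=> u v hu hv huv; apply/eqP; rewrite -subr_eq0 -(alg_homB piP); apply/eqP.
  rewrite /Uq_pi -[RHS](raddf0 (api (@radical_rel I D nu L))); congr (api _ _).
  by apply: api_rel0; exact: drinfeld_ab.
Qed.
End Instance.

Section UqFacts.
Variables (I : countType) (D : cartan_datum I) (nu : Iinf D -> Kq).
Variables (L : bozec_data nu) (t : prim_gens L).
Local Notation piU := (@Uq_pi I D nu L).
Local Notation piO := (fun u => @Uq_pi I D nu L (omega u)).

Lemma piO_alg_hom : alg_hom piO.
Proof. exact: (alg_hom_comp (omega_alg_hom D) (Uq_pi_alg_hom L)). Qed.

Lemma Uq_qD h h' : Uq_q L h * Uq_q L h' = Uq_q L (h + h').
Proof.
rewrite /Uq_q -(qhD D); exact/esym/(alg_homM (Uq_pi_alg_hom L)).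
Qed.

Lemma qh_tlow h x : qh D h * tlow t x =
  scal (qq ^ (- ((lev x)%:Z * wt_val (alpha D (idx x)) h))) * (tlow t x * qh D h).
Proof. exact: (@Q_word_comb I D Kq (Uhat D) (@fh I D) _ (tlow_span t) qq _ qq_neq0 (@qh_fh I D)). Qed.

Lemma Uq_q_t h x : Uq_q L h * t_ t x =
  scal (qq ^ (- ((lev x)%:Z * wt_val (alpha D (idx x)) h))) * (t_ t x * Uq_q L h).
Proof. exact: (@hom_conj Kq (Uhat D) (Uq L) piU _ _ _ (Uq_pi_alg_hom L) (qh_tlow h x)). Qed.

(** Apply omega to the relation of t_x with q^-h. *)
Lemma Uq_q_s h x : Uq_q L h * s_ t x =
  scal (qq ^ ((lev x)%:Z * wt_val (alpha D (idx x)) h)) * (s_ t x * Uq_q L h).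
Proof.
have := @hom_conj Kq (Uhat D) (Uq L) piO _ _ _ piO_alg_hom (qh_tlow (- h) x).
by rewrite omega_q opprK wt_valN mulrN opprK.
Qed.

Lemma Uq_q_T h x : Uq_q L h * T_ t x =
  scal (qq ^ (- ((lev x)%:Z * wt_val (alpha D (idx x)) h))) * (T_ t x * Uq_q L h).
Proof. exact: (@hom_scal_conj Kq (Uq L) _ _ _ _ (Uq_q_t h x)). Qed.

Lemma s_T_comm x y : comm (s_ t x) (T_ t y) =
  if x == y then scal (q_ D (idx y) ^+ 2 - 1)^-1 * (Uq_q L (Kexp [:: x]) - Uq_q L (- Kexp [:: x]))
  else 0.
Proof.
apply: etrans (@comm_scalr Kq (Uq L) _ _ _) _.
have h := s_t_comm t x y; move: h; case: eqP => [->|_] h.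
  exact: (@scal_ifK Kq (Uq L) true _ _ _ _ (tlow_neq0 t y) h).
exact: (@scal_ifK Kq (Uq L) false _ 0 _ _ (tlow_neq0 t y) h).
Qed.

(** The nonnegative number -a_ij, as it is used for i different from j. *)
Definition serre_m (i j : Iinf D) : nat := absz (cm D (idx i) (idx j)).

Lemma serre_expE (i j : Iinf D) : idx i != idx j -> serre_exp i j = (lev j * serre_m i j).+1.
Proof.
move=> ne; rewrite /serre_exp /serre_m; have := cm_off D ne.
case: (cm D (idx i) (idx j)) => [[|n]|n] //= _; first by rewrite mulr0 muln0.
by rewrite NegzE mulrN opprK.
Qed.

Lemma real_idx_neq (i j : Iinf D) : is_real D (idx i) -> i != j -> idx i != idx j.
Proof.
move=> hr ne; apply/eqP => e; case/eqP: ne; apply: Iinf_eq => //.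
by rewrite !lev_real // -e.
Qed.

Lemma fh_serre (i j : Iinf D) : is_real D (idx i) -> i != j ->
  qadn (fh i : Uhat D) (q_ D (idx i)) (q_ D (idx i) ^- (lev j * serre_m i j))
     (lev j * serre_m i j).+1 (fh j) = 0.
Proof.
move=> hr ne; have := Uhat_relE (Uhat_serreF (@qh I D) (@eh I D) (@fh I D) hr ne).
rewrite /qserre (serre_expE (real_idx_neq hr ne)) => <-; apply/esym.
apply: (@serre_sum_qadn Kq (Uhat D) (q_ D (idx i))).
  by rewrite expf_neq0 // qq_neq0.
by move=> n; apply: gint_qq; exact: cr_gt0.
Qed.

(** For a real index t_i = f_i, and t_j is a combination of words in the f_jk. *)
Lemma tlow_serre (i j : Iinf D) : is_real D (idx i) -> i != j ->
  qadn (tlow t i : Uhat D) (q_ D (idx i)) (q_ D (idx i) ^- (lev j * serre_m i j))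
     (lev j * serre_m i j).+1 (tlow t j) = 0.
Proof.
move=> hr ne; rewrite (tlow_real t hr).
apply: (@qadn_word_comb I D Kq (Uhat D) (@fh I D) _ (tlow_span t)) => y hy.
have e : serre_m i y = serre_m i j by rewrite /serre_m hy.
rewrite -e; apply: fh_serre => //; apply/eqP => ey.
by have := real_idx_neq hr ne; rewrite ey hy eqxx.
Qed.

Lemma s_serre (i j : Iinf D) : is_real D (idx i) -> i != j ->
  qadn (s_ t i : Uq L) (q_ D (idx i)) (q_ D (idx i) ^- (lev j * serre_m i j))
     (serre_exp i j) (s_ t j) = 0.
Proof.
move=> hr ne; rewrite (serre_expE (real_idx_neq hr ne)).
exact: (@qadn_hom0 Kq (Uhat D) (Uq L) piO _ _ _ _ _ piO_alg_hom (tlow_serre hr ne)).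
Qed.

Lemma T_serre (i j : Iinf D) : is_real D (idx i) -> i != j ->
  qadn (T_ t i : Uq L) (q_ D (idx i)) (q_ D (idx i) ^- (lev j * serre_m i j))
     (serre_exp i j) (T_ t j) = 0.
Proof.
move=> hr ne; rewrite (serre_expE (real_idx_neq hr ne)).
apply: (@qadn_scal0 Kq (Uq L)).
exact: (@qadn_hom0 Kq (Uhat D) (Uq L) piU _ _ _ _ _ (Uq_pi_alg_hom L) (tlow_serre hr ne)).
Qed.

Lemma tlow_comm (i j : Iinf D) : cm D (idx i) (idx j) = 0 ->
  comm (tlow t i) (tlow t j) = 0.
Proof.
move=> h; apply: (@comm_word_comb I D Kq (Uhat D) (@fh I D) _ (tlow_span t)) => x y hx hy.
by apply: (Uhat_relE (Uhat_commF (@qh I D) (@eh I D) (@fh I D) _)); rewrite hx hy.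
Qed.

Lemma s_comm (i j : Iinf D) : cm D (idx i) (idx j) = 0 -> comm (s_ t i) (s_ t j) = 0.
Proof. by move=> h; exact: (@comm_hom0 Kq (Uhat D) (Uq L) piO _ _ piO_alg_hom (tlow_comm h)). Qed.

Lemma T_comm (i j : Iinf D) : cm D (idx i) (idx j) = 0 -> comm (T_ t i) (T_ t j) = 0.
Proof.
move=> h; apply: (@comm_scal0 Kq (Uq L)).
exact: (@comm_hom0 Kq (Uhat D) (Uq L) piU _ _ (Uq_pi_alg_hom L) (tlow_comm h)).
Qed.

Section Kill.
Variables (K : fieldType) (U A : pzAlgType K) (F : Iinf D -> U) (g : U -> A).
Variables (V : lmodType A) (v : V).
Hypothesis gh : alg_hom g.
Hypothesis gv : forall x, g (F x) *: v = 0.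

(** Levels being positive, the words that occur are nonempty, so their last letter
acts first and kills v. *)
Lemma kill_word_comb (t' : Iinf D -> U) x : (forall x, lspan (is_word_of F x) (t' x : algmod U)) ->
  g (t' x) *: v = 0.
Proof.
move=> h; apply: (@word_comb_ind I D K U F t' h x (fun z => g z *: v = 0)) => [|c u w hu hwl|w _ hwl].
- by rewrite (alg_hom0 gh) scale0r.
- by rewrite (lin_alg_hom _ _ _ gh) scalerDl -scalerA hu hwl scaler0 addr0.
elim/last_ind: w hwl => [|w y IH] hwl.
  by move: hwl; rewrite big_nil; have := lev_gt0 x; case: (lev x).
by rewrite /fw -cats1 big_cat big_seq1 (alg_homM gh) -scalerA gv scaler0.
Qed.
End Kill.

Lemma s_kill (V : lmodType (Uq L)) (v : V) : (forall x, Uq_e L x *: v = 0) ->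
  forall x, s_ t x *: v = 0.
Proof.
move=> hv x; apply: (@kill_word_comb Kq (Uhat D) (Uq L) (@fh I D) piO V v piO_alg_hom).
  by move=> y; rewrite omega_f; exact: hv.
exact: tlow_span.
Qed.
End UqFacts.

(** * Values at q = 1 *)

Section Eval1.

(** The scalar c is regular at q = 1 with value r.  A relation rather than a function,
so that regularity need not be established beforehand. *)
Definition ev (c : Kq) (r : rat) : Prop :=
  exists g h : {poly rat}, [/\ h.[1] != 0, c = frac_of g / frac_of h & g.[1] / h.[1] = r].

Lemma frac_ofM g h : frac_of (g * h) = frac_of g * frac_of h.
Proof. by rewrite /frac_of rmorphM. Qed.
Lemma frac_ofB g h : frac_of (g - h) = frac_of g - frac_of h.
Proof. by rewrite /frac_of rmorphB. Qed.
Lemma frac_of1 : frac_of 1 = 1.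
Proof. by rewrite /frac_of rmorph1. Qed.

Lemma evP c : c \in A1_pred -> exists r, ev c r.
Proof. by move/asboolP => [g [h [h1 e]]]; exists (g.[1] / h.[1]), g, h. Qed.
Lemma ev_A1 c r : ev c r -> c \in A1_pred.
Proof. by case=> g [h [h1 e _]]; apply/asboolP; exists g, h. Qed.

Lemma evB c d r s : ev c r -> ev d s -> ev (c - d) (r - s).
Proof.
move=> [g [h [h1 -> <-]]] [g' [h' [h1' -> <-]]].
exists (g * h' - g' * h), (h * h'); split.
- by rewrite hornerM mulf_neq0.
- by rewrite frac_ofB !frac_ofM -[in LHS]mulNr addf_div ?frac_of_neq0 // mulNr.
- by rewrite hornerD hornerN !hornerM -[in RHS]mulNr addf_div // mulNr.
Qed.
Lemma evM c d r s : ev c r -> ev d s -> ev (c * d) (r * s).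
Proof.
move=> [g [h [h1 -> <-]]] [g' [h' [h1' -> <-]]].
exists (g * g'), (h * h'); split.
- by rewrite hornerM mulf_neq0.
- by rewrite !frac_ofM mulf_div.
- by rewrite !hornerM mulf_div.
Qed.
Lemma evV c r : ev c r -> r != 0 -> ev c^-1 r^-1.
Proof.
move=> [g [h [h1 -> <-]]]; rewrite mulf_eq0 negb_or => /andP [g1 _].
by exists h, g; split=> //; rewrite invf_div.
Qed.
Lemma ev_rat r : ev (frac_of r%:P) r.
Proof.
by exists r%:P, 1; split; rewrite ?hornerC ?oner_eq0 ?frac_of1 ?divr1 // hornerC divr1.
Qed.
Lemma ev1 : ev 1 1.
Proof. by rewrite -frac_of1 -[1 : {poly rat}]/(1%:P); exact: ev_rat. Qed.
Lemma ev0 : ev 0 0.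
Proof. by have := evB ev1 ev1; rewrite !subrr. Qed.
Lemma evN c r : ev c r -> ev (- c) (- r).
Proof. by move=> h; have := evB ev0 h; rewrite !sub0r. Qed.
Lemma evD c d r s : ev c r -> ev d s -> ev (c + d) (r + s).
Proof. by move=> h h'; have := evB h (evN h'); rewrite !opprK. Qed.
Lemma ev_q : ev qq 1.
Proof.
by exists 'X, 1; split; rewrite ?hornerC ?oner_eq0 ?frac_of1 ?divr1 ?hornerX.
Qed.
Lemma ev_qX n : ev (qq ^+ n) 1.
Proof.
elim: n => [|n IH]; first by rewrite expr0; exact: ev1.
by rewrite exprS; have := evM ev_q IH; rewrite mulr1.
Qed.
Lemma ev_qz (z : int) : ev (qq ^ z) 1.
Proof.
case: z => n; first exact: ev_qX.
by rewrite NegzE -exprnN; have := evV (ev_qX n.+1) (oner_neq0 _); rewrite invr1.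
Qed.
Lemma ev_q1 : ev (qq - 1) 0.
Proof. by have := evB ev_q ev1; rewrite subrr. Qed.

Lemma qq1_neq0 : qq - 1 != 0.
Proof. by rewrite subr_eq0 -[qq]expr1 qq_exp_neq1. Qed.

Lemma brS (K : fieldType) (q : K) n : q - 1 != 0 ->
  (q ^+ n.+1 - 1) / (q - 1) = q * ((q ^+ n - 1) / (q - 1)) + 1.
Proof. by move=> h; rewrite exprS; field. Qed.
Lemma brN (K : fieldType) (q : K) n : q != 0 ->
  (q ^- n - 1) / (q - 1) = - (q ^- n * ((q ^+ n - 1) / (q - 1))).
Proof.
move=> h; rewrite mulrA mulrBr mulVf ?expf_neq0 // mulr1.
by rewrite -mulNr opprB.
Qed.

Lemma ev_brn n : ev ((qq ^+ n - 1) / (qq - 1)) n%:R.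
Proof.
elim: n => [|n IH]; first by rewrite expr0 subrr mul0r; exact: ev0.
have -> : (qq ^+ n.+1 - 1) / (qq - 1) = qq * ((qq ^+ n - 1) / (qq - 1)) + 1.
  exact: (@brS Kq _ _ qq1_neq0).
by rewrite -natr1 -[n%:R]mul1r; apply: evD ev1; apply: evM IH; exact: ev_q.
Qed.

(** The geometric sum 1 + q + ... + q^(z-1) has z terms; for negative z, factor out
the power of q. *)
Lemma ev_br (z : int) : ev ((qq ^ z - 1) / (qq - 1)) z%:~R.
Proof.
case: z => n; first exact: ev_brn.
rewrite NegzE -exprnN.
have -> : (qq ^- n.+1 - 1) / (qq - 1) = - (qq ^- n.+1 * ((qq ^+ n.+1 - 1) / (qq - 1))).
  exact: (@brN Kq _ _ qq_neq0).
rewrite mulrNz -[n.+1%:~R]mul1r; apply: evN; apply: evM (ev_brn _).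
by rewrite exprnN; exact: ev_qz.
Qed.

(** The inverse of (q^(2r) - 1) / (q - 1), whose value is 2r. *)
Lemma ev_denom r : (0 < r)%N ->
  ev ((qq - 1) / ((qq ^+ r) ^+ 2 - 1)) ((2 * r)%:R)^-1.
Proof.
move=> r0; rewrite -exprM mulnC -invf_div; apply: evV; first exact: ev_brn.
by rewrite pnatr_eq0 muln_eq0 -lt0n r0.
Qed.

(** If g / h has value r at 1 then g - r h is divisible by X - 1, so g / h - r lies in
the maximal ideal. *)
Lemma A1_scal_ev (a : A1) r : ev (A1_val a) r -> A1_scal a = A1_scal (rat_A1 r).
Proof.
move=> [g [h [h1 e er]]]; apply/eqP.
rewrite /A1_scal -Quotient.idealrBE; apply/asboolP.
have [g' eg] : exists g', g - r%:P * h = g' * ('X - 1%:P).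
  apply/factor_theorem; rewrite rootE hornerD hornerN hornerM hornerC -er.
  by rewrite divfK // subrr.
have hb : frac_of g' / frac_of h \in A1_pred by apply/asboolP; exists g', h.
exists (InA1 hb); rewrite raddfB /= e.
have -> : frac_of g = frac_of r%:P * frac_of h + (qq - 1) * frac_of g'.
  rewrite -frac_of1 -frac_ofB -!frac_ofM [X in _ + frac_of X]mulrC -[1]/(1%:P) -eg frac_ofB.
  by rewrite addrC subrK.
by rewrite mulrDl mulfK ?frac_of_neq0 // addrC addKr mulrA.
Qed.
End Eval1.

Section A1Residue.
Local Open Scope quotient_scope.

Definition q1_A1 : A1 := InA1 (ev_A1 ev_q1).

Lemma A1_scal_surj (a : A1modJ1) : exists c, a = scal c.
Proof. by exists (repr (a : {ideal_quot J1_pred})); rewrite [scal _]/(A1_scal _) /A1_scal reprK. Qed.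
Lemma A1_scal_eq0 c : A1_scal c = 0 -> c \in J1_pred.
Proof.
move=> e; rewrite -[c]subr0 Quotient.idealrBE; apply/eqP.
by apply: etrans e _; rewrite -(raddf0 (\pi_({ideal_quot J1_pred}))).
Qed.
Lemma A1_scal_ker c : A1_scal c = 0 -> exists c', c = q1_A1 * c'.
Proof. by move/A1_scal_eq0/asboolP => [b e]; exists b; apply: val_inj. Qed.
Lemma A1_scal_tt : A1_scal q1_A1 = 0.
Proof.
rewrite (A1_scal_ev (r := 0)); last exact: ev_q1.
by rewrite raddf0; exact: (raddf0 (\pi_({ideal_quot J1_pred}))).
Qed.

Lemma A1_proper a : a \in A1_pred -> (qq - 1) * a <> 1.
Proof.
move=> ha e; have [_ n1 _] := J1_idealr; case/negP: n1.
apply/asboolP; exists (InA1 ha); rewrite /= e; exact: (rmorph1 A1_val).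
Qed.

(** Weights may be compared through the eigenvalues of q^h. *)
Lemma qqz_inj (z z' : int) : qq ^ z = qq ^ z' -> z = z'.
Proof.
move=> e; apply/eqP; rewrite -subr_eq0; apply/eqP.
have : qq ^ (z - z') = 1 by rewrite expfzDr ?qq_neq0 // e -expfzDr ?qq_neq0 // subrr.
case: (z - z') => [[|n]|n] //.
  by move=> e'; have := qq_exp_neq1 (ltn0Sn n); rewrite -exprnP in e'; rewrite e' eqxx.
rewrite NegzE -exprnN => /(congr1 (fun c => c^-1)); rewrite invrK invr1 => e'.
by have := qq_exp_neq1 (ltn0Sn n); rewrite e' eqxx.
Qed.

End A1Residue.

(** * Classical limits of relations *)

Section CartanInd.
Variable I : countType.
Lemma malgUZ (R : nzRingType) (X : choiceType) (c : R) (b : X) :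
  << c *g b >> = c *: << 1 *g b >> :> {malg R[X]}.
Proof. by apply/malgP => k; rewrite mcoeffZ !mcoeffU mulrnAr mulr1. Qed.

(** The rational Cartan subalgebra is spanned by P^vee, so linear statements need only
be checked there. *)
Lemma cartan_ind (P : cartan I -> Prop) :
  P 0 -> (forall c h h', P h -> P h' -> P (c *: h + h')) ->
  (forall h : Pvee I, P (Pvee_in h)) -> forall h, P h.
Proof.
move=> P0 PD Pb h; rewrite [h](monalgE (h : {malg rat[(I + I)%type]})).
elim/big_ind: _ => [//|u v hu hv|b _]; first by rewrite -[u]scale1r; apply: PD.
rewrite malgUZ -[X in P X]addr0; apply: PD => //.
have := Pb << 1 *g b >>; congr P.
by rewrite /Pvee_in msuppU oner_eq0 big_seq_fset1 mcoeffUU.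
Qed.
End CartanInd.

Lemma cartan_weight (I : countType) (B : pzAlgType rat) (M : lmodType B)
    (H : cartan I -> B) (y : M) (mu : cartan I -> rat) :
  (forall c h h', H (c *: h + h') = scal c * H h + H h') ->
  (forall c h h', mu (c *: h + h') = c * mu h + mu h') ->
  (forall h : Pvee I, H (Pvee_in h) *: y = (scal (mu (Pvee_in h)) : B) *: y) ->
  forall h, H h *: y = (scal (mu h) : B) *: y.
Proof.
move=> HP mP hy; apply: cartan_ind => [|c h h' eh eh'|h]; last exact: hy.
- have -> : mu 0 = 0.
    by have := mP (-1) 0 0; rewrite scaler0 addr0 => ->; rewrite mulN1r addNr.
  have -> : H 0 = 0.
    have := HP (-1) 0 0; rewrite scaler0 addr0 => ->.
    by rewrite rmorphN rmorph1 mulN1r addNr.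
  by rewrite rmorph0 !scale0r.
- by rewrite HP scalerDl -scalerA eh eh' mP rmorphD rmorphM scalerDl -scalerA.
Qed.

(** The passage to the limit is carried out for an arbitrary relation lim between the
quantum algebra and a rational algebra that is functional and compatible with
subtraction, product and values of scalars. *)
Section ClassicalLimit.
Variables (I : countType) (D : cartan_datum I) (K : fieldType) (q : K).
Variables (ev : K -> rat -> Prop).
Hypothesis q_neq0 : q != 0.
Hypothesis q1_neq0 : q - 1 != 0.
Hypothesis ev_qz : forall z : int, ev (q ^ z) 1.
Hypothesis ev_q1 : ev (q - 1) 0.
Hypothesis ev_br : forall z : int, ev ((q ^ z - 1) / (q - 1)) z%:~R.
Hypothesis ev_denom : forall r, (0 < r)%N ->
  ev ((q - 1) / ((q ^+ r) ^+ 2 - 1)) ((2 * r)%:R)^-1.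

Variables (A : pzAlgType K) (B : pzAlgType rat) (lim : A -> B -> Prop).
Hypothesis lim_fun : forall u x y, lim u x -> lim u y -> x = y.
Hypothesis limB : forall u v x y, lim u x -> lim v y -> lim (u - v) (x - y).
Hypothesis limM : forall u v x y, lim u x -> lim v y -> lim (u * v) (x * y).
Hypothesis limS : forall c r, ev c r -> lim (scal c) (scal r).

Variables (Qh : Pvee I -> A) (s T : Iinf D -> A).
Variables (hb : Pvee I -> B) (sb Tb : Iinf D -> B).

(** The element (q^h; 0)_q, whose limit is h. *)
Definition q0 h : A := scal (q - 1)^-1 * (Qh h - 1).
Hypothesis lim_s : forall x, lim (s x) (sb x).
Hypothesis lim_T : forall x, lim (T x) (Tb x).
Hypothesis lim_h : forall h, lim (q0 h) (hb h).

Hypothesis Q0 : Qh 0 = 1.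
Hypothesis QD : forall h h', Qh h * Qh h' = Qh (h + h').
Hypothesis Qs : forall h x, Qh h * s x =
  scal (q ^ ((lev x)%:Z * wt_val (alpha D (idx x)) h)) * (s x * Qh h).
Hypothesis QT : forall h x, Qh h * T x =
  scal (q ^ (- ((lev x)%:Z * wt_val (alpha D (idx x)) h))) * (T x * Qh h).
Hypothesis sT : forall x y, comm (s x) (T y) =
  if x == y then scal ((q ^+ cr D (idx y)) ^+ 2 - 1)^-1 *
    (Qh (Kexp ([:: x] : words (Iinf D))) - Qh (- Kexp ([:: x] : words (Iinf D))))
  else 0.
Variable serre_c : Iinf D -> Iinf D -> int.
Hypothesis serre_s : forall i j, is_real D (idx i) -> i != j ->
  qadn (s i) (q ^+ cr D (idx i)) (q ^ serre_c i j) (serre_exp i j) (s j) = 0.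
Hypothesis serre_T : forall i j, is_real D (idx i) -> i != j ->
  qadn (T i) (q ^+ cr D (idx i)) (q ^ serre_c i j) (serre_exp i j) (T j) = 0.
Hypothesis comm_s : forall i j, cm D (idx i) (idx j) = 0 -> comm (s i) (s j) = 0.
Hypothesis comm_T : forall i j, cm D (idx i) (idx j) = 0 -> comm (T i) (T j) = 0.

Lemma lim1 : lim 1 1.
Proof. by have := limS (ev_qz 0); rewrite expr0z !rmorph1. Qed.
Lemma lim0 : lim 0 0.
Proof. by have := limB lim1 lim1; rewrite !subrr. Qed.
Lemma limD u v x y : lim u x -> lim v y -> lim (u + v) (x + y).
Proof. by move=> h h'; have := limB h (limB lim0 h'); rewrite !sub0r !opprK. Qed.
Lemma limZ c r u x : ev c r -> lim u x -> lim (scal c * u) (scal r * x).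
Proof. by move=> h h'; apply: limM => //; exact: limS. Qed.
Lemma lim_comm u v x y : lim u x -> lim v y -> lim (comm u v) (comm x y).
Proof. by move=> h h'; apply: limB; apply: limM. Qed.

Lemma QhE h : Qh h = scal (q - 1) * q0 h + 1.
Proof. by rewrite /q0 mulrA -rmorphM divff // rmorph1 mul1r subrK. Qed.

(** q^h = 1 + (q - 1) (q^h; 0)_q. *)
Lemma lim_Q h : lim (Qh h) 1.
Proof.
have := limD (limZ ev_q1 (lim_h h)) lim1.
by rewrite -QhE rmorph0 mul0r add0r.
Qed.

(** (q^(h+h'); 0)_q = (q^h; 0)_q q^h' + (q^h'; 0)_q, and q^h' has limit 1. *)
Lemma hbD h h' : hb (h + h') = hb h + hb h'.
Proof.
apply: lim_fun (lim_h (h + h')) _.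
have -> : q0 (h + h') = q0 h * Qh h' + q0 h'.
  by rewrite /q0 -QD -mulrA -mulrDr mulrBl mul1r addrA subrK.
by have := limD (limM (lim_h h) (lim_Q h')) (lim_h h'); rewrite mulr1.
Qed.
Lemma hbB : zmod_morphism hb.
Proof. by move=> h h'; apply: (addIr (hb h')); rewrite -hbD !subrK. Qed.
HB.instance Definition _ := GRing.isZmodMorphism.Build (Pvee I) B hb hbB.

(** The linear extension of hb from P^vee to the Cartan subalgebra, on the basis of
the h_i and d_i. *)
Definition hQ (h : cartan I) : B :=
  @lext rat (I + I)%type (algmod B) (fun b => hb << 1 *g (b : (I + I)%type) >>) h.

Lemma hQP c h h' : hQ (c *: h + h') = scal c * hQ h + hQ h'.
Proof. exact: (linearP (@lext rat (I + I)%type (algmod B) _)). Qed.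
Lemma hQ0 : hQ 0 = 0.
Proof. exact: (linear0 (@lext rat (I + I)%type (algmod B) _)). Qed.

Lemma scal_int (z : int) (x : B) : (scal z%:~R : B) * x = x *~ z.
Proof. by rewrite rmorph_int mulrzl. Qed.

Lemma malgUz (z : int) (b : (I + I)%type) :
  << z *g b >> = (<< 1 *g b >> : {malg int[(I + I)%type]}) *~ z.
Proof.
apply/malgP => k; rewrite raddfMz /= !mcoeffU; case: eqP => _.
  by rewrite !mulr1n intz.
by rewrite mul0rz.
Qed.

Lemma hQ_Pvee h : hQ (Pvee_in h) = hb h.
Proof.
rewrite [h in RHS](monalgE (h : {malg int[(I + I)%type]})) (raddf_sum hb).
rewrite /Pvee_in /hQ (raddf_sum (@lext rat (I + I)%type (algmod B) _)).
apply: eq_bigr => b _ /=; rewrite lextU [in RHS]malgUz (raddfMz hb).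
exact: scal_int.
Qed.

Lemma hb_comm h h' : comm (hb h) (hb h') = 0.
Proof.
have c : comm (q0 h) (q0 h') = 0.
  rewrite /q0 comm_scall comm_scalr [X in scal _ * (scal _ * X)](_ : _ = 0) ?mulr0 //.
  rewrite comm_B1 comm_anti comm_B1 /comm !QD (addrC h').
  by rewrite subrr oppr0.
by have := lim_comm (lim_h h) (lim_h h'); rewrite c => /lim_fun; apply; exact: lim0.
Qed.

(** If x has q^h-weight q^m, its commutator with (q^h; 0)_q is
(q^m - 1) / (q - 1) x q^h, whose limit is m y. *)
Lemma hb_weight h (x : A) (y : B) (m : int) : lim x y ->
  Qh h * x = scal (q ^ m) * (x * Qh h) -> comm (hb h) y = scal m%:~R * y.
Proof.
move=> xy e; apply: lim_fun (lim_comm (lim_h h) xy) _.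
have -> : comm (q0 h) x = scal ((q ^ m - 1) / (q - 1)) * (x * Qh h).
  have sx c : comm x (scal c) = 0 by rewrite /comm scalC subrr.
  rewrite /q0 comm_scall mulrC rmorphM -mulrA; congr (_ * _).
  rewrite /comm mulrBl e mulrBr mul1r mulr1 opprB addrA subrK.
  by rewrite rmorphB rmorph1 mulrBl mul1r.
by have := limZ (ev_br m) (limM xy (lim_Q h)); rewrite mulr1.
Qed.

Lemma comm_linl c (x y z : B) : comm (scal c * x + y) z = scal c * comm x z + comm y z.
Proof. by rewrite comm_anti comm_lin opprD -mulrN -!comm_anti. Qed.

Lemma hQ_weight (mu : cartan I -> rat) (y : B) :
  (forall c h h', mu (c *: h + h') = c * mu h + mu h') ->
  (forall h : Pvee I, comm (hb h) y = scal (mu (Pvee_in h)) * y) ->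
  forall h, comm (hQ h) y = scal (mu h) * y.
Proof.
move=> mP hP; apply: cartan_ind => [|c h h' eh eh'|h].
- have -> : mu 0 = 0.
    by have := mP (-1) 0 0; rewrite scaler0 addr0 => ->; rewrite mulN1r addNr.
  by rewrite hQ0 comm_anti comm0 oppr0 rmorph0 mul0r.
- by rewrite hQP comm_linl eh eh' mP rmorphD rmorphM mulrDl mulrA.
- by rewrite hQ_Pvee.
Qed.

(** With r = r_i and K = q^(r h_i), write K^l - K^-l = K^-l (K^2l - 1).  Dividing by
q^(2r) - 1 gives K^-l (K^2l; 0)_q times (q - 1) / (q^(2r) - 1); the limits are 1,
2 r l h_i and 1 / (2r), which leaves l h_i. *)
Lemma lim_sT x : comm (sb x) (Tb x) = scal (lev x)%:R * hb (coroot (idx x)).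
Proof.
have := lim_comm (lim_s x) (lim_T x); rewrite sT eqxx; set k := Kexp _.
have ek : k = coroot (idx x) *~ ((cr D (idx x))%:Z * (lev x)%:Z) by exact: big_seq1.
have r0 := cr_gt0 D (idx x); set r := cr D (idx x) in ek r0 *.
have -> : scal ((q ^+ r) ^+ 2 - 1)^-1 * (Qh k - Qh (- k)) =
    scal ((q - 1) / ((q ^+ r) ^+ 2 - 1)) * (Qh (- k) * q0 (k + k)) :> A.
  rewrite /q0 (scalCA _ (Qh (- k))) [Qh (- k) * _]mulrBr QD addKr mulr1.
  by rewrite [RHS]mulrA -rmorphM mulrAC divff // mul1r.
move=> h1; apply: lim_fun h1 _.
have := limZ (ev_denom r0) (limM (lim_Q (- k)) (lim_h (k + k))).
congr lim; rewrite mul1r ek -mulrzDr (raddfMz hb) -scal_int mulrA -rmorphM.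
congr (scal _ * _).
have r1 : r%:R != 0 :> rat by rewrite pnatr_eq0 -lt0n.
have -> : ((r%:Z * (lev x)%:Z + r%:Z * (lev x)%:Z)%:~R : rat) = (2 * r)%:R * (lev x)%:R.
  by rewrite -mulrDr !intrM intrD -!pmulrn natrM; ring.
by rewrite mulKf // natrM mulf_neq0 // pnatr_eq0.
Qed.

(** All twists are powers of q, of value 1, so that twisted commutators become
commutators and the quantum Serre relations become the classical ones. *)
Lemma lim_qadn (f x : A) (f' x' : B) (c : int) (r n : nat) : lim f f' -> lim x x' ->
  lim (qadn f (q ^+ r) (q ^ c) n x) (iter n (comm f') x').
Proof.
move=> hf; elim: n c x x' => [//|n IH] c x x' hx.
rewrite iterSr /=.
have -> : q ^ c * (q ^+ r) ^+ 2 = q ^ (c + (r * 2)%:Z) 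
  by rewrite expfzDr //; congr (_ * _); exact: (esym (exprM q r 2)).
apply: IH.
have := limB (limM hf hx) (limZ (ev_qz c) (limM hx hf)).
by rewrite rmorph1 mul1r.
Qed.

Lemma classical_relations r : Ug_rel (D := D) hQ sb Tb r -> r = 0.
Proof.
case=> {r} [c h h'|h h'|i j|h j|h j|i j hi ij|i j hi ij|i j hij|i j hij].
- by rewrite hQP subrr.
- have hh' (k : Pvee I) : comm (hQ h) (hb k) = 0.
    rewrite (@hQ_weight (fun _ => 0) (hb k)) ?rmorph0 ?mul0r // => [c _ _|k'].
      by rewrite mulr0 addr0.
    exact: hb_comm.
  move: h'; apply: cartan_ind => [|c k k' hk hk'|k].
  + by rewrite hQ0 comm0.
  + by rewrite hQP comm_lin hk hk' mulr0 addr0.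
  + by rewrite hQ_Pvee hh'.
- case: eqP => [<-|ne].
    rewrite lim_sT -hQ_Pvee; apply/eqP; rewrite subr_eq0; apply/eqP.
    congr (_ * hQ _); rewrite /coroot /corootQ /Pvee_in.
    by rewrite msuppU oner_eq0 big_seq_fset1 mcoeffUU.
  rewrite subr0; apply: lim_fun (lim_comm (lim_s i) (lim_T j)) _.
  by rewrite sT; case: eqP => // _; exact: lim0.
- rewrite (@hQ_weight (fun h => (lev j)%:R * (alpha D (idx j) h : rat))) ?subrr //.
    by move=> c k k'; rewrite linearP /= mulrDr mulrCA.
  move=> k; rewrite (hb_weight (lim_s j) (Qs k j)) intrM wt_valE //.
- rewrite (@hQ_weight (fun h => - ((lev j)%:R * (alpha D (idx j) h : rat)))) ?subrr //.
    by move=> c k k'; rewrite linearP /= mulrDr mulrCA opprD mulrN.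
  move=> k; rewrite (hb_weight (lim_T j) (QT k j)) mulrNz intrM wt_valE //.
- have := lim_qadn (serre_c i j) (cr D (idx i)) (serre_exp i j) (lim_s i) (lim_s j).
  by rewrite serre_s // => /lim_fun; apply; exact: lim0.
- have := lim_qadn (serre_c i j) (cr D (idx i)) (serre_exp i j) (lim_T i) (lim_T j).
  by rewrite serre_T // => /lim_fun; apply; exact: lim0.
- apply: lim_fun (lim_comm (lim_s i) (lim_s j)) _.
  by rewrite comm_s //; exact: lim0.
- apply: lim_fun (lim_comm (lim_T i) (lim_T j)) _.
  by rewrite comm_T //; exact: lim0.
Qed.
End ClassicalLimit.

(** * The homomorphism from the classical enveloping algebra *)

Section UgHom.
Variables (I : countType) (D : cartan_datum I) (A B : pzAlgType rat) (p : A -> B).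
Variables (H : cartan I -> A) (E F : Iinf D -> A).
Variables (H' : cartan I -> B) (E' F' : Iinf D -> B).
Hypothesis ph : alg_hom p.
Hypothesis pH : forall h, p (H h) = H' h.
Hypothesis pE : forall x, p (E x) = E' x.
Hypothesis pF : forall x, p (F x) = F' x.

Lemma hom_comm x y : p (comm x y) = comm (p x) (p y).
Proof. by rewrite /comm (alg_homB ph) !(alg_homM ph). Qed.
Lemma hom_iter_comm n x y : p (iter n (comm x) y) = iter n (comm (p x)) (p y).
Proof. by elim: n => //= n IH; rewrite hom_comm IH. Qed.

(** The relations of the generators of the free algebra are carried to those of their
images, so that psi is well defined as soon as the images satisfy the relations. *)
Lemma Ug_rel_hom r : Ug_rel H E F r -> Ug_rel H' E' F' (p r).
Proof.
have pB := alg_homB ph; have pM := alg_homM ph; have pS := alg_homS ph.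
case=> [c h h'|h h'|i j|h j|h j|i j hi ij|i j hi ij|i j hij|i j hij].
- by rewrite pB (alg_homD ph) pM pS !pH; exact: Ug_lin.
- by rewrite hom_comm !pH; exact: Ug_hh.
- rewrite pB hom_comm pE pF.
  rewrite (_ : p (if _ then _ else _) =
    if i == j then scal (lev i)%:R * H' (corootQ (idx i)) else 0); first exact: Ug_ef.
  by case: eqP => _; rewrite ?(alg_hom0 ph) // pM pS pH.
- by rewrite pB hom_comm pM pS pH pE; exact: Ug_he.
- by rewrite pB hom_comm pM pS pH pF; exact: Ug_hf.
- by rewrite hom_iter_comm !pE; exact: Ug_serreE.
- by rewrite hom_iter_comm !pF; exact: Ug_serreF.
- by rewrite hom_comm !pE; exact: Ug_commE.
- by rewrite hom_comm !pF; exact: Ug_commF.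
Qed.
End UgHom.

Section Ubar.
Variables (I : countType) (D : cartan_datum I) (nu : Iinf D -> Kq).
Variables (L : bozec_data nu) (t : prim_gens L).

(** A relation rather than a map, since membership in the integral form is a
proposition: limits of explicit elements can then be computed without naming them
as elements of the integral form. *)
Definition lim (u : Uq L) (x : U1 t) : Prop := exists2 u' : UA1 t, UA1_val u' = u & ubar u' = x.

Lemma ubarB (u v : UA1 t) : ubar (u - v) = ubar u - ubar v.
Proof. exact: apureBr. Qed.
Lemma ubarM (u v : UA1 t) : ubar (u * v) = ubar u * ubar v.
Proof. by apply: etrans _ (esym (apureM _ _ _ _)); rewrite mul1r. Qed.
Lemma ubarD (u v : UA1 t) : ubar (u + v) = ubar u + ubar v.
Proof. exact: apureDr. Qed.

(** The structure map of U_1 as a rational algebra goes through the constants of A_1,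
which represent all the residues modulo q - 1. *)
Lemma ubar_scal (c : A1) (r : rat) : ev (A1_val c) r -> ubar (scal c : UA1 t) = scal r.
Proof.
move=> h; rewrite -[X in ubar X]mulr1; apply: etrans (apureZr _ _ _) _.
apply: etrans (esym (apureZl _ _ _)) _; rewrite [scal c](A1_scal_ev h).
exact: apureZl.
Qed.

Lemma ubar_surj (x : U1 t) : exists u : UA1 t, ubar u = x.
Proof.
elim/tens_ind: x => [|a u|c x y [u <-] [v <-]].
- by exists 0; apply: apure0r.
- have [c ->] : exists c, a = A1_scal c.
    by exists (repr (a : {ideal_quot J1_pred})); rewrite /A1_scal reprK.
  by exists (scal c * u); exact: (esym (apure_scal A1modJ1 c u)).
- exists (scal c * u + v); rewrite ubarD; congr (_ + _); exact: apureZr.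
Qed.

Lemma lim_fun u x y : lim u x -> lim u y -> x = y.
Proof.
move=> [a ea <-] [b eb <-]; congr ubar; apply: val_inj.
exact: etrans ea (esym eb).
Qed.
Lemma limB u v x y : lim u x -> lim v y -> lim (u - v) (x - y).
Proof. by move=> [a <- <-] [b <- <-]; exists (a - b); rewrite ?ubarB. Qed.
Lemma limM u v x y : lim u x -> lim v y -> lim (u * v) (x * y).
Proof. by move=> [a <- <-] [b <- <-]; exists (a * b); rewrite ?ubarM. Qed.
Lemma limS c r : ev c r -> lim (scal c) (scal r).
Proof.
move=> h; exists (scal (InA1 (ev_A1 h))); first by [].
exact: ubar_scal.
Qed.
Lemma lim_ubar (u : UA1 t) : lim (UA1_val u) (ubar u).
Proof. by exists u. Qed.
Lemma lim_s x : lim (s_ t x) (sbar t x).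
Proof. by exists (InUA1 (UA1_genP (UA1_s t x))). Qed.
Lemma lim_T x : lim (T_ t x) (Tbar t x).
Proof. by exists (InUA1 (UA1_genP (UA1_T t x))). Qed.
Lemma lim_h h : lim (q0 qq (@Uq_q I D nu L) h) (hbar t h).
Proof. by exists (InUA1 (UA1_genP (UA1_q0 t h))). Qed.

(** The exponent of q in the initial twist q_i^(l a_ij) of the Serre relation. *)
Definition serre_c (i j : Iinf D) : int := - ((cr D (idx i) * (lev j * serre_m i j))%N)%:Z.
Lemma serre_cE (i j : Iinf D) :
  q_ D (idx i) ^- (lev j * serre_m i j) = qq ^ serre_c i j.
Proof. by rewrite /serre_c /q_ -exprM exprnN. Qed.

Lemma U1_relations (r : U1 t) : Ug_rel (hbarQ t) (sbar t) (Tbar t) r -> r = 0.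
Proof.
apply: (@classical_relations I D Kq qq ev qq_neq0 qq1_neq0 ev_qz ev_q1 ev_br ev_denom
  (Uq L) (U1 t) lim lim_fun limB limM limS (@Uq_q I D nu L) (s_ t) (T_ t)
  (hbar t) (sbar t) (Tbar t) lim_s lim_T lim_h (@Uq_qD I D nu L)
  (Uq_q_s t) (Uq_q_T t) (s_T_comm t) serre_c _ _ (@s_comm I D nu L t) (@T_comm I D nu L t)).
- by move=> i j hi ij; rewrite -serre_cE; exact: s_serre.
- by move=> i j hi ij; rewrite -serre_cE; exact: T_serre.
Qed.

Lemma hbarQ_Pvee (h : Pvee I) : hbarQ t (Pvee_in h) = hbar t h.
Proof.
exact: (@hQ_Pvee I Kq qq ev qq1_neq0 ev_qz ev_q1 (Uq L) (U1 t) lim lim_fun limB limM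
  limS (@Uq_q I D nu L) (hbar t) lim_h (@Uq_qD I D nu L) h).
Qed.
Lemma lim_Uq_q h : lim (Uq_q L h) 1.
Proof.
exact: (@lim_Q I Kq qq ev qq1_neq0 ev_qz ev_q1 (Uq L) (U1 t) lim limB limM
  limS (@Uq_q I D nu L) (hbar t) lim_h h).
Qed.

Definition psi_gen (g : Ug_gen D) : U1 t :=
  match g with
  | inl h => hbarQ t h
  | inr (inl x) => sbar t x
  | inr (inr x) => Tbar t x
  end.
Definition psi (x : Ug D) : U1 t :=
  @fext rat (Ug_gen D) (U1 t) psi_gen (arepr (Ug_rel (@Ug_gH I D) (@Ug_gE I D) (@Ug_gF I D)) x).

Lemma psi_gen_rel r : Ug_rel (@Ug_gH I D) (@Ug_gE I D) (@Ug_gF I D) r ->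
  @fext rat (Ug_gen D) (U1 t) psi_gen r = 0.
Proof.
move=> hr; apply: U1_relations.
apply: (Ug_rel_hom (fext_alg_hom psi_gen) _ _ _ hr) => x.
- exact: (fext_gen psi_gen (inl x)).
- exact: (fext_gen psi_gen (inr (inl x))).
- exact: (fext_gen psi_gen (inr (inr x))).
Qed.

Lemma psi_alg_hom : alg_hom psi.
Proof. exact: (afactor_alg_hom (fext_alg_hom psi_gen) psi_gen_rel). Qed.
Lemma psi_h h : psi (Ug_h D h) = hbarQ t h.
Proof.
apply: etrans (afactorE (fext_alg_hom psi_gen) psi_gen_rel _) _.
exact: (fext_gen psi_gen (inl h)).
Qed.
Lemma psi_e x : psi (Ug_e x) = sbar t x.
Proof.
apply: etrans (afactorE (fext_alg_hom psi_gen) psi_gen_rel _) _.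
exact: (fext_gen psi_gen (inr (inl x))).
Qed.
Lemma psi_f x : psi (Ug_f x) = Tbar t x.
Proof.
apply: etrans (afactorE (fext_alg_hom psi_gen) psi_gen_rel _) _.
exact: (fext_gen psi_gen (inr (inr x))).
Qed.

(** The limits of the generators of the integral form, and of the scalars, lie in the
image of psi, which is a subalgebra. *)
Lemma lim_psi u : in_UA1 t u -> exists x, lim u (psi x).
Proof.
elim=> {u} [_ [x|x|h|h]|c hc|u v _ [x hx] _ [y hy]|u v _ [x hx] _ [y hy]].
- by exists (Ug_e x); rewrite psi_e; exact: lim_s.
- by exists (Ug_f x); rewrite psi_f; exact: lim_T.
- by exists 1; rewrite (alg_hom1 psi_alg_hom); exact: lim_Uq_q.
- by exists (Ug_h D (Pvee_in h)); rewrite psi_h hbarQ_Pvee; exact: lim_h.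
- have [r hr] := evP hc; exists (scal r); rewrite (alg_homS psi_alg_hom).
  exact: limS.
- by exists (x - y); rewrite (alg_homB psi_alg_hom); exact: limB.
- by exists (x * y); rewrite (alg_homM psi_alg_hom); exact: limM.
Qed.

Lemma psi_surj (u : U1 t) : exists x, psi x = u.
Proof.
have [z <-] := ubar_surj u.
have [x hx] : exists x, lim (UA1_val z) (psi x).
  by apply: lim_psi; apply/asboolP; exact: UA1_valP.
by exists x; apply: lim_fun hx (lim_ubar z).
Qed.
End Ubar.

(** * Lattices in highest weight modules *)

(** Here reg is the subring of scalars regular at q = 1, and v is a highest weight
vector. *)
Section HighestWeight.
Variables (I : countType) (D : cartan_datum I) (K : fieldType) (q : K).
Local Notation W := (words (Iinf D)).
Variable reg : K -> Prop.
Hypothesis q_neq0 : q != 0.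
Hypothesis q1_neq0 : q - 1 != 0.
Hypothesis q_inj : forall z z' : int, q ^ z = q ^ z' -> z = z'.
Hypothesis regB : forall a b, reg a -> reg b -> reg (a - b).
Hypothesis regM : forall a b, reg a -> reg b -> reg (a * b).
Hypothesis reg_qz : forall z : int, reg (q ^ z).
Hypothesis reg_br : forall z : int, reg ((q ^ z - 1) / (q - 1)).
Hypothesis reg_denom : forall r, (0 < r)%N -> reg ((q - 1) / ((q ^+ r) ^+ 2 - 1)).
Hypothesis reg_proper : forall a, reg a -> (q - 1) * a <> 1.

Variables (A : pzAlgType K) (V : lmodType A) (v : V).
Variables (Qh : Pvee I -> A) (s T : Iinf D -> A).
Hypothesis QD : forall h h', Qh h * Qh h' = Qh (h + h').
Hypothesis QT : forall h x, Qh h * T x =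
  scal (q ^ (- ((lev x)%:Z * wt_val (alpha D (idx x)) h))) * (T x * Qh h).
Hypothesis sT : forall x y, comm (s x) (T y) =
  if x == y then scal ((q ^+ cr D (idx y)) ^+ 2 - 1)^-1 *
    (Qh (Kexp ([:: x] : words (Iinf D))) - Qh (- Kexp ([:: x] : words (Iinf D))))
  else 0.
Variable lam : Pvee I -> int.
Hypothesis lamN : forall h, lam (- h) = - lam h.
Hypothesis Qv : forall h, Qh h *: v = (scal (q ^ lam h) : A) *: v.
Hypothesis sv : forall x, s x *: v = 0.
Hypothesis v_neq0 : v != 0.

Definition word_vec (w : W) : V := fw T w *: v.
Definition word_wt (w : W) (h : Pvee I) : int := lam h - word_alpha h w.

Lemma word_alphaN h (w : W) : word_alpha (- h) w = - word_alpha h w.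
Proof.
by rewrite /word_alpha -sumrN; apply: eq_bigr => x _; rewrite wt_valN mulrN.
Qed.

Lemma Q_word_vec h w : Qh h *: word_vec w = (scal (q ^ word_wt w h) : A) *: word_vec w.
Proof.
rewrite /word_vec scalerA (qh_fw q_neq0 QT) -!scalerA Qv !scalerA.
by rewrite -mulrA -scalC mulrA -rmorphM -expfzDr // addrC.
Qed.

(** The lattice V_A1, described by spanning vectors; see [VA1_span]. *)
Inductive Tspan : V -> Prop :=
| Tspan_word w : Tspan (word_vec w)
| Tspan_0 : Tspan 0
| Tspan_comb c x y of reg c & Tspan x & Tspan y : Tspan ((scal c : A) *: x + y).

Lemma reg1 : reg 1. Proof. by have := reg_qz 0. Qed.
Lemma reg0 : reg 0. Proof. by rewrite -(subrr 1); apply: regB; exact: reg1. Qed.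
Lemma regD a b : reg a -> reg b -> reg (a + b).
Proof. by move=> ha hb; rewrite -[b]opprK -[- b]sub0r; do 2?apply: regB => //; exact: reg0. Qed.
Lemma Tspan_add x y : Tspan x -> Tspan y -> Tspan (x + y).
Proof. by move=> hx hy; have := Tspan_comb reg1 hx hy; rewrite rmorph1 scale1r. Qed.
Lemma Tspan_scal c x : reg c -> Tspan x -> Tspan ((scal c : A) *: x).
Proof. by move=> hc hx; have := Tspan_comb hc hx Tspan_0; rewrite addr0. Qed.
Lemma Tspan_sub x y : Tspan x -> Tspan y -> Tspan (x - y).
Proof.
move=> hx hy; apply: Tspan_add => //.
have := Tspan_scal (regB reg0 reg1) hy.
by rewrite sub0r rmorphN rmorph1 scaleN1r.
Qed.

Lemma Tspan_stable (u : A) : (forall w, Tspan (u *: word_vec w)) ->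
  forall x, Tspan x -> Tspan (u *: x).
Proof.
move=> hu x; elim=> {x} [w||c x y hc _ hx _ hy] //; first by rewrite scaler0; exact: Tspan_0.
rewrite scalerDr scalerA -scalC -scalerA; exact: Tspan_comb.
Qed.

Lemma Tspan_T y x : Tspan x -> Tspan (T y *: x).
Proof.
apply: Tspan_stable => w; rewrite /word_vec scalerA -fw_cons.
exact: (Tspan_word (y :: w)).
Qed.
Lemma Tspan_Q h x : Tspan x -> Tspan (Qh h *: x).
Proof. by apply: Tspan_stable => w; rewrite Q_word_vec; apply: Tspan_scal => //; exact: Tspan_word. Qed.
Lemma q0_eigen h (x : V) (m : int) : Qh h *: x = (scal (q ^ m) : A) *: x ->
  q0 q Qh h *: x = (scal ((q ^ m - 1) / (q - 1)) : A) *: x.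
Proof.
move=> e; rewrite /q0 -scalerA scalerBl e scale1r.
have -> : (scal (q ^ m) : A) *: x - x = (scal (q ^ m - 1) : A) *: x.
  by rewrite rmorphB rmorph1 scalerBl scale1r.
by rewrite scalerA -rmorphM mulrC.
Qed.
Lemma Tspan_q0 h x : Tspan x -> Tspan (q0 q Qh h *: x).
Proof.
apply: Tspan_stable => w; rewrite (q0_eigen (Q_word_vec h w)).
by apply: Tspan_scal => //; exact: Tspan_word.
Qed.

(** (q^z - q^-z) / (q_i^2 - 1) is the product of q^-z, of (q^(2z) - 1) / (q - 1) and of
(q - 1) / (q_i^2 - 1). *)
Lemma reg_K (z : int) r : (0 < r)%N -> reg ((q ^ z - q ^ (- z)) / ((q ^+ r) ^+ 2 - 1)).
Proof.
move=> r0; have -> : q ^ z - q ^ (- z) = (q - 1) * (q ^ (- z) * ((q ^ (z + z) - 1) / (q - 1))).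
  by rewrite mulrCA [(q - 1) * _]mulrC divfK // mulrBr mulr1 -expfzDr // addKr.
rewrite mulrAC; apply: regM; first exact: reg_denom.
exact: regM.
Qed.

(** Move s_y to the right through the word: it ends up killing v, and each commutator
with a T acts on a weight vector by a scalar (q^z - q^-z) / (q_i^2 - 1).  Regularity
of this scalar is what the normalisation of the T's is made for. *)
Lemma Tspan_s y x : Tspan x -> Tspan (s y *: x).
Proof.
apply: Tspan_stable => w; elim: w => [|z w IH].
  by rewrite /word_vec fw_nil scale1r sv; exact: Tspan_0.
have -> : s y *: word_vec (z :: w) = T z *: (s y *: word_vec w) + comm (s y) (T z) *: word_vec w.
  by rewrite /word_vec fw_cons !scalerA -scalerDl /comm mulrBl !mulrA addrC subrK.
apply: Tspan_add; first exact: Tspan_T.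
rewrite sT; case: eqP => [->|_]; last by rewrite scale0r; exact: Tspan_0.
rewrite -scalerA scalerBl !Q_word_vec -scalerBl -rmorphB scalerA -rmorphM mulrC.
apply: Tspan_scal; last exact: Tspan_word.
have -> : word_wt w (- Kexp [:: z]) = - word_wt w (Kexp [:: z]).
  by rewrite /word_wt lamN word_alphaN opprD.
by apply: reg_K; exact: cr_gt0.
Qed.

Variable gen : A -> Prop.
Hypothesis genP : forall u, gen u ->
  [\/ exists x, u = s x, exists x, u = T x, exists h, u = Qh h | exists h, u = q0 q Qh h].

(** The integral form preserves the lattice, because its generators do. *)
Lemma Tspan_subalg u : subalg reg gen u -> forall x, Tspan x -> Tspan (u *: x).
Proof.
elim=> {u} [u /genP [] [a ->]|c hc|u u' _ hu _ hu'|u u' _ hu _ hu'] x hx.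
- exact: Tspan_s.
- exact: Tspan_T.
- exact: Tspan_Q.
- exact: Tspan_q0.
- exact: Tspan_scal.
- by rewrite scalerBl; apply: Tspan_sub; [apply: hu | apply: hu'].
- by rewrite -scalerA; apply: hu; apply: hu'.
Qed.

Lemma Tspan_subalg_v u : subalg reg gen u -> Tspan (u *: v).
Proof.
move=> hu; apply: Tspan_subalg => //; have := Tspan_word [::].
by rewrite /word_vec fw_nil scale1r.
Qed.

Lemma Tspan_sum x : Tspan x -> exists l : seq ({c : K | reg c} * W),
  x = \sum_(p <- l) (scal (sval p.1) : A) *: word_vec p.2.
Proof.
elim=> {x} [w||c x y hc _ [l ->] _ [l' ->]].
- exists [:: (exist _ 1 reg1, w)].
  by rewrite big_seq1 /= rmorph1 scale1r.
- by exists [::]; rewrite big_nil.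
- exists ([seq (exist _ (c * sval p.1) (regM hc (svalP p.1)), p.2) | p <- l] ++ l').
  rewrite big_cat /= big_map scaler_sumr; congr (_ + _); apply: eq_bigr => p _ /=.
  by rewrite scalerA rmorphM.
Qed.

(** The basis element d_i of P^vee, which counts the multiplicity of alpha_i. *)
Definition dcoroot (i : I) : Pvee I := << 1 *g (inr i : (I + I)%type) >>.

(** A nonempty word lowers the weight strictly, as seen by the d_i.  This would fail
with the h_i alone, since the Cartan matrix may be degenerate. *)
Lemma word_alpha_d (y : Iinf D) (w : W) : (0 < word_alpha (dcoroot (idx y)) (y :: w : W))%R.
Proof.
have e (z : Iinf D) : wt_val (alpha D (idx z)) (dcoroot (idx y)) = (idx y == idx z)%:R.
  apply: (@intr_inj rat); rewrite wt_valE /Pvee_in msuppU oner_eq0 big_seq_fset1 mcoeffUU.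
  rewrite /= /alpha_fun lextU /= scale1r; by case: eqP.
rewrite /word_alpha big_cons e eqxx mulr1 ltr_wpDr //; last by rewrite ltz_nat lev_gt0.
by apply: sumr_ge0 => z _; rewrite e mulr_ge0 // ler0n.
Qed.

(** Only the empty word has the weight of v, so in an equality v = (q - 1) x the
component of this weight reads v = (q - 1) c v with c regular.  But q - 1 is not
invertible among the regular scalars. *)
Lemma v_not_divisible x : Tspan x -> v <> (scal (q - 1) : A) *: x.
Proof.
move=> /Tspan_sum [l ->]; rewrite scaler_sumr => e.
pose y (p : {c : K | reg c} * W) := (scal (q - 1) : A) *: ((scal (sval p.1) : A) *: word_vec p.2).
have hy p : is_weight_vec Qh (fun h => q ^ word_wt p.2 h) (y p).
  by do 2!apply: is_weight_vecZ; move=> h; exact: Q_word_vec.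
have := weight_component Qv hy e; rewrite (eq_bigr (fun p => (scal ((q - 1) * sval p.1) : A) *: v)).
  rewrite -scaler_suml -(rmorph_sum (@scal K A)) -mulr_sumr.
  set C := \sum_(p <- l | _) _ => ev.
  have rC : reg C.
    rewrite /C; elim/big_ind: _ => [||p _]; [exact: reg0 | exact: regD | exact: svalP].
  have : (scal (1 - (q - 1) * C) : A) *: v = 0.
    by rewrite rmorphB rmorph1 scalerBl scale1r -ev subrr.
  move/(scal_inj0 _) => hv; case/eqP: v_neq0; apply: hv.
  by rewrite subr_eq0 eq_sym; apply/eqP; exact: reg_proper.
move=> [c [|y0 w]] /asboolP h /=; rewrite /y /=.
  by rewrite /word_vec fw_nil scale1r scalerA -rmorphM.
have /q_inj := congr1 (fun f => f (dcoroot (idx y0))) h.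
rewrite /word_wt /= => /eqP; rewrite -subr_eq0 addrC addKr oppr_eq0 => /eqP e0.
by have := word_alpha_d y0 w; rewrite e0.
Qed.
End HighestWeight.

Section Combinations.
Variables (B : pzAlgType rat) (M : lmodType B) (J : Type) (y : J -> M).
Definition comb (l : seq (rat * J)) : M := \sum_(p <- l) (scal p.1 : B) *: y p.2.

(** By [weight_component], only the terms of weight mu contribute. *)
Lemma comb_weight_ind (H : Type) (X : H -> B) (nu : J -> H -> rat) (mu : H -> rat)
    (P : M -> Prop) (l : seq (rat * J)) :
  (forall j, is_weight_vec X (nu j) (y j)) -> is_weight_vec X mu (comb l) ->
  P 0 -> (forall z z', P z -> P z' -> P (z + z')) ->
  (forall c j, nu j = mu -> P ((scal c : B) *: y j)) -> P (comb l).
Proof.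
move=> hy hl P0 PD PJ.
pose yl (p : rat * J) := (scal p.1 : B) *: y p.2.
have hyl p : is_weight_vec X (nu p.2) (yl p) by apply: is_weight_vecZ.
rewrite (weight_component hl hyl (erefl (comb l))).
by elim/big_ind: _ => // p /asboolP; exact: PJ.
Qed.

Variables (I : countType) (D : cartan_datum I) (K : fieldType) (reg : K -> Prop).
Variables (ev : K -> rat -> Prop) (A : pzAlgType K) (V : lmodType A) (v : V).
Variables (T : Iinf D -> A) (lim : A -> B -> Prop) (limV : V -> M -> Prop).
Hypothesis reg_ev : forall c, reg c -> exists r, ev c r.
Hypothesis limS : forall c r, ev c r -> lim (scal c) (scal r).
Hypothesis limV_0 : limV 0 0.
Hypothesis limV_D : forall x x' z z', limV x z -> limV x' z' -> limV (x + x') (z + z').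
Hypothesis limV_act : forall u a x z, lim u a -> limV x z -> limV (u *: x) (a *: z).
Variable wj : words (Iinf D) -> J.
Hypothesis limV_w : forall w, limV (word_vec v T w) (y (wj w)).

(** A lattice combination of words has as limit the combination with the values of the
coefficients. *)
Lemma comb_lim x : Tspan reg v T x -> exists l, limV x (comb l).
Proof.
elim=> {x} [w||c x x' /reg_ev [r hr] _ [l hl] _ [l' hl']].
- exists [:: (1, wj w)]; rewrite /comb big_seq1 /= rmorph1 scale1r.
  exact: limV_w.
- by exists [::]; rewrite /comb big_nil; exact: limV_0.
exists ([seq (r * p.1, p.2) | p <- l] ++ l'); rewrite /comb big_cat /= big_map.
apply: limV_D => //; rewrite (eq_bigr (fun p => (scal r : B) *: ((scal p.1 : B) *: y p.2))).
  by rewrite -scaler_sumr; exact: limV_act (limS hr) hl.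
by move=> p _ /=; rewrite rmorphM scalerA.
Qed.
End Combinations.

(** * The classical limit of a highest weight module *)

Section Modules.
Variables (I : countType) (D : cartan_datum I) (nu : Iinf D -> Kq).
Variables (L : bozec_data nu) (t : prim_gens L).
Variables (lam : weight I) (V : lmodType (Uq L)) (v : V).
Hypothesis hv : is_highest_weight_q lam v.
Local Notation W := (words (Iinf D)).
Local Notation VA1 := (VA1 t v).
Local Notation V1 := (V1 t v).
Local Notation regA := (fun c : Kq => c \in A1_pred).

(** The analogue of [lim] for vectors. *)
Definition limV (x : V) (y : V1) : Prop := exists2 w : VA1, VA1_val w = x & vbar w = y.

Lemma vbarD (w w' : VA1) : vbar (w + w') = vbar w + vbar w'.
Proof. exact: pure1D. Qed.
Lemma vbar_act (u : UA1 t) (w : VA1) : vbar (VA1_act u w) = ubar u *: vbar w.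
Proof.
exact: (esym (tens_act_pure1 A1modJ1 (VA1_act_bilin t v) u w)).
Qed.
Lemma vbar_surj (y : V1) : exists w, vbar w = y.
Proof. by have [w ->] := tens_pure1 A1_scal_surj y; exists w. Qed.

Lemma limV_fun x y z : limV x y -> limV x z -> y = z.
Proof. by move=> [a ea <-] [b eb <-]; congr vbar; apply: val_inj; exact: etrans ea (esym eb). Qed.
Lemma limV_D x x' y y' : limV x y -> limV x' y' -> limV (x + x') (y + y').
Proof. by move=> [a <- <-] [b <- <-]; exists (a + b); rewrite ?vbarD. Qed.
Lemma limV_0 : limV 0 0.
Proof. by exists 0 => //; exact: pure10. Qed.
Lemma limV_act (u : Uq L) (a : U1 t) x y : lim u a -> limV x y -> limV (u *: x) (a *: y).
Proof. by move=> [b <- <-] [w <- <-]; exists (VA1_act b w); rewrite ?vbar_act. Qed.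
Lemma limV_vbar (w : VA1) : limV (VA1_val w) (vbar w). Proof. by exists w. Qed.
Lemma limV_v : limV v (v0bar t v).
Proof. by exists (InVA1 (v0_in_VA1 t v)). Qed.

(** (q^h; 0)_q acts on x by (q^m - 1) / (q - 1), which has value m. *)
Lemma limV_weight x y (m : Pvee I -> int) :
  (forall h, Uq_q L h *: x = (scal (qq ^ m h) : Uq L) *: x) -> limV x y ->
  forall h, hbar t h *: y = (scal (m h)%:~R : U1 t) *: y.
Proof.
move=> hx xy h; apply: limV_fun (limV_act (lim_h t h) xy) _.
have -> : q0 qq (@Uq_q I D nu L) h *: x = (scal ((qq ^ m h - 1) / (qq - 1)) : Uq L) *: x.
  exact: (@q0_eigen I Kq qq (Uq L) V (@Uq_q I D nu L) h x (m h) (hx h)).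
exact: limV_act (limS t (ev_br (m h))) xy.
Qed.

Lemma hbarQP c h h' : hbarQ t (c *: h + h') = scal c * hbarQ t h + hbarQ t h'.
Proof. exact: (@hQP I (U1 t) (hbar t) c h h'). Qed.

Lemma hbarQ_weight (y : V1) (mu : cartan I -> rat) :
  (forall c h h', mu (c *: h + h') = c * mu h + mu h') ->
  (forall h : Pvee I, hbar t h *: y = (scal (mu (Pvee_in h)) : U1 t) *: y) ->
  forall h, hbarQ t h *: y = (scal (mu h) : U1 t) *: y.
Proof.
move=> mP hy; apply: (@cartan_weight I (U1 t) V1 (hbarQ t) y mu hbarQP mP) => h.
by rewrite hbarQ_Pvee.
Qed.

Local Notation Sp := (@Tspan I D Kq (fun c : Kq => c \in A1_pred) (Uq L) V v (T_ t)).
Local Notation wv := (@word_vec I D Kq (Uq L) V v (T_ t)).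
Local Notation ww := (@word_wt I D (wt_val lam)).

Lemma regz z : qq ^ z \in A1_pred. Proof. exact: ev_A1 (ev_qz z). Qed.
Lemma regbr z : (qq ^ z - 1) / (qq - 1) \in A1_pred. Proof. exact: ev_A1 (ev_br z). Qed.
Lemma regden r : (0 < r)%N -> (qq - 1) / ((qq ^+ r) ^+ 2 - 1) \in A1_pred.
Proof. move=> h; exact: ev_A1 (ev_denom h). Qed.
Lemma regsub a b : a \in A1_pred -> b \in A1_pred -> a - b \in A1_pred.
Proof. exact: rpredB. Qed.
Lemma regmul a b : a \in A1_pred -> b \in A1_pred -> a * b \in A1_pred.
Proof. exact: rpredM. Qed.

Lemma UA1_gen_cases u : UA1_gen t u -> [\/ exists x, u = s_ t x, exists x, u = T_ t x,
  exists h, u = Uq_q L h | exists h, u = q0 qq (@Uq_q I D nu L) h].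
Proof.
case=> [x|x|h|h].
- by apply: Or41; exists x.
- by apply: Or42; exists x.
- by apply: Or43; exists h.
- by apply: Or44; exists h.
Qed.

Lemma VA1_span (w : VA1) : Sp (VA1_val w).
Proof.
case: w => w w_in /=; case/asboolP: (w_in) => u /asboolP hu ->.
exact: (@Tspan_subalg_v I D Kq qq regA qq_neq0 qq1_neq0 regsub regmul regz regbr regden
  (Uq L) V v (@Uq_q I D nu L) (s_ t) (T_ t) (Uq_q_T t) (s_T_comm t)
  (wt_val lam) (wt_valN lam) (hwq_q hv) (s_kill t (hwq_e hv)) (UA1_gen t) UA1_gen_cases u hu).
Qed.

Lemma Uq_q_word_vec h w : Uq_q L h *: wv w = (scal (qq ^ ww w h) : Uq L) *: wv w.
Proof.
exact: (@Q_word_vec I D Kq qq qq_neq0 (Uq L) V v (@Uq_q I D nu L) (T_ t) (Uq_q_T t)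
  (wt_val lam) (hwq_q hv) h w).
Qed.

(** Otherwise v_lambda would be q - 1 times an element of the lattice. *)
Lemma v0bar_neq0 : v0bar t v != 0.
Proof.
apply/eqP => e; have [w ew] := pure1_eq0 A1_scal_surj A1_scal_ker e.
have := @v_not_divisible I D Kq qq regA qq_neq0 qqz_inj regsub regmul regz A1_proper
  (Uq L) V v (@Uq_q I D nu L) (T_ t) (Uq_q_T t) (wt_val lam) (hwq_q hv) (hwq_neq0 hv) _ (VA1_span w).
apply; exact: (congr1 (@VA1_val _ _ _ _ _ _ _) ew).
Qed.

Lemma word_in_UA1 (w : W) : in_UA1 t (fw (T_ t) w).
Proof.
elim: w => [|x w IH].
  by rewrite fw_nil; have /asboolP := UA1_valP (1 : UA1 t); exact.
by rewrite fw_cons; apply: subalg_M => //; apply: subalg_gen; exact: UA1_T.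
Qed.
Lemma word_vec_in_VA1 (w : W) : wv w \in VA1_pred t v.
Proof. by apply/asboolP; exists (fw (T_ t) w) => //; apply/asboolP; exact: word_in_UA1. Qed.
Definition word_bar (w : W) : V1 := vbar (InVA1 (word_vec_in_VA1 w)).
Lemma limV_word_bar w : limV (wv w) (word_bar w).
Proof. by exists (InVA1 (word_vec_in_VA1 w)). Qed.

Local Notation comb1 := (@comb (U1 t) V1 W word_bar).
Lemma V1_span (y : V1) : exists l, y = comb1 l.
Proof.
have [w ew] := vbar_surj y; have [l hl] := @comb_lim (U1 t) V1 W word_bar I D Kq regA ev
  (Uq L) V v (T_ t) (@lim I D nu L t) limV (@evP) (limS t) limV_0 limV_D limV_act id
  limV_word_bar _ (VA1_span w).
by exists l; rewrite -ew; exact: limV_fun (limV_vbar w) hl.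
Qed.

(** The weight of a word as a linear form on the rational Cartan subalgebra; on P^vee
it is the integral weight of the word before the limit. *)
Definition word_wtQ (w : W) (h : cartan I) : rat :=
  lam h - \sum_(x <- w) (lev x)%:R * (alpha D (idx x) h : rat).
Lemma word_wtQ_Pvee w h : word_wtQ w (Pvee_in h) = (ww w h)%:~R.
Proof.
rewrite /word_wtQ /word_wt rmorphB /= wt_valE /word_alpha rmorph_sum /=; congr (_ - _).
by apply: eq_bigr => x _; rewrite intrM wt_valE.
Qed.
Lemma word_wtQP w c h h' : word_wtQ w (c *: h + h') = c * word_wtQ w h + word_wtQ w h'.
Proof.
rewrite /word_wtQ linearP mulrBr addrACA -opprD; congr (_ - _).
rewrite mulr_sumr -big_split; apply: eq_bigr => x _ /=.
by rewrite linearP mulrDr mulrCA.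
Qed.
Lemma word_bar_weight w h : hbarQ t h *: word_bar w = (scal (word_wtQ w h) : U1 t) *: word_bar w.
Proof.
move: h; apply: hbarQ_weight => [|h]; first exact: word_wtQP.
rewrite word_wtQ_Pvee.
by apply: limV_weight (limV_word_bar w) h => k; exact: Uq_q_word_vec.
Qed.

Section Weight.
Variable mu : weight I.
Local Notation V1mu := (V1mu t v mu).

Lemma V1mu_incl_pure (w : VA1mu t v mu) :
  V1mu_incl (pure ((1 : A1modJ1) : algmod A1modJ1) w : V1mu) = vbar (VA1mu_incl w).
Proof.
apply: tlift_pure; have [hl hr] := pure_bilin (algmod A1modJ1) VA1.
split=> [n a m m'|m a n n']; first exact: hl.
by rewrite -hr; congr pure; apply: val_inj.
Qed.

(** Every element of V^1_mu is the class of a single weight vector of the lattice. *)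
Lemma V1mu_image (y : V1) :
  (exists w' : V1mu, V1mu_incl w' = y) <-> exists2 x, x \in VA1mu_pred t v mu & limV x y.
Proof.
split=> [[w' <-]|[x hx [w ew <-]]].
  have [w ->] := tens_pure1 A1_scal_surj w'; exists (VA1mu_val w); first exact: VA1mu_valP.
  by rewrite V1mu_incl_pure; exists (VA1mu_incl w).
exists (pure ((1 : A1modJ1) : algmod A1modJ1) (InVA1mu hx)); rewrite V1mu_incl_pure.
by congr vbar; apply: val_inj.
Qed.

Lemma V1mu_weight (h : Pvee I) (w : V1mu) :
  hbar t h *: V1mu_incl w = (scal (mu (Pvee_in h) : rat) : U1 t) *: V1mu_incl w.
Proof.
have [x /andP [_ /asboolP hx] lx] := (V1mu_image (V1mu_incl w)).1 (ex_intro _ w erefl).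
by rewrite -wt_valE; exact: limV_weight hx lx h.
Qed.

Lemma V1mu_weightQ (w : V1mu) h :
  hbarQ t h *: V1mu_incl w = (scal (mu h : rat) : U1 t) *: V1mu_incl w.
Proof.
move: h; apply: hbarQ_weight => [c h h'|h]; first by rewrite linearP.
exact: V1mu_weight.
Qed.

(** If x - x' = (q - 1) u with x and x' of weight mu, then u has weight mu as well, so
x and x' already have the same class in V^1_mu. *)
Lemma V1mu_incl_inj : injective (@V1mu_incl I D nu L t V v mu).
Proof.
move=> z z'; have [w ->] := tens_pure1 A1_scal_surj z.
have [w' ->] := tens_pure1 A1_scal_surj z' => e0.
have e := etrans (esym (V1mu_incl_pure w)) (etrans e0 (V1mu_incl_pure w')).
have [u eu] := pure1_eq A1_scal_surj A1_scal_ker e.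
have eV : VA1mu_val w - VA1mu_val w' = (scal (qq - 1) : Uq L) *: VA1_val u.
  exact: (congr1 (@VA1_val _ _ _ _ _ _ _) eu).
have hu : VA1_val u \in VA1mu_pred t v mu.
  apply/andP; split; first exact: VA1_valP.
  apply/asboolP => h; apply: (@eigen_cancel Kq (Uq L) V (qq - 1) _ _ _ qq1_neq0).
  rewrite -eV; have /andP [_ /asboolP] := VA1mu_valP (w - w'); exact.
apply: (@pure1_mod A1 A1modJ1 _ q1_A1 A1_scal_tt _ _ (InVA1mu hu)).
by apply: val_inj; exact: eV.
Qed.

(** Write y as a rational combination of classes of words; only the words of weight mu
contribute, and these are of weight mu before the limit since the integral weights
of a word determine its eigenvalues.  So y lifts to a weight vector of the lattice. *)
Lemma V1mu_weight_space (y : V1) :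
  (forall h, hbarQ t h *: y = (scal (mu h : rat) : U1 t) *: y) ->
  exists w' : V1mu, V1mu_incl w' = y.
Proof.
move=> hy; apply/V1mu_image; have [l el] := V1_span y; rewrite el.
rewrite el in hy.
apply: (@comb_weight_ind (U1 t) V1 W word_bar (cartan I) (hbarQ t) word_wtQ
  (fun h => mu h : rat)
  (fun z => exists2 x, x \in VA1mu_pred t v mu & limV x z) l word_bar_weight hy)
  => [|y1 y2 [x1 hx1 l1] [x2 hx2 l2]|c w hp].
- exists 0; [exact: rpred0 | exact: limV_0].
- exists (x1 + x2); [exact: rpredD | exact: limV_D].
(* Rational coefficients lift to constants of A_1. *)
exists ((scal (frac_of c%:P) : Uq L) *: wv w); last first.
  exact: limV_act (limS t (ev_rat c)) (limV_word_bar w).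
have w_in : wv w \in VA1mu_pred t v mu.
  apply/andP; split; first exact: word_vec_in_VA1.
  apply/asboolP => h; rewrite Uq_q_word_vec; congr (scal (qq ^ _) *: _).
  apply: (@intr_inj rat); rewrite -word_wtQ_Pvee wt_valE.
  exact: (congr1 (fun f => f (Pvee_in h)) hp).
exact: (VA1mu_scale_subproof (rat_A1 c) (InVA1mu w_in)).
Qed.
End Weight.

Lemma v0bar_s x : sbar t x *: v0bar t v = 0.
Proof.
apply: limV_fun (limV_act (lim_s t x) limV_v) _.
by rewrite (s_kill t (hwq_e hv)); exact: limV_0.
Qed.
Lemma v0bar_weight h : hbarQ t h *: v0bar t v = (scal (lam h : rat) : U1 t) *: v0bar t v.
Proof.
move: h; apply: hbarQ_weight => [c h h'|h]; first by rewrite linearP.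
by rewrite -wt_valE; exact: limV_weight (hwq_q hv) limV_v h.
Qed.

(** Every vector of V_A1 is u v_lambda with u in the integral form, and the class of u
is in the image of psi. *)
Lemma v0bar_gen (y : V1) : exists u : Ug D, y = psi t u *: v0bar t v.
Proof.
have [w ew] := vbar_surj y; have /asboolP [z /asboolP hz e] := VA1_valP w.
have [x hx] := lim_psi hz; exists x; rewrite -ew.
by apply: limV_fun (limV_act hx limV_v); rewrite -e; exact: limV_vbar.
Qed.
End Modules.

Section PullbackFacts.
Variables (I : countType) (D : cartan_datum I) (B : pzAlgType rat) (M : lmodType B).
Variables (phi : {rmorphism Ug D -> B}) (H : cartan I -> B) (E : Iinf D -> B).
Hypothesis phi_h : forall h, phi (Ug_h D h) = H h.
Hypothesis phi_e : forall x, phi (Ug_e x) = E x.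
Hypothesis phi_scal : forall c : rat, phi (scal c) = scal c.

(** Acting through phi, the Cartan subalgebra has the eigenspaces of the images of the
h's as weight spaces. *)
Lemma weight_pullback (mu : weight I) (w : M) :
  in_weight_space mu (w : pullback phi M) <->
  forall h, H h *: w = (scal (mu h : rat) : B) *: w.
Proof. by split=> wt_w h; move: (wt_w h); rewrite -phi_h -phi_scal. Qed.

Lemma highest_weight_pullback (lam : weight I) (w : M) :
  w != 0 -> (forall x, E x *: w = 0) ->
  (forall h, H h *: w = (scal (lam h : rat) : B) *: w) ->
  (forall z : M, exists u, z = phi u *: w) ->
  is_highest_weight lam (w : pullback phi M).
Proof.
move=> w0 wE wh wg; split=> //; last exact/weight_pullback.
by move=> x; have := wE x; rewrite -phi_e.
Qed.
End PullbackFacts.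

Theorem theorem4p3 (I : countType) (D : cartan_datum I)
  (nu : Iinf D -> Kq)
  (nu_neq0 : forall x, nu x != 0)
  (nu_series : forall x, one_plus_q_nat_series (nu x))
  (L : bozec_data nu) (t : prim_gens L)
  (lam : weight I) (Vq : lmodType (Uq L)) (v : Vq)
  (hv : is_highest_weight_q lam v) :
  (* (a) *)
  [/\ forall h : Pvee I, hbarQ t (Pvee_in h) = hbar t h,
      forall r : U1 t, Ug_rel (hbarQ t) (sbar t) (Tbar t) r -> r = 0
    & exists psi : {rmorphism Ug D -> U1 t},
      [/\ [/\ forall c : rat, psi (scal c) = scal c,
              forall u : U1 t, exists x : Ug D, psi x = u,
              forall x : Iinf D, psi (Ug_e x) = sbar t x,
              forall x : Iinf D, psi (Ug_f x) = Tbar t x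
            & forall h : Pvee I, psi (Ug_h D (Pvee_in h)) = hbar t h],
  (* (b) *)
          forall mu : weight I,
          [/\ forall (h : Pvee I) (w : V1mu t v mu),
                hbar t h *: V1mu_incl w
                = (scal (mu (Pvee_in h) : rat) : U1 t) *: V1mu_incl w,
              injective (@V1mu_incl I D nu L t Vq v mu)
            & forall w : V1 t v,
                (exists w' : V1mu t v mu, V1mu_incl w' = w) <->
                in_weight_space mu (w : pullback psi (V1 t v))]
  (* (c) *)
        & is_highest_weight lam (v0bar t v : pullback psi (V1 t v))]].
Proof.
split; [exact: hbarQ_Pvee | exact: U1_relations |].
have psiP := psi_alg_hom t.
pose psiB := GRing.isZmodMorphism.Build (Ug D) (U1 t) (@psi I D nu L t) (let: And3 h _ _ := psiP in h).
pose psiM := GRing.isMonoidMorphism.Build (Ug D) (U1 t) (@psi I D nu L t) (let: And3 _ h _ := psiP in h).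
pose psiR : {rmorphism Ug D -> U1 t} := HB.pack (@psi I D nu L t) psiB psiM.
exists psiR; split.
- split.
  + exact: (alg_homS psiP).
  + exact: psi_surj.
  + exact: psi_e.
  + exact: psi_f.
  + by move=> h; apply: etrans (psi_h t _) _; exact: hbarQ_Pvee.
- move=> mu; split.
  + exact: V1mu_weight.
  + exact: V1mu_incl_inj.
  + move=> w; apply: iff_trans
      (iff_sym (@weight_pullback I D (U1 t) (V1 t v) psiR _ (psi_h t) (alg_homS psiP) mu w)).
    split; last exact: (V1mu_weight_space hv).
    by case=> w' <-; exact: (V1mu_weightQ w').
- apply: (@highest_weight_pullback I D (U1 t) (V1 t v) psiR _ _ (psi_h t) (psi_e t)
    (alg_homS psiP)).
  + exact: v0bar_neq0 hv.
  + exact: v0bar_s hv.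
  + exact: v0bar_weight hv.
  + exact: v0bar_gen.
Qed.
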